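(* For every fixed $k\geq 1$, the context-free membership problem for black box groups restricted to context-free grammars from $\mathrm{CFG}(k)$ is in $\mathbf{NP}$. Here the problem is: given a finite group $G$ (accessed via a black box) and a context-free grammar $\mathcal{G}\in\mathrm{CFG}(k)$ with terminal alphabet $G$, does $1\in L(\mathcal{G})$ hold?
   Context: A black box is a tuple $B=(b,c,\mathsf{valid},\mathsf{inv},\mathsf{prod},\mathsf{id},G,f)$ where $G$ is a finite group, $b,c\in\mathbb{N}$, and: - $f:\{0,1\}^b\to G\uplus\{\ast\}$ is a mapping with $G\subseteq f(\{0,1\}^b)$ (the strings in $f^{-1}(g)$ are the names of $g\in G$); - $\mathsf{valid}:\{0,1\}^b\to\{\mathsf{yes},\mathsf{no}\}$ with $\mathsf{valid}(x)=\mathsf{yes}$ iff $f(x)\in G$; - $\mathsf{inv}:\{0,1\}^b\to\{0,1\}^b$ with $f(\mathsf{inv}(x))=f(x)^{-1}$ for all $x\in f^{-1}(G)$; - $\mathsf{prod}:\{0,1\}^b\times\{0,1\}^b\to\{0,1\}^b$ with $f(\mathsf{prod}(x,y))=f(x)f(y)$ for all $x,y\in f^{-1}(G)$; - $\mathsf{id}:\{0,1\}^b\times\{0,1\}^c\to\{\mathsf{yes},\mathsf{no}\}$ such that for all $x\in f^{-1}(G)$: $f(x)=1$ iff there is $y\in\{0,1\}^c$ with $\mathsf{id}(x,y)=\mathsf{yes}$. A black box Turing machine $T$ is a (deterministic or nondeterministic) oracle Turing machine with an oracle tape and four query states, one for each of $\mathsf{valid},\mathsf{inv},\mathsf{prod},\mathsf{id}$.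 When coupled with a black box $B$ (written $T_B$), entering a query state replaces, in one step, the content of the oracle tape by the value of the corresponding function on the first $b$ (for $\mathsf{valid},\mathsf{inv}$), $2b$ (for $\mathsf{prod}$), resp. $b+c$ (for $\mathsf{id}$) bits of the oracle tape. The input of $T$ consists of the unary encoded numbers $b$ and $c$ and additional input $X$; the black box itself is not part of the input. A problem $\mathcal{P}$ whose instances are pairs $(G,X)$ of a finite group $G$ and additional data $X$ (possibly containing elements of $G$) belongs to $\mathbf{NP}$ for black box groups if there is a nondeterministic black box Turing machine $T$ such that for every black box $B=(b,c,\mathsf{valid},\mathsf{inv},\mathsf{prod},\mathsf{id},G,f)$, $T_B$ accepts input $b,c,X$ (group elements in $X$ being represented by names from $f^{-1}(G)$) if and only if $(G,X)\in\mathcal{P}$, and the running time of $T_B$ is polynomial in $b+c+|X|$. Here $X$ is the grammar $\mathcal{G}$. Words over the alphabet $G$ are identified with the group elements they evaluate to, so $1\in L(\mathcal{G})$ means that $\mathcal{G}$ generates a word evaluating to the identity of $G$. The restriction to $\mathrm{CFG}(k)$ is a promise: the machine has to be correct on inputs with $\mathcal{G}\in\mathrm{CFG}(k)$. Context-free grammars are in Chomsky normal form (productions $A\to BC$ or $A\to g$ with $A,B,C$ nonterminals and $g$ a terminal). In a derivation tree the root is labelled with the start nonterminal and every leaf is labelled with a terminal. A derivation tree is acyclic if no nonterminal appears twice on a path from the root to a leaf. The Horton-Strahler number $\mathrm{hs}(t)$ of a binary tree $t$ (every inner node has exactly two children) is defined recursively: if $t$ is a single node, $\mathrm{hs}(t)=0$.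 Otherwise, let $t_1,t_2$ be the subtrees rooted in the two children of the root; if $\mathrm{hs}(t_1)=\mathrm{hs}(t_2)$ then $\mathrm{hs}(t)=1+\mathrm{hs}(t_1)$, and otherwise $\mathrm{hs}(t)=\max\{\mathrm{hs}(t_1),\mathrm{hs}(t_2)\}$. The Horton-Strahler number of a derivation tree is that of the binary tree obtained by removing all terminal-labelled leaves. $\mathrm{CFG}(k)$ is the set of all context-free grammars in Chomsky normal form such that every acyclic derivation tree has Horton-Strahler number at most $k$. *)

(* Defs.v *)
From HB Require Import structures.
From Stdlib Require List.
From Stdlib Require Export Relation_Operators.
From mathcomp Require Export all_boot all_algebra all_fingroup.

Set Implicit Arguments.
Unset Strict Implicit.
Unset Printing Implicit Defensive.

(** * Black boxes *)

(* The point [None] of [option G] plays the role of the extra point [*]. *)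
Record blackBox := BlackBox {
  bb_b : nat;
  bb_c : nat;
  bb_group : finGroupType;
  bb_f : bb_b.-tuple bool -> option bb_group;
  bb_valid : bb_b.-tuple bool -> bool;
  bb_inv : bb_b.-tuple bool -> bb_b.-tuple bool;
  bb_prod : bb_b.-tuple bool -> bb_b.-tuple bool -> bb_b.-tuple bool;
  bb_id : bb_b.-tuple bool -> bb_c.-tuple bool -> bool;
  bb_fP : forall g : bb_group, exists x, bb_f x = Some g;
  bb_validP : forall x, bb_valid x <-> exists g, bb_f x = Some g;
  bb_invP : forall x g, bb_f x = Some g -> bb_f (bb_inv x) = Some g^-1%g;
  bb_prodP : forall x y g h, bb_f x = Some g -> bb_f y = Some h ->
    bb_f (bb_prod x y) = Some (g * h)%g;
  bb_idP : forall x g, bb_f x = Some g -> (g = 1%g <-> exists y, bb_id x y)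
}.

(** * Black box Turing machines *)

(* Tapes are infinite to the right only; [cells] lists a finite prefix, with
   [None] the blank, and all cells beyond it are blank. A left move on cell 0
   leaves the head in place. *)
Record tape (S : Type) := Tape { cells : seq (option S); head_pos : nat }.

Variant move := MoveLeft | Stay | MoveRight.

Definition read S (t : tape S) : option S := nth None (cells t) (head_pos t).

Definition write S (s : option S) (t : tape S) : tape S :=
  Tape (set_nth None (cells t) (head_pos t) s) (head_pos t).

Definition shift S (m : move) (t : tape S) : tape S :=
  Tape (cells t) (match m with
                  | MoveLeft => (head_pos t).-1
                  | Stay => head_pos t
                  | MoveRight => (head_pos t).+1
                  end).

Definition blank_tape S : tape S := Tape [::] 0.

Variant query := QValid | QInv | QProd | QId.

(* Input words are over {0, 1, #}, where [None] is #. *)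
Definition letter := option bool.

Record action (Q Gamma : Type) (m : nat) := Action {
  a_state : Q;
  a_input_move : move;
  a_oracle_write : option bool;
  a_oracle_move : move;
  a_work : {ffun 'I_m -> option Gamma * move}
}.

(* A nondeterministic machine with a read-only input tape, [tm_tapes] work tapes
   over the alphabet [tm_sym] plus blank, and an oracle tape over bits plus
   blank. [tm_delta] returns the finite list of possible actions; the first
   [option] in the type of the scanned input symbol is for the blank. *)
Record bbTM := BBTM {
  tm_state : finType;
  tm_sym : finType;
  tm_tapes : nat;
  tm_start : tm_state;
  tm_accept : pred tm_state;
  tm_query : query -> tm_state;
  tm_query_inj : injective tm_query;
  tm_delta : tm_state -> option letter -> option bool ->
    {ffun 'I_tm_tapes -> option tm_sym} -> seq (action tm_state tm_sym tm_tapes)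
}.

Record config (T : bbTM) := Config {
  c_state : tm_state T;
  c_input : tape letter;
  c_oracle : tape bool;
  c_work : {ffun 'I_(tm_tapes T) -> tape (tm_sym T)}
}.

(* The [n] bits of the tape starting at cell [i]; a blank is read as 0. *)
Definition tape_bits (t : tape bool) (i n : nat) : n.-tuple bool :=
  [tuple odflt false (nth None (cells t) (i + j)) | j < n].

Definition oracle_answer (B : blackBox) (q : query) (t : tape bool) : seq bool :=
  let b := bb_b B in
  let c := bb_c B in
  match q with
  | QValid => [:: bb_valid (tape_bits t 0 b)]
  | QInv => bb_inv (tape_bits t 0 b)
  | QProd => bb_prod (tape_bits t 0 b) (tape_bits t b b)
  | QId => [:: bb_id (tape_bits t 0 b) (tape_bits t b c)]
  end.

(* The answer becomes the whole content of the oracle tape (yes = 1, no = 0) and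
   the oracle head returns to cell 0. *)
Definition oracle_update (B : blackBox) (T : bbTM) (s : tm_state T)
    (t : tape bool) : tape bool :=
  let ask q := Tape (map Some (oracle_answer B q t)) 0 in
  if s == tm_query T QValid then ask QValid
  else if s == tm_query T QInv then ask QInv
  else if s == tm_query T QProd then ask QProd
  else if s == tm_query T QId then ask QId
  else t.

(* The oracle is consulted within the very step that enters a query state. *)
Definition apply_action (B : blackBox) (T : bbTM) (c : config T)
    (a : action (tm_state T) (tm_sym T) (tm_tapes T)) : config T :=
  Config (a_state a)
    (shift (a_input_move a) (c_input c))
    (oracle_update B (a_state a)
       (shift (a_oracle_move a) (write (a_oracle_write a) (c_oracle c))))
    [ffun i => shift (a_work a i).2 (write (a_work a i).1 (c_work c i))].

Definition step (B : blackBox) (T : bbTM) (c c' : config T) : Prop :=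
  exists a,
    List.In a (tm_delta (c_state c) (read (c_input c)) (read (c_oracle c))
                 [ffun i => read (c_work c i)])
    /\ c' = apply_action B c a.

Fixpoint run (B : blackBox) (T : bbTM) (n : nat) (c c' : config T) : Prop :=
  match n with
  | 0 => c = c'
  | n'.+1 => exists d, step B c d /\ run B n' d c'
  end.

(* 1^b # 1^c # X *)
Definition input_word (b c : nat) (X : seq letter) : seq letter :=
  nseq b (Some true) ++ None :: nseq c (Some true) ++ None :: X.

Definition init (T : bbTM) (b c : nat) (X : seq letter) : config T :=
  Config (tm_start T) (Tape (map Some (input_word b c X)) 0) (blank_tape bool)
    [ffun _ => blank_tape (tm_sym T)].

Definition halted (B : blackBox) (T : bbTM) (c : config T) : Prop :=
  ~ exists c', step B c c'.

Definition accepts (B : blackBox) (T : bbTM) (X : seq letter) : Prop :=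
  exists n c, [/\ run B n (init T (bb_b B) (bb_c B) X) c, halted B c
                & tm_accept (c_state c)].

(* Every computation, accepting or not, has at most [N] steps. *)
Definition halts_within (B : blackBox) (T : bbTM) (X : seq letter) (N : nat) : Prop :=
  forall n c, run B n (init T (bb_b B) (bb_c B) X) c -> n <= N.

(** * Problems for black box groups *)

(* [encodes B I X] means that the word [X] is an encoding of the additional data
   [I] in which group elements are given by names with respect to [B]. An
   instance may have many encodings, as group elements may have many names. *)
Record problem := Problem {
  instance : finGroupType -> Type;
  holds : forall G : finGroupType, instance G -> Prop;
  encodes : forall B : blackBox, instance (bb_group B) -> seq letter -> Prop
}.

(* Correctness is required on the instances in [D] only, the polynomial time
   bound on all words. *)
Definition in_NP_restricted (P : problem)
    (D : forall G : finGroupType, instance P G -> Prop) : Prop :=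
  exists (T : bbTM) (p : {poly nat}),
    (forall (B : blackBox) (X : seq letter),
        halts_within B T X (p.[(bb_b B + bb_c B + size X)%N])%R)
    /\ (forall (B : blackBox) (I : instance P (bb_group B)) (X : seq letter),
        D (bb_group B) I -> encodes I X -> (accepts B T X <-> holds I)).

(** * Context-free grammars in Chomsky normal form *)

(* [(A, inl (B, C))] is the production A -> BC and [(A, inr g)] is A -> g. *)
Definition production (N S : Type) : Type := N * (N * N + S).

Record cfg (S : finType) := Cfg {
  nonterm : finType;
  start : nonterm;
  prods : {set nonterm * (nonterm * nonterm + S)}
}.

Section Grammar.

Variables (S : finType) (Gr : cfg S).
Let N := nonterm Gr.

Definition rhs_word (r : N * N + S) : seq (N + S) :=
  match r with
  | inl (A1, A2) => [:: inl A1; inl A2]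
  | inr g => [:: inr g]
  end.

Inductive derives1 : seq (N + S) -> seq (N + S) -> Prop :=
| Derives1 u v A r : (A, r) \in prods Gr ->
    derives1 (u ++ inl A :: v) (u ++ rhs_word r ++ v).

Definition language (w : seq S) : Prop :=
  clos_refl_trans _ derives1 [:: inl (start Gr)] (map inr w).

End Grammar.

(* [DLeaf A g] is a node labelled A whose only child is a leaf labelled g. *)
Inductive dtree (N S : Type) :=
| DLeaf of N & S
| DNode of N & dtree N S & dtree N S.

Definition root_label N S (t : dtree N S) : N :=
  match t with DLeaf A _ => A | DNode A _ _ => A end.

Fixpoint uses_prods (S : finType) (Gr : cfg S) (t : dtree (nonterm Gr) S) : bool :=
  match t with
  | DLeaf A g => (A, inr g) \in prods Gr
  | DNode A t1 t2 =>
      [&& (A, inl (root_label t1, root_label t2)) \in prods Gr,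
          uses_prods t1 & uses_prods t2]
  end.

Definition derivation_tree (S : finType) (Gr : cfg S) (t : dtree (nonterm Gr) S) : Prop :=
  root_label t = start Gr /\ uses_prods t.

(* The sequences of nonterminals along the paths from the root to the leaves. *)
Fixpoint paths N S (t : dtree N S) : seq (seq N) :=
  match t with
  | DLeaf A _ => [:: [:: A]]
  | DNode A t1 t2 => map (cons A) (paths t1 ++ paths t2)
  end.

Definition acyclic (N : eqType) S (t : dtree N S) : bool := all uniq (paths t).

Inductive bintree := BLeaf | BNode of bintree & bintree.

Fixpoint hs (t : bintree) : nat :=
  match t with
  | BLeaf => 0
  | BNode t1 t2 => if hs t1 == hs t2 then (hs t1).+1 else maxn (hs t1) (hs t2)
  end.

Fixpoint remove_terminals N S (t : dtree N S) : bintree :=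
  match t with
  | DLeaf _ _ => BLeaf
  | DNode _ t1 t2 => BNode (remove_terminals t1) (remove_terminals t2)
  end.

Definition CFG (k : nat) (S : finType) (Gr : cfg S) : Prop :=
  forall t : dtree (nonterm Gr) S,
    derivation_tree t -> acyclic t -> hs (remove_terminals t) <= k.

(** * Context-free membership *)

Definition terminated (s : seq bool) : seq letter := rcons (map Some s) None.

Definition production_word (N : Type) (b : nat) (code : N -> seq bool)
    (p : production N (b.-tuple bool)) : seq letter :=
  match p with
  | (A, inl (A1, A2)) =>
      Some true :: terminated (code A) ++ terminated (code A1) ++ terminated (code A2)
  | (A, inr x) => Some false :: terminated (code A) ++ terminated x
  end.

(* Replaces the name of a terminal by the group element; [None] if the string
   names no element. *)
Definition named_rhs (B : blackBox) (N : Type) (r : N * N + (bb_b B).-tuple bool) :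
    option (N * N + bb_group B) :=
  match r with
  | inl AA => Some (inl AA)
  | inr x => omap inr (bb_f x)
  end.

(* A grammar is given by its start symbol followed by a list of its productions,
   where [code] represents nonterminals by arbitrary distinct bit strings and
   each occurrence of a terminal may be represented by any of its names. *)
Definition cfg_encodes (B : blackBox) (Gr : cfg (bb_group B)) (X : seq letter) : Prop :=
  exists (code : nonterm Gr -> seq bool)
         (ps : seq (production (nonterm Gr) ((bb_b B).-tuple bool))),
    [/\ injective code,
        (forall A r, (A, r) \in prods Gr <->
           exists2 r', (A, r') \in ps & named_rhs r' = Some r),
        (forall A r', (A, r') \in ps -> named_rhs r' <> None)
      & X = terminated (code (start Gr)) ++ flatten (map (production_word code) ps)].

Definition cf_membership : problem :=
  @Problem (fun G => cfg G)
    (fun G Gr => exists w : seq G, language Gr w /\ (\prod_(g <- w) g)%g = 1%g)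
    cfg_encodes.

(* Main.v *)
(* A fact [valf A g] says that the nonterminal A generates g, a fact [ctxf A B (g, h)]
   that A generates g x h^-1 whenever B generates x. Six rules derive facts from facts,
   and the machine guesses a polynomially long derivation of [valf S 1], storing on a
   tape names for the elements involved. Since G is finite, contexts from A to A can be
   inverted, so they generate a subgroup of G x G.

   Short derivations exist by three arguments. First, attach to a set of facts the groups
   <<x^-1 y>> of quotients of known values of A and the groups generated by the known
   loops at A. Each can grow only log |G| times, so after polynomially many rules no
   short derivation enlarges them; then the values of A lie in one coset of the first
   group, and every loop at A lies in the second. Second, the cubes of Babai and Szemeredi
   write each element of a loop group as a short product. Third, cutting out all loops
   turns a derivation tree into an acyclic one, which has at most n^k leaves when its
   Horton-Strahler number is at most k; the loops are then put back.

   The machine is the graph of a nondeterministic program, run under a clock: a mixed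
   radix counter whose digits are the positions of heads moving to and fro. *)
From Stdlib Require Import FunctionalExtensionality Classical.
From mathcomp Require Import zify.
Require Import Defs.

Set Implicit Arguments.
Unset Strict Implicit.
Unset Printing Implicit Defensive.

(** * Facts about a grammar over a group *)

(** The obstacle is that a loop cut out of a derivation tree has arbitrary trees as siblings, whose
    values are in general not among the derived facts. This is why the groups of quotients of values
    are tracked beside the loop groups: an unknown sibling value is a known one times an element of
    the first group, and the correction this causes in a round trip is a product of quotients of
    round trips with known siblings. So every loop, whatever its siblings, lies in the group
    generated by the known loops. The promise [CFG k] enters through the number of leaves of the
    acyclic skeleton, so it governs the length of derivations and not their truth. A saturated set
    is never recognised by the machine; it only shows that some short derivation exists, which is
    then guessed, and the last step asks [id] about the name obtained. The time bound concerns all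
    computations on all words, including endless guesses, so the clock has to be built into the
    machine; its range must be a power of the input length obtained without arithmetic. *)

Lemma gen_ind (gT : finGroupType) (A : {set gT}) (P : gT -> Prop) :
  P 1%g -> (forall x y, P x -> P y -> P (x * y)%g) -> {in A, forall x, P x} ->
  {in <<A>>%g, forall x, P x}.
Proof.
move=> P1 PM PA x /gen_prodgP [n [c cA ->]].
by apply: (big_ind P) => // i _; apply/PA/cA.
Qed.

Lemma trunc_log_ltn m n : 0 < m -> m.*2 <= n -> trunc_log 2 m < trunc_log 2 n.
Proof.
move=> m0 le; apply: trunc_log_max => //.
by apply: leq_trans le; rewrite expnS mul2n leq_double trunc_logP.
Qed.

(** By Lagrange a proper inclusion at least doubles the order, so a strict chain of subgroups of G
    has at most log |G| steps. This keeps the potential below polynomial. *)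
Lemma subgroup_trunc_log (gT : finGroupType) (H K : {group gT}) :
  H \subset K -> trunc_log 2 #|K| <= trunc_log 2 #|H| -> H :=: K.
Proof.
move=> sHK le; apply/eqP; rewrite eqEproper sHK /=; apply/negP => pHK.
have lt1 : 1 < #|K : H|%g by rewrite indexg_gt1; case/andP: pHK.
suff : trunc_log 2 #|H| < trunc_log 2 #|K| by rewrite ltnNge le.
by apply: trunc_log_ltn => //; rewrite -(Lagrange sHK) -muln2 leq_mul2l lt1 orbT.
Qed.

Section Derivation.

Variables (gT : finGroupType) (Gr : cfg gT).
Local Notation N := (nonterm Gr).
Local Notation tree := (dtree N gT).

Fixpoint tree_value (t : tree) : gT :=
  match t with
  | DLeaf _ g => g
  | DNode _ t1 t2 => (tree_value t1 * tree_value t2)%g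
  end.

Fixpoint labels (t : tree) : seq N :=
  match t with
  | DLeaf A _ => [:: A]
  | DNode A t1 t2 => A :: labels t1 ++ labels t2
  end.

Fixpoint leaves (t : tree) : nat :=
  match t with DLeaf _ _ => 1 | DNode _ t1 t2 => leaves t1 + leaves t2 end.

Fixpoint height (t : tree) : nat :=
  match t with DLeaf _ _ => 1 | DNode _ t1 t2 => (maxn (height t1) (height t2)).+1 end.

Definition generates (A : N) (g : gT) : Prop :=
  exists t, [/\ uses_prods t, root_label t = A & tree_value t = g].

Definition fact : Type := (N * (gT + N * (gT * gT)))%type.
Definition valf (A : N) (g : gT) : fact := (A, inl g).
Definition ctxf (A B : N) (p : gT * gT) : fact := (A, inr (B, p)).

(* Storing the right factor of a context inverted turns composition of contexts
   into multiplication in the direct product. *)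
Definition act (p : gT * gT) (x : gT) : gT := (p.1 * x * p.2^-1)%g.

Lemma act1 x : act 1%g x = x.
Proof. by rewrite /act /= invg1 mulg1 mul1g. Qed.

Lemma actM p q x : act (p * q)%g x = act p (act q x).
Proof. by rewrite /act /= invMg !mulgA. Qed.

(** [InferId] asks for a value of [A] because the black box supplies no name of 1: the machine makes
    one as x x^-1, here as in [InferLeft] and [InferRight]. *)
Inductive infer (F : seq fact) : fact -> Prop :=
| InferLeft A B C x : (A, inl (B, C)) \in prods Gr -> valf C x \in F ->
    infer F (ctxf A B (1, x^-1)%g)
| InferRight A B C x : (A, inl (B, C)) \in prods Gr -> valf B x \in F ->
    infer F (ctxf A C (x, 1)%g)
| InferComp A B C p q : ctxf A B p \in F -> ctxf B C q \in F ->
    infer F (ctxf A C (p * q)%g)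
| InferInv A p : ctxf A A p \in F -> infer F (ctxf A A p^-1%g)
| InferId A x : valf A x \in F -> infer F (ctxf A A 1%g)
| InferAct A B p x : ctxf A B p \in F -> valf B x \in F ->
    infer F (valf A (act p x)).

Definition fact_true (f : fact) : Prop :=
  match f.2 with
  | inl g => generates f.1 g
  | inr Bp => forall x, generates Bp.1 x -> generates f.1 (act Bp.2 x)
  end.

(* A loop permutes the finite set of values of its nonterminal, so its inverse,
   being one of its powers, maps this set into itself too. *)
Lemma infer_true F f : {in F, forall f, fact_true f} -> infer F f -> fact_true f.
Proof.
move=> tF; case=> {f}.
- move=> A B C x pA /tF [t [ut rt vt]] y [t' [ut' rt' vt']] /=.
  exists (DNode A t' t); split=> //=; first by rewrite rt rt' pA ut ut'.
  by rewrite vt vt' /act /= invgK mul1g.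
- move=> A B C x pA /tF [t [ut rt vt]] y [t' [ut' rt' vt']] /=.
  exists (DNode A t t'); split=> //=; first by rewrite rt rt' pA ut ut'.
  by rewrite vt vt' /act /= invg1 mulg1.
- by move=> A B C p q /tF tp /tF tq x /tq /tp; rewrite -actM.
- move=> A p /tF tp x gx /=.
  have tpX n : generates A (act (p ^+ n)%g x).
    by elim: n => [|n IH]; rewrite ?expg0 ?act1 // expgS actM; apply: tp.
  by rewrite invg_expg.
- by move=> A x _ y gy /=; rewrite act1.
- by move=> A B p x /tF tp /tF; apply: tp.
Qed.

Inductive derivs : nat -> seq fact -> seq fact -> Prop :=
| Derivs0 F : derivs 0 F F
| DerivsS m F F' f : infer F f -> derivs m (f :: F) F' -> derivs m.+1 F F'.

Lemma infer_sub F F' f : {subset F <= F'} -> infer F f -> infer F' f.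
Proof.
move=> sF; case.
- by move=> A B C x pA /sF; apply: InferLeft.
- by move=> A B C x pA /sF; apply: InferRight.
- by move=> A B C p q /sF i /sF; apply: InferComp.
- by move=> A p /sF; apply: InferInv.
- by move=> A x /sF; apply: InferId.
- by move=> A B p x /sF i /sF; apply: InferAct.
Qed.

Lemma derivs_sub m F F' : derivs m F F' -> {subset F <= F'}.
Proof.
elim=> [{}F //|{}m {}F {}F' f _ _ IH g gF].
by apply: IH; rewrite inE gF orbT.
Qed.

Lemma derivs_trans m m' F F' F'' :
  derivs m F F' -> derivs m' F' F'' -> derivs (m + m') F F''.
Proof.
by elim=> [//|{}m {}F {}F' f i _ IH /IH]; apply: DerivsS.
Qed.

Lemma derivs_mono m F F' E : {subset F <= E} -> derivs m F F' ->
  exists2 E', derivs m E E' & {subset F' <= E'}.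
Proof.
move=> sFE d; elim: d E sFE => [{}F|{}m {}F {}F' f i _ IH] E sFE.
  by exists E => //; constructor.
have [E' dE' sE'] : exists2 E', derivs m (f :: E) E' & {subset F' <= E'}.
  by apply: IH => g; rewrite !inE => /predU1P[->|/sFE->]; rewrite ?eqxx ?orbT.
by exists E' => //; apply: DerivsS dE'; apply: infer_sub i.
Qed.

(** The final set of facts is hidden, so that derivations made one after the other simply add their
    costs. *)
Definition ext (m : nat) (F fs : seq fact) : Prop :=
  exists m' F', [/\ m' <= m, derivs m' F F' & {subset fs <= F'}].

Lemma ext_sub m F E fs : {subset F <= E} -> ext m F fs -> ext m E fs.
Proof.
move=> sFE [m' [F' [le d s]]]; have [E' d' s'] := derivs_mono sFE d.
by exists m', E'; split=> // f /s /s'.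
Qed.

Lemma ext_leq m m' F fs : m <= m' -> ext m F fs -> ext m' F fs.
Proof.
by move=> le [i [F' [l d s]]]; exists i, F'; split=> //; apply: leq_trans le.
Qed.

Lemma ext_self m F fs : {subset fs <= F} -> ext m F fs.
Proof. by move=> s; exists 0, F; split=> //; apply: Derivs0. Qed.

(* Facts are never lost, so the second derivation may use both those of [F] and [fs]. *)
Lemma ext_trans m m' F fs gs :
  ext m F fs -> ext m' (F ++ fs) gs -> ext (m + m') F (fs ++ gs).
Proof.
move=> [i [F' [li d s]]] e.
have [j [F'' [lj d' s']]] : ext m' F' gs.
  by apply: ext_sub e => f; rewrite mem_cat => /orP[/(derivs_sub d)|/s].
exists (i + j), F''; split; [exact: leq_add|exact: derivs_trans d d'|].
by move=> f; rewrite mem_cat => /orP[/s /(derivs_sub d')|/s'].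
Qed.

Lemma ext_subr m F fs gs : {subset gs <= fs} -> ext m F fs -> ext m F gs.
Proof. by move=> sg [i [F' [l d s]]]; exists i, F'; split=> // f /sg /s. Qed.

Lemma ext_infer m F f gs : infer F f -> ext m (f :: F) gs -> ext m.+1 F gs.
Proof.
move=> i [m' [F' [le d s]]]; exists m'.+1, F'; split=> //.
by apply: DerivsS i d.
Qed.

End Derivation.

(** * Saturated sets of facts *)

Lemma leq4_eq a b c d a' b' c' d' : a <= a' -> b <= b' -> c <= c' -> d <= d' ->
  a' + b' + c' + d' <= a + b + c + d -> [/\ a' = a, b' = b, c' = c & d' = d].
Proof. by move=> *; split; lia. Qed.

Section Saturation.

Variables (gT : finGroupType) (Gr : cfg gT).
Local Notation N := (nonterm Gr).
Local Notation tree := (dtree N gT).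
Local Notation fact := (fact Gr).

(** Bounds are stated in [#|lhs|]: a nonterminal without productions need not occur in the encoding,
    so [nonterm Gr] may be far larger than the input. *)
Definition lhs : {set N} := [set A | [exists r, (A, r) \in prods Gr]].

Lemma root_lhs (t : tree) : uses_prods t -> root_label t \in lhs.
Proof.
case: t => [A g|A t1 t2] /= => [i|/and3P[i _ _]]; rewrite inE; apply/existsP.
  by exists (inr g).
by exists (inl (root_label t1, root_label t2)).
Qed.

Definition vals (F : seq fact) A : {set gT} := [set x | valf A x \in F].
Definition links (F : seq fact) A B : {set gT * gT} := [set p | ctxf A B p \in F].
Definition diffs (F : seq fact) A : {group gT} :=
  <<[set (x^-1 * y)%g | x in vals F A, y in vals F A]>>%G.
Definition loops (F : seq fact) A : {group gT * gT} := <<links F A A>>%G.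

(** The logarithms bound chains of subgroups. The indicators are added because the groups do not
    notice a first value, whose quotient with itself is 1, nor a first link between distinct
    nonterminals. *)
Definition local_pot F A : nat :=
  ((vals F A != set0) + trunc_log 2 #|diffs F A| + trunc_log 2 #|loops F A|
   + \sum_(B in lhs) (links F A B != set0)).
Definition pot F : nat := \sum_(A in lhs) local_pot F A.

Section Mono.
Variables (F F' : seq fact).
Hypothesis sF : {subset F <= F'}.

Lemma vals_sub A : vals F A \subset vals F' A.
Proof. by apply/subsetP => x; rewrite !inE => /sF. Qed.
Lemma links_sub A B : links F A B \subset links F' A B.
Proof. by apply/subsetP => x; rewrite !inE => /sF. Qed.
Lemma diffs_sub A : diffs F A \subset diffs F' A.
Proof. by apply/genS/imset2S; apply: vals_sub. Qed.
Lemma loops_sub A : loops F A \subset loops F' A.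
Proof. by apply/genS/links_sub. Qed.

Lemma neq0_sub (T : finType) (X Y : {set T}) : X \subset Y -> (X != set0) <= (Y != set0).
Proof. by move=> s; case: (X =P set0) => // /eqP nX; rewrite (subset_neq0 s nX). Qed.

Lemma card_trunc_log_sub (T : finType) (X Y : {set T}) :
  X \subset Y -> trunc_log 2 #|X| <= trunc_log 2 #|Y|.
Proof. by move=> s; apply/leq_trunc_log/subset_leq_card. Qed.

Lemma local_pot_sub A : local_pot F A <= local_pot F' A.
Proof.
rewrite /local_pot !leq_add ?neq0_sub ?card_trunc_log_sub ?vals_sub ?diffs_sub ?loops_sub //.
by apply: leq_sum => B _; apply/neq0_sub/links_sub.
Qed.

(** Each summand can only grow, so a sum that has not grown fixes every summand; equal logarithms
    then force nested groups to coincide. *)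
Lemma local_pot_stable A : local_pot F' A <= local_pot F A ->
  [/\ vals F' A != set0 -> vals F A != set0, diffs F' A = diffs F A,
      loops F' A = loops F A
    & forall B, B \in lhs -> links F' A B != set0 -> links F A B != set0].
Proof.
have h1 := neq0_sub (vals_sub A); have h2 := card_trunc_log_sub (diffs_sub A).
have h3 := card_trunc_log_sub (loops_sub A).
have h4 B : (links F A B != set0) <= (links F' A B != set0) := neq0_sub (links_sub A B).
have h5 : \sum_(B in lhs) (links F A B != set0) <= \sum_(B in lhs) (links F' A B != set0).
  by apply: leq_sum.
move=> /(leq4_eq h1 h2 h3 h5) [e1 e2 e3 e5]; split.
- by move: e1; do 2!case: (_ != set0).
- by apply/val_inj/esym; apply: (subgroup_trunc_log (diffs_sub A)); rewrite e2.
- by apply/val_inj/esym; apply: (subgroup_trunc_log (loops_sub A)); rewrite e3.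
- move=> B lB n'; case: (boolP (links F A B != set0)) => // n.
  move/eqP: e5; rewrite eqn_leq => /andP[+ _].
  rewrite leqNgt => /negP; case.
  rewrite (bigD1 B) //= [X in _ < X](bigD1 B) //= (negPf n) n' add0n add1n ltnS.
  by apply: leq_sum.
Qed.
End Mono.

(** The term 3b is b for a subgroup of G and 2b for a subgroup of G x G; 1 and [#|lhs|] bound the
    indicators. *)
Lemma pot_bound b F : #|gT| <= 2 ^ b -> pot F <= #|lhs| * (1 + 3 * b + #|lhs|).
Proof.
move=> gb; rewrite -sum_nat_const; apply: leq_sum => A _; rewrite /local_pot.
apply: leq_add; last first.
  by rewrite -sum1_card; apply: leq_sum => B _; case: (_ != _).
rewrite -addnA; apply: leq_add; first by case: (_ != _).
have tl m x : x <= 2 ^ m -> trunc_log 2 x <= m.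
  by move/(leq_trunc_log 2); rewrite trunc_expnK.
rewrite mulSn; apply: leq_add; apply: tl.
  by apply: leq_trans gb; apply: max_card.
rewrite mul2n -addnn expnD; apply: leq_trans (leq_mul gb gb).
by rewrite -card_prod; apply: max_card.
Qed.

(** The allowance of 5 leaves room: the short derivations tested against it below use at most three
    rules. *)
Definition stable F : Prop := forall m F', m <= 5 -> derivs m F F' -> pot F' <= pot F.

(** As long as stability fails, at most 5 rules raise [pot] by at least 1, and [pot] never exceeds
    [M]; the induction is on the gap [M - pot E]. Stability is settled by excluded middle, since a
    guessing machine only needs the derivation to exist. *)
Lemma saturate b F : #|gT| <= 2 ^ b -> exists m F',
  [/\ m <= 5 * (#|lhs| * (1 + 3 * b + #|lhs|)), derivs m F F' & stable F'].
Proof.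
move=> gb; set M := (_ * (_ + _)).
suff H j E : M - pot E <= j -> exists m F', [/\ m <= 5 * j, derivs m E F' & stable F'].
  by have [|m [F' [le d st]]] := H M F; [apply: leq_subr | exists m, F'].
elim: j E => [|j IH] E le.
  exists 0, E; split=> //; first exact: Derivs0.
  move=> m F' _ _; apply: leq_trans (pot_bound _ gb) _.
  by move: le; rewrite leqn0 subn_eq0.
have [st|/not_all_ex_not [m /not_all_ex_not [F' nst]]] := classic (stable E).
  by exists 0, E; split=> //; exact: Derivs0.
have [lem nst'] := imply_to_and _ _ nst; have [d /negP] := imply_to_and _ _ nst'.
rewrite -ltnNge => lt.
have [|m' [F'' [le' d' st]]] := IH F'.
  rewrite -ltnS; apply: leq_trans le; rewrite ltn_sub2l //.
  by apply: leq_trans lt _; apply: pot_bound.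
exists (m + m'), F''; split=> //; last exact: derivs_trans d d'.
by rewrite mulnS; apply: leq_add.
Qed.

Section Stable.
Variable F : seq fact.
Hypothesis stF : stable F.

(** No other summand of [pot] can drop, so growth at [A] would show in the total. *)
Lemma stableP m F' A : m <= 5 -> derivs m F F' -> A \in lhs ->
  [/\ vals F' A != set0 -> vals F A != set0, diffs F' A = diffs F A,
      loops F' A = loops F A
    & forall B, B \in lhs -> links F' A B != set0 -> links F A B != set0].
Proof.
move=> le d lA; have sF := derivs_sub d; apply: (local_pot_stable sF).
move: (stF le d); rewrite /pot !(bigD1 A lA) /=; set x := local_pot F' A.
rewrite leqNgt => /negP nlt; rewrite leqNgt; apply/negP => lt; apply: nlt.
rewrite -addSn leq_add //; apply: leq_sum => B _; exact: local_pot_sub.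
Qed.

Lemma stable_val A x : A \in lhs -> ext 5 F [:: valf A x] -> exists y, valf A y \in F.
Proof.
move=> lA [m [F' [le d s]]]; have [h _ _ _] := stableP le d lA.
have /h/set0Pn[y] : vals F' A != set0.
  by apply/set0Pn; exists x; rewrite inE s ?mem_head.
by rewrite inE => yF; exists y.
Qed.

Lemma stable_diff A x y : A \in lhs -> ext 5 F [:: valf A x; valf A y] ->
  (x^-1 * y)%g \in diffs F A.
Proof.
move=> lA [m [F' [le d s]]]; have [_ <- _ _] := stableP le d lA.
by apply/mem_gen/imset2P; exists x y; rewrite ?inE ?s // !inE eqxx ?orbT.
Qed.

Lemma stable_link A B p : A \in lhs -> B \in lhs -> ext 5 F [:: ctxf A B p] ->
  exists q, ctxf A B q \in F.
Proof.
move=> lA lB [m [F' [le d s]]]; have [_ _ _ h] := stableP le d lA.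
have /(h _ lB)/set0Pn[y] : links F' A B != set0.
  by apply/set0Pn; exists p; rewrite inE s ?mem_head.
by rewrite inE => yF; exists y.
Qed.

Lemma stable_loop A p : A \in lhs -> ext 5 F [:: ctxf A A p] -> p \in loops F A.
Proof.
move=> lA [m [F' [le d s]]]; have [_ _ <- _] := stableP le d lA.
by apply/mem_gen; rewrite inE s ?mem_head.
Qed.

End Stable.
End Saturation.

(** * Contexts of derivation trees and the loop groups of a stable set *)

Section Contexts.

Variables (gT : finGroupType) (Gr : cfg gT).
Local Notation N := (nonterm Gr).
Local Notation tree := (dtree N gT).
Local Notation fact := (fact Gr).

(** The side trees are arbitrary derivations, whose values need not be known to [F]; so [p] is not
    directly available from the rules. *)
Inductive context : N -> N -> gT * gT -> Prop :=
| ContextNil A : context A A 1%g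
| ContextLeft A B C p t : (A, inl (B, root_label t)) \in prods Gr -> uses_prods t ->
    context B C p -> context A C ((1, (tree_value t)^-1) * p)%g
| ContextRight A B C p t : (A, inl (root_label t, B)) \in prods Gr -> uses_prods t ->
    context B C p -> context A C ((tree_value t, 1) * p)%g.

Lemma act_left y x : act (1, y^-1)%g x = (x * y)%g :> gT.
Proof. by rewrite /act /= mul1g invgK. Qed.

Lemma act_right y x : act (y, 1)%g x = (y * x)%g :> gT.
Proof. by rewrite /act /= invg1 mulg1. Qed.

Lemma diffs_ind (F : seq fact) A (P : gT -> Prop) :
  P 1%g -> (forall x y, P x -> P y -> P (x * y)%g) ->
  (forall x y, valf A x \in F -> valf A y \in F -> P (x^-1 * y)%g) ->
  forall z, z \in diffs F A -> P z.
Proof.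
move=> P1 PM PV; apply: (gen_ind P1 PM) => _ /imset2P [x y xF yF ->].
by apply: PV; move: xF yF; rewrite !inE.
Qed.

Variable F : seq fact.
Hypothesis stF : stable F.
Hypothesis termF : forall A g, (A, inr g) \in prods Gr -> valf A g \in F.

(** By induction both children have known values, and two rules turn these into a value of the
    parent. Stability then provides a known value, possibly different from that of the tree. *)
Lemma stable_has_val (t : tree) : uses_prods t -> exists y, valf (root_label t) y \in F.
Proof.
elim: t => [A g|A t1 IH1 t2 IH2] /=; first by move/termF; exists g.
case/and3P=> pA /[dup] u1 /IH1 [y1 h1] /[dup] u2 /IH2 [y2 h2].
apply: (stable_val stF (x := act (1, y2^-1)%g y1)).
  by rewrite inE; apply/existsP; exists (inl (root_label t1, root_label t2)).
apply: (ext_infer (InferLeft pA h2)).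
apply: (ext_infer (InferAct (A := A) (B := root_label t1) (p := (1, y2^-1)%g) (x := y1) _ _)).
- by rewrite mem_head.
- by rewrite inE h1 orbT.
- by apply: ext_self => f; rewrite !inE => ->.
Qed.

Lemma prod_lhs A r : (A, r) \in prods Gr -> A \in lhs Gr.
Proof. by move=> i; rewrite inE; apply/existsP; exists r. Qed.

(** The element is x^-1 y conjugated by z: the difference group of a left child, conjugated by a
    known value of the right child, falls into that of the parent. *)
Lemma diffs_right A B C x y z : (A, inl (B, C)) \in prods Gr ->
  valf B x \in F -> valf B y \in F -> valf C z \in F ->
  ((x * z)^-1 * (y * z))%g \in diffs F A.
Proof.
move=> pA xF yF zF; apply: stable_diff => //; first exact: prod_lhs pA.
apply: (ext_infer (InferLeft pA zF)).
apply: (ext_infer (InferAct (A := A) (B := B) (p := (1, z^-1)%g) (x := x) _ _)).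
- by rewrite mem_head.
- by rewrite inE xF orbT.
apply: (ext_infer (InferAct (A := A) (B := B) (p := (1, z^-1)%g) (x := y) _ _)).
- by rewrite !inE eqxx orbT.
- by rewrite !inE yF !orbT.
rewrite !act_left; apply: ext_self => f; rewrite !inE.
by case/orP=> /eqP ->; rewrite eqxx ?orbT.
Qed.

(** Here z cancels, so the difference group of a right child falls into that of the parent without
    conjugation. *)
Lemma diffs_left A B C x y z : (A, inl (B, C)) \in prods Gr ->
  valf C x \in F -> valf C y \in F -> valf B z \in F ->
  ((z * x)^-1 * (z * y))%g \in diffs F A.
Proof.
move=> pA xF yF zF; apply: stable_diff => //; first exact: prod_lhs pA.
apply: (ext_infer (InferRight pA zF)).
apply: (ext_infer (InferAct (A := A) (B := C) (p := (z, 1)%g) (x := x) _ _)).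
- by rewrite mem_head.
- by rewrite inE xF orbT.
apply: (ext_infer (InferAct (A := A) (B := C) (p := (z, 1)%g) (x := y) _ _)).
- by rewrite !inE eqxx orbT.
- by rewrite !inE yF !orbT.
rewrite !act_right; apply: ext_self => f; rewrite !inE.
by case/orP=> /eqP ->; rewrite eqxx ?orbT.
Qed.

Lemma diffs_prod A B C x y z : (A, inl (B, C)) \in prods Gr ->
  valf B x \in F -> valf C y \in F -> valf A z \in F -> (z^-1 * (x * y))%g \in diffs F A.
Proof.
move=> pA xF yF zF; apply: stable_diff => //; first exact: prod_lhs pA.
apply: (ext_infer (InferLeft pA yF)).
apply: (ext_infer (InferAct (A := A) (B := B) (p := (1, y^-1)%g) (x := x) _ _)).
- by rewrite mem_head.
- by rewrite inE xF orbT.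
rewrite !act_left; apply: ext_self => f; rewrite !inE.
by case/orP=> /eqP ->; rewrite ?zF ?eqxx ?orbT.
Qed.

(* The values of a nonterminal lie in a single coset of its difference group. *)
Lemma tree_value_diffs (t : tree) y : uses_prods t -> valf (root_label t) y \in F ->
  (y^-1 * tree_value t)%g \in diffs F (root_label t).
Proof.
elim: t y => [A g|A t1 IH1 t2 IH2] y /=.
  move=> /[dup] /termF gF pA yF; apply: stable_diff => //; first exact: prod_lhs pA.
  by apply: ext_self => f; rewrite !inE => /orP[]/eqP->.
case/and3P=> pA u1 u2 yF.
have [y1 f1] := stable_has_val u1; have [y2 f2] := stable_has_val u2.
have h1 := IH1 _ u1 f1; have h2 := IH2 _ u2 f2.
set v1 := tree_value t1 in h1 *; set v2 := tree_value t2 in h2 *.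
(* The three factors compare y with the known product y1 y2, then replace y1 by v1 to the left of
   y2, then y2 by v2. *)
have -> : (y^-1 * (v1 * v2) = (y^-1 * (y1 * y2)) * (y1^-1 * v1) ^ y2 * (y2^-1 * v2))%g.
  by rewrite /conjg !mulgA !mulgK.
apply: groupM; first apply: groupM.
- exact: diffs_prod f1 f2 yF.
- move: (y1^-1 * v1)%g h1; apply: (diffs_ind (P := fun z => (z ^ y2)%g \in diffs F A)).
  + by rewrite conj1g.
  + by move=> x z xH zH; rewrite conjMg groupM.
  + move=> x x' xF x'F.
    have -> : ((x^-1 * x') ^ y2 = (x * y2)^-1 * (x' * y2))%g.
      by rewrite /conjg invMg !mulgA.
    exact: (diffs_right pA).
- move: (y2^-1 * v2)%g h2; apply: (diffs_ind (P := fun z => z \in diffs F A)) => //.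
  + by move=> x z xH zH; rewrite groupM.
  + move=> x x' xF x'F.
    have -> : (x^-1 * x' = (y1 * x)^-1 * (y1 * x'))%g.
      by rewrite invMg !mulgA mulgVK.
    exact: (diffs_left pA).
Qed.

(** Only some link is claimed, not [p]: the known link of the next nonterminal is extended by one
    edge, whose side tree is replaced by a known value. *)
Lemma context_link A B p x : context A B p -> B \in lhs Gr -> valf B x \in F ->
  A \in lhs Gr /\ exists q, ctxf A B q \in F.
Proof.
move=> c lB xF; elim: c lB xF => {A B p}.
- move=> A lA xF; split=> //; apply: (stable_link stF (p := 1%g)) => //.
  by apply: (ext_infer (InferId xF)); apply: ext_self => f; rewrite !inE => ->.
- move=> A B C p t pA ut _ IH lC xF; have [lB [q qF]] := IH lC xF.
  have [y yF] := stable_has_val ut; have lA := prod_lhs pA; split=> //.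
  apply: (stable_link stF (p := ((1, y^-1) * q)%g)) => //.
  apply: (ext_infer (InferLeft pA yF)).
  apply: (ext_infer (InferComp (A := A) (B := B) (C := C) (p := (1, y^-1)%g) (q := q) _ _)).
  + by rewrite mem_head.
  + by rewrite inE qF orbT.
  by apply: ext_self => f; rewrite !inE => ->.
- move=> A B C p t pA ut _ IH lC xF; have [lB [q qF]] := IH lC xF.
  have [y yF] := stable_has_val ut; have lA := prod_lhs pA; split=> //.
  apply: (stable_link stF (p := ((y, 1) * q)%g)) => //.
  apply: (ext_infer (InferRight pA yF)).
  apply: (ext_infer (InferComp (A := A) (B := B) (C := C) (p := (y, 1)%g) (q := q) _ _)).
  + by rewrite mem_head.
  + by rewrite inE qF orbT.
  by apply: ext_self => f; rewrite !inE => ->.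
Qed.

(* Closes a round trip [A -> B -> C -> A] whose middle edge [B -> C] comes from a
   production, and divides it by the round trip [A -> B -> A]. *)
Lemma edge_loop A B C r q q1 e : A \in lhs Gr -> infer F (ctxf B C e) ->
  ctxf A B r \in F -> ctxf C A q \in F -> ctxf B A q1 \in F ->
  (q1^-1 * (e * q))%g \in loops F A.
Proof.
move=> lA ie rF qF q1F.
have l1 : (r * q1)%g \in loops F A.
  apply: stable_loop => //.
  apply: (ext_infer (InferComp rF q1F)).
  by apply: ext_self => f; rewrite !inE => ->.
have l2 : (r * (e * q))%g \in loops F A.
  apply: stable_loop => //.
  apply: (ext_infer ie).
  apply: (ext_infer (InferComp (A := B) (B := C) (C := A) (p := e) (q := q) _ _)).
  - by rewrite mem_head.
  - by rewrite inE qF orbT.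
  apply: (ext_infer (InferComp (A := A) (B := B) (C := A) (p := r) (q := (e * q)%g) _ _)).
  - by rewrite !inE rF !orbT.
  - by rewrite mem_head.
  by apply: ext_self => f; rewrite !inE => ->.
by rewrite -(mulKg r (e * q)%g) mulgA -invMg groupM ?groupV.
Qed.

(** Passing from a known y to the arbitrary v multiplies the edge by the inverse of (1, d)
    conjugated by [q1], with d a difference. For a generator d this conjugate is a quotient of two
    edges with known values, hence in [L]. *)
Lemma edge_left (L : {group gT * gT}) A q1 q y v :
  (forall z, valf A z \in F -> q1^-1 * ((1, z^-1) * q) \in L)%g ->
  valf A y \in F -> (y^-1 * v)%g \in diffs F A -> (q1^-1 * ((1, v^-1) * q) \in L)%g.
Proof.
move=> edge yF k.
have -> : (q1^-1 * ((1, v^-1) * q) =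
    ((1, y^-1 * v) ^ q1)^-1 * (q1^-1 * ((1, y^-1) * q)))%g.
  have -> : ((1, v^-1) = (1, y^-1 * v)^-1 * (1, y^-1) :> gT * gT)%g.
    by congr pair => /=; rewrite ?invMg ?invgK ?mulg1 ?invg1 ?mulgK.
  by rewrite /conjg !invMg invgK !mulgA mulgK.
rewrite groupM ?edge // groupV.
move: (y^-1 * _)%g k; apply: (diffs_ind (P := fun z => ((1, z) ^ q1)%g \in L)).
- by rewrite conj1g.
- move=> u w uH wH; have -> : ((1, u * w) = (1, u) * (1, w) :> gT * gT)%g.
    by congr pair; rewrite /= mulg1.
  by rewrite conjMg groupM.
- move=> u w uF wF.
  have -> : ((1, u^-1 * w) ^ q1 =
     (q1^-1 * ((1, u^-1) * q)) * (q1^-1 * ((1, w^-1) * q))^-1)%g.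
    have -> : ((1, u^-1 * w) = (1, u^-1) * (1, w^-1)^-1 :> gT * gT)%g.
      by congr pair; rewrite /= ?invg1 ?mulg1 ?invgK.
    by rewrite /conjg !invMg invgK !mulgA !mulgK.
  by rewrite groupM ?groupV ?edge.
Qed.

(** Mirror image of [edge_left]: the correction now stands next to [q], so the conjugation is by [q]
    instead of [q1]. *)
Lemma edge_right (L : {group gT * gT}) A q1 q y v :
  (forall z, valf A z \in F -> q1^-1 * ((z, 1) * q) \in L)%g ->
  valf A y \in F -> (y^-1 * v)%g \in diffs F A -> (q1^-1 * ((v, 1) * q) \in L)%g.
Proof.
move=> edge yF k.
have -> : (q1^-1 * ((v, 1) * q) = (q1^-1 * ((y, 1) * q)) * (y^-1 * v, 1) ^ q)%g.
  have -> : ((v, 1) = (y, 1) * (y^-1 * v, 1) :> gT * gT)%g.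
    by congr pair => /=; rewrite ?mulKVg ?mulg1.
  by rewrite /conjg !mulgA !mulgK.
rewrite groupM ?edge //.
move: (y^-1 * _)%g k; apply: (diffs_ind (P := fun z => ((z, 1) ^ q)%g \in L)).
- by rewrite conj1g.
- move=> u w uH wH; have -> : ((u * w, 1) = (u, 1) * (w, 1) :> gT * gT)%g.
    by congr pair; rewrite /= mulg1.
  by rewrite conjMg groupM.
- move=> u w uF wF.
  have -> : ((u^-1 * w, 1) ^ q =
     (q1^-1 * ((u, 1) * q))^-1 * (q1^-1 * ((w, 1) * q)))%g.
    have -> : ((u^-1 * w, 1) = (u, 1)^-1 * (w, 1) :> gT * gT)%g.
      by congr pair; rewrite /= ?invg1 ?mulg1 ?invgK.
    by rewrite /conjg !invMg invgK !mulgA !mulgK.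
  by rewrite groupM ?groupV ?edge.
Qed.

(** Telescoping along the path: if e is the first edge and q a known link for the rest p, then q1^-1
    e p = (q1^-1 e q)(q^-1 p). The second factor is the induction hypothesis, and the first is an
    edge closed into a round trip by the way back [r]. *)
Lemma context_loops A B p x : context B A p -> A \in lhs Gr -> valf A x \in F ->
  forall r q, ctxf A B r \in F -> ctxf B A q \in F -> (q^-1 * p)%g \in loops F A.
Proof.
have link_trans C D E r e : C \in lhs Gr -> E \in lhs Gr -> ctxf C D r \in F ->
    infer F (ctxf D E e) -> exists r', ctxf C E r' \in F.
  move=> lC lE rF ie; apply: (stable_link stF (p := (r * e)%g)) => //.
  apply: (ext_infer ie).
  apply: (ext_infer (InferComp (A := C) (B := D) (C := E) (p := r) (q := e) _ _)).
  - by rewrite inE rF orbT.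
  - by rewrite mem_head.
  by apply: ext_self => f; rewrite !inE => ->.
move=> c lA xF; elim: c lA xF => {A B p}.
- move=> A lA xF r q rF qF; rewrite mulg1 groupV.
  by apply: mem_gen; rewrite inE.
- move=> B C A p t pB ut c IH lA xF r q1 rF q1F.
  have [lC [q qF]] := context_link c lA xF.
  have [y yF] := stable_has_val ut.
  have [r' r'F] := link_trans _ _ _ _ _ lA lC rF (InferLeft pB yF).
  have h := IH lA xF _ _ r'F qF.
  rewrite -(mulKVg q p) !mulgA -(mulgA _ q^-1%g) -(mulgA (q1^-1)%g) groupM //.
  apply: edge_left yF (tree_value_diffs ut yF) => z zF.
  exact: (edge_loop lA (InferLeft pB zF) rF qF q1F).
- move=> B C A p t pB ut c IH lA xF r q1 rF q1F.
  have [lC [q qF]] := context_link c lA xF.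
  have [y yF] := stable_has_val ut.
  have [r' r'F] := link_trans _ _ _ _ _ lA lC rF (InferRight pB yF).
  have h := IH lA xF _ _ r'F qF.
  rewrite -(mulKVg q p) !mulgA -(mulgA _ q^-1%g) -(mulgA (q1^-1)%g) groupM //.
  apply: edge_right yF (tree_value_diffs ut yF) => z zF.
  exact: (edge_loop lA (InferRight pB zF) rF qF q1F).
Qed.

Lemma context_loop t p : uses_prods t -> context (root_label t) (root_label t) p ->
  p \in loops F (root_label t).
Proof.
move=> ut c; have [x xF] := stable_has_val ut; have lA := root_lhs ut.
have [q qF] : exists q, ctxf (root_label t) (root_label t) q \in F.
  apply: (stable_link stF (p := 1%g)) => //.
  by apply: (ext_infer (InferId xF)); apply: ext_self => f; rewrite !inE => ->.
rewrite -(mulKVg q p) groupM //; first by apply: mem_gen; rewrite inE.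
exact: (context_loops c lA xF qF qF).
Qed.

End Contexts.

(** * Cubes and skeletons *)

Lemma leq_expn2r m n e : m <= n -> m ^ e <= n ^ e.
Proof. by case: e => // e le; rewrite leq_exp2r. Qed.

Section Cubes.

Variables (gT : finGroupType) (Gr : cfg gT).
Local Notation N := (nonterm Gr).
Local Notation fact := (fact Gr).

(** The products of subsequences of [s], taken from its end: a list of length m gives at most 2^m of
    them, each reached by at most m compositions. *)
Fixpoint cube (rT : finGroupType) (s : seq rT) : {set rT} :=
  if s is h :: s' then cube s' :|: (cube s' :* h)%g else [set 1%g].

Lemma cube_derivs A (s : seq (gT * gT)) (F : seq fact) p :
  ctxf A A 1%g \in F -> {in s, forall h, ctxf A A h \in F} -> p \in cube s ->
  ext (size s) F [:: ctxf A A p].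
Proof.
elim: s F p => [|h s IH] F p F1 Fs /=.
  by rewrite inE => /eqP ->; apply: ext_self => f; rewrite inE => /eqP ->.
have Fs' : {in s, forall h, ctxf A A h \in F} by move=> z zs; rewrite Fs // inE zs orbT.
case/setUP => [/(IH _ _ F1 Fs')|/rcosetP [q /(IH _ _ F1 Fs') e ->]].
  exact: ext_leq.
rewrite -addn1.
apply: (ext_subr (fs := [:: ctxf A A q] ++ [:: ctxf A A (q * h)%g])).
  by move=> f; rewrite !inE => ->; rewrite orbT.
apply: (ext_trans e).
apply: (ext_infer (InferComp (A := A) (B := A) (C := A) (p := q) (q := h) _ _)).
- by rewrite mem_cat mem_head orbT.
- by rewrite mem_cat Fs ?mem_head.
by apply: ext_self => f; rewrite inE => /eqP ->; rewrite mem_head.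
Qed.

Lemma cube_diff_derivs A (s : seq (gT * gT)) (F : seq fact) p q :
  ctxf A A 1%g \in F -> {in s, forall h, ctxf A A h \in F} ->
  p \in cube s -> q \in cube s -> ext ((size s).*2 + 2) F [:: ctxf A A (p^-1 * q)%g].
Proof.
move=> F1 Fs pK qK.
have e1 := cube_derivs F1 Fs pK.
have e2 := ext_trans e1 (ext_sub (E := F ++ [:: ctxf A A p]) _ (cube_derivs F1 Fs qK)).
apply: (ext_subr (fs := ([:: ctxf A A p] ++ [:: ctxf A A q]) ++ [:: ctxf A A (p^-1 * q)%g])).
  by move=> f; rewrite !inE => ->; rewrite !orbT.
rewrite -addnn; apply: ext_trans.
  by apply: e2 => f; rewrite mem_cat => ->.
apply: (ext_infer (InferInv (A := A) (p := p) _)).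
  by rewrite mem_cat mem_head orbT.
apply: (ext_infer (InferComp (A := A) (B := A) (C := A) (p := p^-1%g) (q := q) _ _)).
- by rewrite mem_head.
- by rewrite !inE mem_cat !inE eqxx !orbT.
by apply: ext_self => f; rewrite inE => /eqP ->; rewrite mem_head.
Qed.

(* Babai and Szemeredi: as long as the cube [K] of the elements found so far has
   [K^-1 K] different from the group, some product of an element of [K^-1 K] and
   a generator doubles the cube. *)
Lemma loops_derivs_from A (F : seq fact) b j (s : seq (gT * gT)) E p : #|gT| <= 2 ^ b ->
  b.*2 - size s <= j -> {subset F <= E} -> ctxf A A 1%g \in E ->
  {in s, forall h, ctxf A A h \in E} -> #|cube s| = 2 ^ size s ->
  p \in loops F A -> ext (j.+1 * (4 * b + 3)) E [:: ctxf A A p].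
Proof.
move=> gb; elim: j s E => [|j IH] s E le sFE E1 Es cK pL.
(* The cube has exactly 2^size elements and lies in G x G, of order at most 2^(2b), so it can double
   at most 2b times. *)
all: have les : size s <= b.*2
       by rewrite -(leq_exp2l _ _ (isT : 1 < 2)) -cK; apply: leq_trans (max_card _) _;
          rewrite card_prod -addnn expnD leq_mul.
all: have [[x [y [xK yK ->]]]|notin] :=
       classic (exists x y, [/\ x \in cube s, y \in cube s & p = (x^-1 * y)%g]).
- by apply: ext_leq (cube_diff_derivs E1 Es xK yK); lia.
(* With the rounds exhausted the cube fills G x G, and p = 1^-1 p. *)
- case: notin; have es : size s = b.*2 by lia.
  have -> : cube s = setT.
    apply/eqP; rewrite eqEcard subsetT cK cardsT card_prod es -addnn expnD.
    by rewrite leq_mul.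
  by exists 1%g, p; rewrite !inE invg1 mul1g.
- by apply: ext_leq (cube_diff_derivs E1 Es xK yK); lia.
have [x [y [g [xK yK gF nK]]]] : exists x y g, [/\ x \in cube s, y \in cube s,
    ctxf A A g \in F & ~ exists x' y', [/\ x' \in cube s, y' \in cube s &
       (x^-1 * y * g = x'^-1 * y')%g]].
  (* If K^-1 K were closed under right multiplication by the generators, it would contain every
     product of them, in particular [p]. *)
  apply: NNPP => no; case: notin.
  have [n [c cF ->]] := gen_prodgP pL; elim: n c cF => [|n IHn] c cF.
    rewrite big_ord0; have : cube s != set0 by rewrite -card_gt0 cK expn_gt0.
    by case/set0Pn => x xK; exists x, x; rewrite mulVg.
  rewrite big_ord_recr /=.
  have [x [y [xK yK ->]]] := IHn (fun i => c (widen_ord (leqnSn n) i)) (fun i => cF _).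
  apply: NNPP => nK; apply: no; exists x, y, (c ord_max); split=> //.
  by have := cF ord_max; rewrite inE.
set h := (x^-1 * y * g)%g in nK.
(* At most 2 (2b) + 2 rules for x^-1 y, by the bound on the length of [s], and one more to multiply
   by g. *)
have eh : ext (4 * b + 3) E [:: ctxf A A h].
  apply: (ext_subr (fs := [:: ctxf A A (x^-1 * y)%g] ++ [:: ctxf A A h])).
    by move=> f; rewrite !inE => ->; rewrite orbT.
  apply: (ext_leq (m := ((size s).*2 + 2) + 1)); first lia.
  apply: (ext_trans (cube_diff_derivs E1 Es xK yK)).
  apply: (ext_infer (InferComp (A := A) (B := A) (C := A) (p := (x^-1 * y)%g) (q := g) _ _)).
  - by rewrite mem_cat mem_head orbT.
  - by rewrite mem_cat sFE.
  by apply: ext_self => f; rewrite inE => /eqP ->; rewrite mem_head.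
apply: (ext_subr (fs := [:: ctxf A A h] ++ [:: ctxf A A p])).
  by move=> f; rewrite !inE => ->; rewrite orbT.
rewrite mulSn; apply: (ext_trans eh).
apply: (IH (h :: s)) => //=.
- by lia.
- by move=> f /sFE; rewrite mem_cat => ->.
- by rewrite mem_cat E1.
- by move=> z; rewrite inE mem_cat => /predU1P [->|/Es ->] //; rewrite mem_head orbT.
rewrite cardsU card_rcoset cK expnS mul2n -addnn.
(* A common element z = z' h would put h = z'^-1 z into K^-1 K. *)
suff -> : cube s :&: (cube s :* h)%g = set0 by rewrite cards0 subn0.
apply/setP => z; rewrite !inE; apply/negP => /andP [zK /rcosetP [z' z'K e]].
by case: nK; exists z', z; split=> //; rewrite e mulKg.
Qed.

(** 2b + 1 rounds of 4b + 3 rules, starting from the empty list, after one [InferId] that supplies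
    the identity loop. *)
Lemma loops_derivs A (F : seq fact) b x p : #|gT| <= 2 ^ b -> valf A x \in F ->
  p \in loops F A -> ext ((2 * b + 1) * (4 * b + 3) + 1) F [:: ctxf A A p].
Proof.
move=> gb xF pL; rewrite addn1; apply: (ext_infer (InferId xF)).
rewrite addn1 mul2n; apply: (loops_derivs_from (s := [::]) gb _ _ _ _ _ pL) => //=.
- by rewrite subn0.
- by move=> f fF; rewrite inE fF orbT.
- by rewrite mem_head.
- by rewrite cards1.
Qed.

End Cubes.

(** * Acyclic skeletons of derivation trees *)

Section Trees.

Variables (gT : finGroupType) (Gr : cfg gT).
Local Notation N := (nonterm Gr).
Local Notation tree := (dtree N gT).
Local Notation fact := (fact Gr).

Lemma root_labels (t : tree) : root_label t \in labels t.
Proof. by case: t => [A g|A t1 t2]; rewrite mem_head. Qed.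

Definition root_once (t : tree) : bool :=
  if t is DNode A t1 t2 then (A \notin labels t1) && (A \notin labels t2) else true.

(** Descending as long as [A] occurs in a child ends at an occurrence with no further [A] below it.
    When [A] is the label of the root, the context passed on the way is a loop. *)
Lemma split_deepest (t : tree) A : uses_prods t -> A \in labels t -> exists p t0,
  [/\ context (root_label t) A p, uses_prods t0 & root_label t0 = A] /\
  [/\ root_once t0, leaves t0 <= leaves t, {subset labels t0 <= labels t}
    & tree_value t = act p (tree_value t0)].
Proof.
elim: t => [B g|B t1 IH1 t2 IH2] /=.
  move=> uB; rewrite inE => /eqP ->; exists 1%g, (DLeaf B g); split; split=> //.
    exact: ContextNil.
  by rewrite act1.
case/and3P => pB u1 u2; case: (boolP (A \in labels t1)) => [A1 _|nA1].
  have [p [t0 [[c u0 r0] [o0 l0 s0 v0]]]] := IH1 u1 A1.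
  exists ((1, (tree_value t2)^-1) * p)%g, t0; split; split=> //.
  - exact: ContextLeft c.
  - exact: leq_trans l0 (leq_addr _ _).
  - by move=> z /s0; rewrite inE mem_cat => ->; rewrite orbT.
  - by rewrite actM act_left v0.
case: (boolP (A \in labels t2)) => [A2 _|nA2].
  have [p [t0 [[c u0 r0] [o0 l0 s0 v0]]]] := IH2 u2 A2.
  exists ((tree_value t1, 1) * p)%g, t0; split; split=> //.
  - exact: ContextRight c.
  - exact: leq_trans l0 (leq_addl _ _).
  - by move=> z /s0; rewrite inE mem_cat => ->; rewrite !orbT.
  - by rewrite actM act_right v0.
rewrite inE mem_cat (negPf nA1) (negPf nA2) !orbF => /eqP eA; subst B.
exists 1%g, (DNode A t1 t2); split; split=> //=.
- exact: ContextNil.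
- by rewrite pB u1.
- by rewrite nA1.
- by rewrite act1.
Qed.

Lemma mem_paths (t : tree) s : s \in paths t -> {subset s <= labels t}.
Proof.
elim: t s => [A g|A t1 IH1 t2 IH2] s /=; first by rewrite inE => /eqP ->.
case/mapP => s'; rewrite mem_cat => h -> z; rewrite !inE => /predU1P [->|zs].
  by rewrite eqxx.
by rewrite mem_cat; case/orP: h => [/IH1|/IH2] /(_ _ zs) ->; rewrite !orbT.
Qed.

Lemma leaves_gt0 (t : tree) : 0 < leaves t.
Proof. by elim: t => //= A t1 IH1 t2 IH2; rewrite addn_gt0 IH1. Qed.

Lemma acyclic_node A (t1 t2 : tree) : A \notin labels t1 -> A \notin labels t2 ->
  acyclic t1 -> acyclic t2 -> acyclic (DNode A t1 t2).
Proof.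
move=> n1 n2 /allP a1 /allP a2; apply/allP => s /mapP [s' + ->] /=.
rewrite mem_cat => /orP[] i.
  by rewrite (a1 _ i) andbT; apply: contra n1; apply: mem_paths i _.
by rewrite (a2 _ i) andbT; apply: contra n2; apply: mem_paths i _.
Qed.

Lemma height_paths (t : tree) : exists2 s, s \in paths t & size s = height t.
Proof.
elim: t => [A g|A t1 [s1 i1 e1] t2 [s2 i2 e2]] /=; first by exists [:: A]; rewrite ?mem_head.
have [_|_] := leqP (height t1) (height t2).
  exists (A :: s2); first by rewrite map_f // mem_cat i2 orbT.
  by rewrite /= e2.
exists (A :: s1); first by rewrite map_f // mem_cat i1.
by rewrite /= e1.
Qed.

Lemma uses_prods_labels (t : tree) : uses_prods t -> {subset labels t <= lhs Gr}.
Proof.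
elim: t => [A g|A t1 IH1 t2 IH2] ut z; rewrite inE.
  by move/eqP->; apply: (root_lhs ut).
case/predU1P => [->|]; first exact: (root_lhs ut).
by case/and3P: ut => _ /IH1 h1 /IH2 h2; rewrite mem_cat => /orP[/h1|/h2].
Qed.

Lemma height_acyclic (t : tree) : uses_prods t -> acyclic t -> height t <= #|lhs Gr|.
Proof.
move=> ut /allP at_; have [s i <-] := height_paths t.
rewrite -(card_uniqP (at_ _ i)); apply: subset_leq_card; apply/subsetP => z zs.
by apply: (uses_prods_labels ut); apply: mem_paths zs.
Qed.

(** At least one child has number at most k - 1 and the other at most k, so with h the larger height
    of the two there are at most h^k + h^(k-1) = (h+1) h^(k-1) leaves, hence at most (h+1)^k. *)
Lemma leaves_height (t : tree) : leaves t <= height t ^ hs (remove_terminals t).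
Proof.
suff H k : hs (remove_terminals t) <= k -> leaves t <= height t ^ k by apply: H.
elim: t k => [A g|A t1 IH1 t2 IH2] k /=; first by rewrite exp1n.
set h := maxn (height t1) (height t2).
set s1 := hs (remove_terminals t1); set s2 := hs (remove_terminals t2).
have hl (u : tree) k' : height u <= h -> leaves u <= height u ^ k' -> leaves u <= h ^ k'.
  by move=> le /leq_trans; apply; apply: leq_expn2r.
have b1 k' : s1 <= k' -> leaves t1 <= h ^ k'.
  by move/IH1/(hl t1 k' (leq_maxl _ _)).
have b2 k' : s2 <= k' -> leaves t2 <= h ^ k'.
  by move/IH2/(hl t2 k' (leq_maxr _ _)).
have step k' : h ^ k'.+1 + h ^ k' <= h.+1 ^ k'.+1.
  rewrite expnS -mulSnr expnS leq_mul2l /=.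
  by apply: leq_expn2r.
have h0 : 0 < h by rewrite /h; case: (t1) => *; rewrite /= leq_max.
have le1 k' : h ^ k' <= h ^ k'.+1 by rewrite leq_pexp2l.
case: eqP => [e|/eqP ne].
  case: k => // k; rewrite ltnS => le; apply: leq_trans (step k).
  by apply: leq_add; [apply: leq_trans (le1 k); apply: b1|apply: b2; rewrite -e].
case: (ltngtP s1 s2) ne => // lt _ le.
  case: k le => [|k] le; first by lia.
  by rewrite addnC; apply: leq_trans (step k); apply: leq_add; [apply: b2|apply: b1; lia].
case: k le => [|k] le; first by lia.
by apply: leq_trans (step k); apply: leq_add; [apply: b1|apply: b2; lia].
Qed.

(** The allowance for one node: [loops_derivs] for the loop at it, one rule to apply this loop, and
    two rules to multiply the values of its children. *)
Definition tree_cost b := (2 * b + 1) * (4 * b + 3) + 4.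

Lemma skeleton_cost m n c : 0 < m -> 0 < n -> 2 <= c ->
  m.*2.-1 * c + (n.*2.-1 * c + 2) + (c - 2) <= (m + n).*2.-1 * c.
Proof.
case: m n => [//|m] [//|n] _ _ c2.
have -> : (m.+1 + n.+1).*2.-1 = m.+1.*2.-1 + n.+1.*2.-1 + 1 by lia.
by rewrite !mulnDl mul1n; lia.
Qed.

Section Stable.
Variables (F : seq fact) (b : nat).
Hypothesis gb : #|gT| <= 2 ^ b.
Hypothesis stF : stable F.
Hypothesis termF : forall A g, (A, inr g) \in prods Gr -> valf A g \in F.

Local Notation cost := (tree_cost b).

(** The value derived is that of [t] itself; [t'] merely counts the cost, one [tree_cost] for each
    of its 2l - 1 nodes. The part between the root and a deepest repetition of its label is cut off
    as a loop and applied again at the end. Below the cut this label no longer occurs, which makes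
    [t'] acyclic. *)
Lemma tree_skeleton (t : tree) : uses_prods t -> exists t',
  [/\ uses_prods t', root_label t' = root_label t, acyclic t',
      {subset labels t' <= labels t}
    & ext ((leaves t').*2.-1 * cost) F [:: valf (root_label t) (tree_value t)]].
Proof.
have [n le] := ubnP (leaves t); elim: n t le => // n IH t le ut.
have [p [t0 [[c u0 r0] [o0 l0 s0 v0]]]] := split_deepest ut (root_labels t).
have pL := context_loop stF termF ut c.
have [x xF] := stable_has_val stF termF ut.
have ep := loops_derivs gb xF pL.
have fin m : ext m F [:: valf (root_label t) (tree_value t0)] ->
    ext (m + (cost - 2)) F [:: valf (root_label t) (tree_value t)].
  move=> e0.
  apply: (ext_subr (fs := [:: valf (root_label t) (tree_value t0)] ++
     ([:: ctxf (root_label t) (root_label t) p] ++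
      [:: valf (root_label t) (tree_value t)]))).
    by move=> f; rewrite !inE => ->; rewrite !orbT.
  apply: (ext_trans e0); apply: (ext_leq (m := ((2 * b + 1) * (4 * b + 3) + 1) + 1)).
    by rewrite /tree_cost; lia.
  apply: ext_trans; first by apply: ext_sub ep => f; rewrite mem_cat => ->.
  apply: (ext_infer (InferAct (A := root_label t) (B := root_label t) (p := p)
    (x := tree_value t0) _ _)).
  - by rewrite mem_cat mem_head orbT.
  - by rewrite !mem_cat mem_head !orbT.
  by rewrite v0; apply: ext_self => f; rewrite inE => /eqP ->; rewrite mem_head.
case: t0 r0 u0 o0 l0 s0 v0 fin => [A g|A t1 t2] /= r0; rewrite -r0.
  move=> u0 _ _ s0 _ fin; exists (DLeaf A g); split=> //.
  rewrite mul1n; apply: ext_leq (fin 0 _); first by lia.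
  by apply: ext_self => f; rewrite inE => /eqP ->; apply: termF.
case/and3P => pA u1 u2 /andP[n1 n2] l0 s0 _ fin.
have [||t1' [u1' r1' a1' s1' e1]] := IH t1; rewrite //.
  by rewrite -ltnS; apply: leq_trans le; rewrite ltnS; apply: leq_trans l0;
     rewrite -addn1 leq_add2l leaves_gt0.
have [||t2' [u2' r2' a2' s2' e2]] := IH t2; rewrite //.
  by rewrite -ltnS; apply: leq_trans le; rewrite ltnS; apply: leq_trans l0;
     rewrite -add1n leq_add2r leaves_gt0.
exists (DNode A t1' t2'); split=> //=.
- by rewrite r1' r2' pA u1'.
- by apply: acyclic_node => //; [apply: contra (s1' A) n1|apply: contra (s2' A) n2].
- move=> z; rewrite inE mem_cat => h; apply: s0; rewrite inE mem_cat.
  by case/or3P: h => [->//|/s1' ->|/s2' ->]; rewrite !orbT.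
apply: ext_leq (fin ((leaves t1').*2.-1 * cost + ((leaves t2').*2.-1 * cost + 2)) _).
  by apply: skeleton_cost; rewrite ?leaves_gt0 //; apply: leq_trans (leq_addl _ _).
apply: (ext_subr (fs := [:: valf (root_label t1) (tree_value t1)] ++
   ([:: valf (root_label t2) (tree_value t2)] ++
      [:: valf A (tree_value t1 * tree_value t2)%g]))).
  by move=> f; rewrite !inE => ->; rewrite !orbT.
apply: (ext_trans e1); apply: ext_trans.
  by apply: ext_sub e2 => f; rewrite mem_cat => ->.
apply: (ext_infer (InferLeft (x := tree_value t2) pA _)).
  by rewrite !mem_cat mem_head !orbT.
apply: (ext_infer (InferAct (A := A) (B := root_label t1)
  (p := (1, (tree_value t2)^-1)%g) (x := tree_value t1) _ _)).
- by rewrite mem_head.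
- by rewrite inE !mem_cat mem_head !orbT.
by rewrite act_left; apply: ext_self => f; rewrite inE => /eqP ->; rewrite mem_head.
Qed.

End Stable.

Lemma tree_derivs (F : seq fact) b k (t : tree) : #|gT| <= 2 ^ b ->
  (forall A g, (A, inr g) \in prods Gr -> valf A g \in F) ->
  CFG k Gr -> derivation_tree t ->
  ext (5 * (#|lhs Gr| * (1 + 3 * b + #|lhs Gr|)) +
       (#|lhs Gr| ^ k).*2 * tree_cost b)
    F [:: valf (start Gr) (tree_value t)].
Proof.
move=> gb termF cfgk [rt ut].
have [m [F' [le d st]]] := saturate F gb.
have termF' A g : (A, inr g) \in prods Gr -> valf A g \in F'.
  by move/termF/(derivs_sub d).
have [t' [ut' rt' at' _ [m' [F'' [le' d' s']]]]] := tree_skeleton gb st termF' ut.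
exists (m + m'), F''; split; last by rewrite -rt.
- apply: leq_add => //; apply: leq_trans le' _; rewrite leq_mul2r; apply/orP; right.
  apply: leq_trans (leq_pred _) _; rewrite leq_double.
  apply: leq_trans (leaves_height t') _.
  (* The skeleton keeps the root label, so it is an acyclic derivation tree and the promise applies
     to it. *)
  have hk : hs (remove_terminals t') <= k by apply: cfgk => //; split; rewrite // rt'.
  have hh := height_acyclic ut' at'.
  have h0 : 0 < height t' by case: (t').
  by apply: leq_trans (leq_pexp2l h0 hk) _; apply: leq_expn2r.
- exact: derivs_trans d d'.
Qed.

End Trees.

(** * Words of the language and derivation trees *)

Section Language.

Variables (gT : finGroupType) (Gr : cfg gT).
Local Notation N := (nonterm Gr).
Local Notation tree := (dtree N gT).

Fixpoint yield (t : tree) : seq gT :=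
  match t with DLeaf _ g => [:: g] | DNode _ t1 t2 => yield t1 ++ yield t2 end.

Lemma prod_yield (t : tree) : (\prod_(g <- yield t) g)%g = tree_value t.
Proof. by elim: t => [A g|A t1 IH1 t2 IH2] /=; rewrite ?big_seq1 // big_cat /= IH1 IH2. Qed.

Lemma derives_yield (t : tree) u v : uses_prods t ->
  clos_refl_trans _ (@derives1 gT Gr) (u ++ inl (root_label t) :: v)
    (u ++ map inr (yield t) ++ v).
Proof.
elim: t u v => [A g|A t1 IH1 t2 IH2] u v /=.
  by move=> pA; apply: rt_step; apply: (Derives1 u v pA).
case/and3P => pA u1 u2; apply: rt_trans; first exact: rt_step (Derives1 u v pA).
apply: rt_trans; first exact: (IH1 u (inl (root_label t2) :: v) u1).
have := IH2 (u ++ map inr (yield t1)) v u2.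
by rewrite map_cat -!catA.
Qed.

(** The invariant pulled back along a derivation, from the word to the start symbol: a nonterminal
    may contribute any value it generates, so at the start symbol a tree appears. *)
Fixpoint form_value (s : seq (N + gT)) (g : gT) : Prop :=
  match s with
  | [::] => g = 1%g
  | inl A :: s' => exists x h, [/\ generates A x, form_value s' h & g = (x * h)%g]
  | inr x :: s' => exists2 h, form_value s' h & g = (x * h)%g
  end.

Lemma form_value_cat s1 s2 g : form_value (s1 ++ s2) g <->
  exists g1 g2, [/\ form_value s1 g1, form_value s2 g2 & g = (g1 * g2)%g].
Proof.
elim: s1 g => [|[A|x] s1 IH] g /=.
- split=> [h|[_ [g2 [-> h ->]]]]; last by rewrite mul1g.
  by exists 1%g, g; rewrite mul1g.
- split=> [[x [h [Ax /IH [g1 [g2 [h1 h2 ->]]] ->]]]|].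
    exists (x * g1)%g, g2; split=> //; last by rewrite mulgA.
    by exists x, g1.
  case=> _ [g2 [[x [h [Ax h1 ->]]] h2 ->]]; exists x, (h * g2)%g; split=> //.
    by apply/IH; exists h, g2.
  by rewrite mulgA.
- split=> [[h /IH [g1 [g2 [h1 h2 ->]]] ->]|].
    exists (x * g1)%g, g2; split=> //; last by rewrite mulgA.
    by exists g1.
  case=> _ [g2 [[h h1 ->] h2 ->]]; exists (h * g2)%g; last by rewrite mulgA.
  by apply/IH; exists h, g2.
Qed.

Lemma form_value_derives1 s s' g : derives1 (Gr := Gr) s s' -> form_value s' g ->
  form_value s g.
Proof.
case=> u v A r pA /form_value_cat [g1 [_ [h1 /form_value_cat [g2 [g3 [h2 h3 ->]]] ->]]].
apply/form_value_cat; exists g1, (g2 * g3)%g; split=> //=; exists g2, g3; split=> //.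
case: r pA h2 => [[B C]|x] pA /=.
  case=> x [h [[t1 [u1 r1 v1]] [y [_ [[t2 [u2 r2 v2]] -> ->]] ->]]].
  exists (DNode A t1 t2); split=> //=; first by rewrite r1 r2 pA u1.
  by rewrite v1 v2 mulg1.
by case=> _ -> ->; exists (DLeaf A x); split=> //=; rewrite mulg1.
Qed.

Lemma languageP : (exists w, language Gr w /\ (\prod_(g <- w) g)%g = 1%g) <->
  exists2 t : tree, derivation_tree t & tree_value t = 1%g.
Proof.
split=> [[w [Lw w1]]|[t [rt ut] v1]]; last first.
  exists (yield t); rewrite prod_yield; split=> //.
  by have := derives_yield [::] [::] ut; rewrite cats0 rt.
have fw : form_value (map inr w) 1%g.
  rewrite -w1; elim: w {Lw w1} => [|x w IH] /=; first by rewrite big_nil.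
  by exists (\prod_(g <- w) g)%g; rewrite ?big_cons.
have back s s' : clos_refl_trans _ (@derives1 gT Gr) s s' -> form_value s' 1%g ->
    form_value s 1%g.
  by elim=> [? ? d|//|? ? ? _ IH1 _ IH2 /IH2 /IH1] //; apply: form_value_derives1.
have [x [_ [[t [ut rt vt]] -> e]]] := back _ _ Lw fw.
by exists t; rewrite // vt e mulg1.
Qed.

End Language.

(** * Guarded programs as graphs *)

(** Contents are functions, so that tapes agreeing in every cell are equal; lists of cells may
    differ in trailing blanks. *)
Definition ftape (S : Type) : Type := ((nat -> option S) * nat)%type.

Definition fread S (t : ftape S) : option S := t.1 t.2.

Definition fmove (m : move) (p : nat) : nat :=
  match m with MoveLeft => p.-1 | Stay => p | MoveRight => p.+1 end.

Definition fwrite S (a : option S * move) (t : ftape S) : ftape S :=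
  ((fun j => if j == t.2 then a.1 else t.1 j), fmove a.2 t.2).

Definition fblank S : ftape S := (fun=> None, 0).

(* Cell 0 stays blank and serves as the left end marker. *)
Definition word_tape S (w : seq S) (p : nat) : ftape S :=
  (nth None (None :: map Some w), p).

Definition fbits (f : nat -> option bool) (i n : nat) : n.-tuple bool :=
  [tuple odflt false (f (i + j)) | j < n].

Definition fanswer (B : blackBox) (q : query) (f : nat -> option bool) : seq bool :=
  let b := bb_b B in
  match q with
  | QValid => [:: bb_valid (fbits f 0 b)]
  | QInv => bb_inv (fbits f 0 b)
  | QProd => bb_prod (fbits f 0 b) (fbits f b b)
  | QId => [:: bb_id (fbits f 0 b) (fbits f b (bb_c B))]
  end.

Definition upd (I : eqType) X (f : I -> X) i x : I -> X :=
  fun j => if j == i then x else f j.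

Lemma upd_same (I : eqType) X (f : I -> X) i x : upd f i x i = x.
Proof. by rewrite /upd eqxx. Qed.

Lemma upd_upd (I : eqType) X (f : I -> X) i x y : upd (upd f i x) i y = upd f i y.
Proof. by apply: functional_extensionality => j; rewrite /upd; case: eqP. Qed.

Lemma upd_id (I : eqType) X (f : I -> X) i : upd f i (f i) = f.
Proof. by apply: functional_extensionality => j; rewrite /upd; case: eqP => // ->. Qed.

Lemma fwrite_keep S (t : ftape S) m : fwrite (fread t, m) t = (t.1, fmove m t.2).
Proof.
congr pair; apply: functional_extensionality => j /=.
by case: eqP => // ->.
Qed.

Lemma fwrite_stay S (f : ftape S) : fwrite (fread f, Stay) f = f.
Proof. by rewrite fwrite_keep; case: f. Qed.

Section Language.

Variable r : nat.

Record lstate := LState {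
  l_oracle : ftape bool;
  l_store : ftape letter;
  l_reg : 'I_r.+1 -> ftape letter
}.

(* A guarded instruction scans and rewrites the oracle tape, the store and one
   register; it is blocked when [p_fun] returns [None]. *)
Record prim := Prim {
  p_reg : 'I_r.+1;
  p_fun : option bool -> option letter -> option letter ->
    option ((option bool * move) * (option letter * move) * (option letter * move));
  p_query : option query
}.

Definition lstep (B : blackBox) (p : prim) (s : lstate) : option lstate :=
  match p_fun p (fread (l_oracle s)) (fread (l_store s)) (fread (l_reg s (p_reg p))) with
  | None => None
  | Some (ao, as_, ar) =>
      let o := fwrite ao (l_oracle s) in
      Some (LState
        (if p_query p is Some q then (nth None (map Some (fanswer B q o.1)), 0) else o)
        (fwrite as_ (l_store s))
        (upd (l_reg s) (p_reg p) (fwrite ar (l_reg s (p_reg p)))))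
  end.

(** Regular expressions over guarded instructions: a test is an instruction that may block, and a
    blocked execution is simply lost, so branching and loops come from [Alt] and [Star]. *)
Inductive cmd :=
| Do of prim
| Seq of cmd & cmd
| Alt of cmd & cmd
| Star of cmd.

Definition nop : prim :=
  Prim ord0 (fun o s x => Some ((o, Stay), (s, Stay), (x, Stay))) None.

Lemma lstep_nop B s : lstep B nop s = Some s.
Proof.
case: s => o s x; rewrite /lstep /= !fwrite_keep /=; congr (Some (LState _ _ _)).
- by case: o.
- by case: s.
by rewrite -[X in _ = X](upd_id x ord0); congr upd; case: (x ord0).
Qed.

(** The count is the length of the corresponding walk. The 2 of [ExecStar0] are the [nop] into the
    loop head and the [nop] out of it, paid once however often the body runs. *)
Inductive exec (B : blackBox) : cmd -> lstate -> lstate -> nat -> Prop :=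
| ExecDo p s s' : lstep B p s = Some s' -> exec B (Do p) s s' 1
| ExecSeq c1 c2 s s1 s' n1 n2 : exec B c1 s s1 n1 -> exec B c2 s1 s' n2 ->
    exec B (Seq c1 c2) s s' (n1 + n2)
| ExecAltL c1 c2 s s' n : exec B c1 s s' n -> exec B (Alt c1 c2) s s' n
| ExecAltR c1 c2 s s' n : exec B c2 s s' n -> exec B (Alt c1 c2) s s' n
| ExecStar0 c s : exec B (Star c) s s 2
| ExecStarS c s s1 s' n1 n2 : exec B c s s1 n1 -> exec B (Star c) s1 s' n2 ->
    exec B (Star c) s s' (n1 + n2).

Section Graph.

Variables (B : blackBox) (V : Type) (E : option V -> seq (prim * option V)).

(* [None] is the entry as a source and the exit as a target. *)
Inductive walk : option V -> lstate -> lstate -> nat -> Prop :=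
| WalkExit o p s s' : List.In (p, None) (E o) -> lstep B p s = Some s' -> walk o s s' 1
| WalkStep o p v s s1 s' n : List.In (p, Some v) (E o) -> lstep B p s = Some s1 ->
    walk (Some v) s1 s' n -> walk o s s' n.+1.

End Graph.

Definition retarget (V V' : Type) (f : option V -> option V') (e : prim * option V) :
  prim * option V' := (e.1, f e.2).

(** Only interior control points are nodes. [Seq] adds the junction [inr None], and [Star] adds a
    loop head [None], because the entry of a graph cannot be the target of an edge. *)
Fixpoint node (c : cmd) : finType :=
  match c with
  | Do _ => void
  | Seq c1 c2 => (node c1 + option (node c2))%type
  | Alt c1 c2 => (node c1 + node c2)%type
  | Star c1 => option (node c1)
  end.

Definition seq_tgt V1 V2 (o : option V1) : option (V1 + option V2) :=
  if o is Some v then Some (inl v) else Some (inr None).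

Fixpoint edges (c : cmd) : option (node c) -> seq (prim * option (node c)) :=
  match c with
  | Do p => fun o => [:: (p, None)]
  | Seq c1 c2 => fun o =>
      match o with
      | None => map (retarget (@seq_tgt _ _)) (edges (c := c1) None)
      | Some (inl v) => map (retarget (@seq_tgt _ _)) (edges (c := c1) (Some v))
      | Some (inr o2) => map (retarget (omap (fun v => inr (Some v)))) (edges (c := c2) o2)
      end
  | Alt c1 c2 => fun o =>
      match o with
      | None => map (retarget (omap inl)) (edges (c := c1) None)
                ++ map (retarget (omap inr)) (edges (c := c2) None)
      | Some (inl v) => map (retarget (omap inl)) (edges (c := c1) (Some v))
      | Some (inr v) => map (retarget (omap inr)) (edges (c := c2) (Some v))
      end
  | Star c1 => fun o =>
      match o with
      | None => [:: (nop, Some None)]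
      | Some o1 => (if o1 is None then [:: (nop, None)] else [::])
                   ++ map (retarget Some) (edges (c := c1) o1)
      end
  end.

Lemma In_map A A' (f : A -> A') x s : List.In x (map f s) <-> exists2 y, f y = x & List.In y s.
Proof.
elim: s => [|z s IH] /=; first by split=> // [[]].
split=> [[<-|/IH[y e ys]]|[y e [->|ys]]].
- by exists z => //; left.
- by exists y => //; right.
- by left.
- by right; apply/IH; exists y.
Qed.

Lemma In_cat A (x : A) s1 s2 : List.In x (s1 ++ s2) <-> List.In x s1 \/ List.In x s2.
Proof.
elim: s1 => [|y s1 IH] /=; first by split=> [|[]//]; right.
rewrite IH; tauto.
Qed.

(** * Executions are the walks from entry to exit, with equal length *)

Section Adequacy.
Variable B : blackBox.

Lemma walk_Seq1 c1 c2 o s s1 s' n1 n2 : walk B (edges (c := c1)) o s s1 n1 ->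
  walk B (edges (c := c2)) None s1 s' n2 ->
  walk B (edges (c := Seq c1 c2)) (omap inl o) s s' (n1 + n2).
Proof.
move=> w1 w2; elim: w1 w2 => {o s s1 n1}.
- move=> o p s s1 i st w2; rewrite add1n.
  apply: (WalkStep (p := p) (v := inr None) (s1 := s1)) => //.
    by case: o i => [v|] i; apply/In_map; exists (p, None).
  elim: w2 => {s s' n2 st i}.
  + move=> o2 q s s' i st; apply: (WalkExit (p := q)) => //.
    by apply/In_map; exists (q, None).
  + move=> o2 q v s s2 s' n i st _ IH; apply: (WalkStep (p := q) (v := inr (Some v))) IH => //.
    by apply/In_map; exists (q, Some v).
- move=> o p v s s2 s1 n i st _ IH w2; rewrite addSn.
  apply: (WalkStep (p := p) (v := inl v)) (IH w2) => //.
  by case: o i => [v'|] i; apply/In_map; exists (p, Some v).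
Qed.

Lemma walk_Seq2 c1 c2 o s s' n : walk B (edges (c := Seq c1 c2)) o s s' n ->
  match o with
  | Some (inr o2) => walk B (edges (c := c2)) o2 s s' n
  | _ => exists s1 n1 n2, [/\ walk B (edges (c := c1)) 
            (if o is Some (inl v) then Some v else None) s s1 n1,
           walk B (edges (c := c2)) None s1 s' n2 & n = n1 + n2]
  end.
Proof.
elim=> {o s s' n}.
- move=> [[v|o2]|] p s s' /= /In_map[[q [t|]] //= [<- //] i] st.
  by apply: (WalkExit i st).
- have H o p v s s1 s' n : List.In (p, Some v)
      (map (retarget (@seq_tgt (node c1) (node c2))) (edges (c := c1) o)) ->
    lstep B p s = Some s1 -> match v with
      | inr o2 => walk B (edges (c := c2)) o2 s1 s' n
      | inl v => exists s2 n1 n2, [/\ walk B (edges (c := c1)) (Some v) s1 s2 n1,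
           walk B (edges (c := c2)) None s2 s' n2 & n = n1 + n2] end ->
    exists s2 n1 n2, [/\ walk B (edges (c := c1)) o s s2 n1,
           walk B (edges (c := c2)) None s2 s' n2 & n.+1 = n1 + n2].
    move=> /In_map [[q [t|]] /= [<- <-] i] st /=.
      case=> s2 [n1 [n2 [w1 w2 ->]]]; exists s2, n1.+1, n2; split=> //.
      exact: (WalkStep i st w1).
    by move=> w; exists s1, 1, n; split=> //; apply: WalkExit st.
  move=> [[v'|o2]|] p v s s1 s' n /= i st _ IH.
  + by apply: (H (Some v') p v s s1) => //; case: (v) IH.
  + case/In_map: i => [[q [t|]] //= [qp tv] i]; subst q v.
    exact: (WalkStep i st IH).
  + by apply: (H None p v s s1) => //; case: (v) IH.
Qed.

Lemma walk_AltL c1 c2 o s s' n : walk B (edges (c := c1)) o s s' n ->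
  walk B (edges (c := Alt c1 c2)) (omap inl o) s s' n.
Proof.
elim=> {o s s' n} [o p s s' i st|o p v s s1 s' n i st _ IH].
  apply: WalkExit st; case: o i => [v'|] i /=; [|apply/In_cat; left];
    by apply/In_map; exists (p, None).
apply: WalkStep st IH; case: o i => [v'|] i /=; [|apply/In_cat; left];
  by apply/In_map; exists (p, Some v).
Qed.

Lemma walk_AltR c1 c2 o s s' n : walk B (edges (c := c2)) o s s' n ->
  walk B (edges (c := Alt c1 c2)) (omap inr o) s s' n.
Proof.
elim=> {o s s' n} [o p s s' i st|o p v s s1 s' n i st _ IH].
  apply: WalkExit st; case: o i => [v'|] i /=; [|apply/In_cat; right];
    by apply/In_map; exists (p, None).
apply: WalkStep st IH; case: o i => [v'|] i /=; [|apply/In_cat; right];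
  by apply/In_map; exists (p, Some v).
Qed.

Lemma walk_Alt c1 c2 o s s' n : walk B (edges (c := Alt c1 c2)) o s s' n ->
  match o with
  | Some (inl v) => walk B (edges (c := c1)) (Some v) s s' n
  | Some (inr v) => walk B (edges (c := c2)) (Some v) s s' n
  | None => walk B (edges (c := c1)) None s s' n \/ walk B (edges (c := c2)) None s s' n
  end.
Proof.
elim=> {o s s' n} [o p s s'|o p v s s1 s' n].
  case: o => [[v|v]|] /=.
  - by move=> /In_map [[q [t|]] // [<-]] i st; apply: (WalkExit i st).
  - by move=> /In_map [[q [t|]] // [<-]] i st; apply: (WalkExit i st).
  - by move=> /In_cat [] /In_map [[q [t|]] // [<-]] i st; [left|right];
      apply: (WalkExit i st).
case: o => [[v'|v']|] /=.
- by move=> /In_map [[q [t|]] //= [<- <-]] i st _ IH; apply: (WalkStep i st IH).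
- by move=> /In_map [[q [t|]] //= [<- <-]] i st _ IH; apply: (WalkStep i st IH).
- by move=> /In_cat [] /In_map [[q [t|]] //= [<- <-]] i st _ IH; [left|right];
    apply: (WalkStep i st IH).
Qed.

Lemma walk_Star1 c o s s1 s' n1 n2 : walk B (edges (c := c)) o s s1 n1 ->
  walk B (edges (c := Star c)) (Some None) s1 s' n2 ->
  walk B (edges (c := Star c)) (Some o) s s' (n1 + n2).
Proof.
move=> w1 w2; elim: w1 w2 => {o s s1 n1}.
  move=> o p s s1 i st w2; rewrite add1n; apply: WalkStep st w2 => /=.
  by apply/In_cat; right; apply/In_map; exists (p, None).
move=> o p v s s2 s1 n i st _ IH w2; rewrite addSn; apply: WalkStep st (IH w2) => /=.
by apply/In_cat; right; apply/In_map; exists (p, Some v).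
Qed.

Lemma walk_Star2 c o s s' n : walk B (edges (c := Star c)) o s s' n ->
  if o is Some o1 then (o1 = None /\ s' = s /\ n = 1) \/
     exists s1 n1 n2, [/\ walk B (edges (c := c)) o1 s s1 n1,
       walk B (edges (c := Star c)) (Some None) s1 s' n2 & n = n1 + n2]
  else exists2 m, n = m.+1 & walk B (edges (c := Star c)) (Some None) s s' m.
Proof.
elim=> {o s s' n} [[o|] p s s'|[o|] p v s s1 s' n] /=; [|by case|
  |by case=> // -[<- <-]; rewrite lstep_nop => -[->]; exists n]; move=> /In_cat [].
- case: o => [//|] [[<-]|//]; rewrite lstep_nop => -[<-]; by left.
- by case/In_map => [[]].
- by case: o => [//|] [].
case/In_map => [[q t] /= [-> <-] i] st w; case: t i w => [v'|] i w IH; right; last first.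
  by exists s1, 1, n; split=> //; apply: WalkExit st.
case: IH => [[]//|[s2 [n1 [n2 [w1 w2 ->]]]]].
by exists s2, n1.+1, n2; split=> //; apply: (WalkStep i st w1).
Qed.

Lemma exec_walk c s s' n : exec B c s s' n -> walk B (edges (c := c)) None s s' n.
Proof.
elim=> {c s s' n} [p s s' st|c1 c2 s s1 s' n1 n2 _ IH1 _ IH2|c1 c2 s s' n _ IH|
  c1 c2 s s' n _ IH|c s|c s s1 s' n1 n2 _ IH1 _ IH2].
- by apply: WalkExit st; left.
- exact: walk_Seq1 IH1 IH2.
- exact: (walk_AltL c2 IH).
- exact: (walk_AltR c1 IH).
- apply: (WalkStep (p := nop) (v := None)); [by left|exact: lstep_nop|].
  by apply: (WalkExit (p := nop)); [left|exact: lstep_nop].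
- have /= [m -> w] := walk_Star2 IH2; rewrite addnS.
  apply: (WalkStep (p := nop) (v := None)); [by left|exact: lstep_nop|].
  exact: walk_Star1 IH1 w.
Qed.

Lemma walk_gt0 V (E : option V -> seq (prim * option V)) o s s' n : walk B E o s s' n -> 0 < n.
Proof. by case. Qed.

Lemma walk_exec c s s' n : walk B (edges (c := c)) None s s' n -> exec B c s s' n.
Proof.
elim: c s s' n => [p|c1 IH1 c2 IH2|c1 IH1 c2 IH2|c IH] s s' n w.
- case: w => [o q t t' [[<-]|//] st|o q []]; exact: ExecDo.
- have [s1 [n1 [n2 [w1 w2 ->]]]] := walk_Seq2 w.
  by apply: ExecSeq; [apply: IH1 w1|apply: IH2 w2].
- by case: (walk_Alt w) => [/IH1|/IH2]; [apply: ExecAltL|apply: ExecAltR].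
(* The body may repeat, so the induction is on the length of the walk that remains at the loop
   head. *)
- have /= [m -> {}w] := walk_Star2 w; have [k le] := ubnP m.
  elim: k m s w le => // k IHk m s w le.
  case: (walk_Star2 w) => [[_ [-> ->]]|[s1 [n1 [n2 [w1 w2 e]]]]]; first exact: ExecStar0.
  rewrite e -addnS; apply: ExecStarS; first exact: IH w1.
  apply: IHk => //; have := walk_gt0 w1; rewrite e in le.
  by case: (n1) le => // n'; rewrite addSn ltnS => le _; apply: leq_ltn_trans le; apply: leq_addl.
Qed.

End Adequacy.
End Language.

(** * The clock *)

Section Odometer.

Variables (d top : nat).
Implicit Type rem : 'I_d -> nat.

Definition settled rem (j : 'I_d) : bool := [forall i : 'I_d, (i < j) ==> (rem i == 0)].

(** A countdown with borrow, least significant digit first: [rem j] is the distance that head j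
    still has to travel before it turns, and turning restores it to [top]. *)
Definition odo_next rem (j : 'I_d) : nat :=
  if settled rem j then (if rem j == 0 then top else (rem j).-1) else rem j.

Definition odo rem : nat := \sum_(j < d) rem j * top.+1 ^ j.

Lemma geometric_top m : (\sum_(j < m) top * top.+1 ^ j).+1 = top.+1 ^ m.
Proof. by rewrite -big_distrr /= -[top in X in X * _]/(top.+1.-1) -predn_exp prednK ?expn_gt0. Qed.

(** All digits below the lowest nonzero one, at place i, jump from 0 to [top]; together they are
    worth (top+1)^i - 1, one less than the unit borrowed at place i. *)
Lemma odo_nextE rem j : rem j != 0 -> odo rem = (odo (odo_next rem)).+1.
Proof.
move=> nz0; case: (@arg_minnP _ j (fun i => rem i != 0) (fun i => i : nat) nz0)
  => i nzi mini {j nz0}.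
have before (j : 'I_d) : j < i -> rem j = 0.
  by move=> lt; apply/eqP; apply: contraTT lt => /mini; rewrite -leqNgt.
have si : settled rem i by apply/forallP => j; apply/implyP => /before ->.
have after (j : 'I_d) : i < j -> odo_next rem j = rem j.
  move=> lt; rewrite /odo_next; case: ifP => // /forallP /(_ i).
  by rewrite lt (negPf nzi).
have next0 (j : 'I_d) : j < i -> odo_next rem j = top.
  move=> lt; rewrite /odo_next before // eqxx; case: ifP => // /forallP [] l.
  by apply/implyP => /ltn_trans /(_ lt) /before ->.
have split (F : 'I_d -> nat) : \sum_(j < d) F j =
    \sum_(j < d | j < i) F j + (F i + \sum_(j < d | i < j) F j).
  rewrite (bigID (fun j : 'I_d => j < i)) /=; congr addn.
  rewrite (bigD1 i) ?ltnn //=; congr addn; apply: eq_bigl => j.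
  by rewrite -leqNgt [i < j]ltn_neqAle -val_eqE eq_sym andbC.
have e1 : \sum_(j < d | j < i) odo_next rem j * top.+1 ^ j = \sum_(j < i) top * top.+1 ^ j.
  rewrite (big_ord_widen d (fun j => top * top.+1 ^ j) (ltnW (ltn_ord i))).
  by apply: eq_bigr => j /next0 ->.
have e2 : \sum_(j < d | i < j) odo_next rem j * top.+1 ^ j =
    \sum_(j < d | i < j) rem j * top.+1 ^ j.
  by apply: eq_bigr => j /after ->.
rewrite /odo !split e1 e2 -addSn geometric_top.
rewrite big1 => [|j lt]; last by rewrite before.
rewrite add0n addnA; congr addn.
by rewrite /odo_next si (negPf nzi) -mulSn prednK // lt0n.
Qed.

End Odometer.

(** * The Turing machine of a graph *)

Definition represents S (f : ftape S) (t : tape S) : Prop :=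
  head_pos t = f.2 /\ forall j, nth None (cells t) j = f.1 j.

Lemma represents_read S (f : ftape S) t : represents f t -> read t = fread f.
Proof. by case=> h c; rewrite /read c h. Qed.

Lemma represents_act S (f : ftape S) t w m : represents f t ->
  represents (fwrite (w, m) f) (shift m (write w t)).
Proof.
case=> h c; split; first by rewrite /= h; case: m.
by move=> j; rewrite /= nth_set_nth /= h c.
Qed.

Lemma represents_answer B q f t : represents f t -> oracle_answer B q t = fanswer B q f.1.
Proof.
case=> _ c; have tb i n : tape_bits t i n = fbits f.1 i n.
  by apply: eq_from_tnth => j; rewrite !tnth_mktuple c.
by case: q; rewrite /oracle_answer /fanswer !tb.
Qed.

Definition femb S S' (emb : S -> S') (f : ftape S) : ftape S' :=
  (fun j => omap emb (f.1 j), f.2).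

Lemma femb_write S S' (emb : S -> S') (f : ftape S) w m :
  fwrite (omap emb w, m) (femb emb f) = femb emb (fwrite (w, m) f).
Proof.
congr pair; apply: functional_extensionality => j /=.
by case: ifP.
Qed.

Section Machine.

Variables (r d : nat) (V : finType) (E : option V -> seq (prim r * option V)).

Definition sym : finType :=
  (letter + (bool + option (option V) * {ffun 'I_d -> bool}))%type.
Definition mark (b : bool) : sym := inr (inl b).
(* The node to be executed next, [None] being the exit, and the directions of the
   clock heads, [true] for right. *)
Definition control (o : option (option V)) (ds : {ffun 'I_d -> bool}) : sym := inr (inr (o, ds)).
Definition letter_of (x : option sym) : option letter :=
  if x is Some (inl a) then Some a else None.

Definition key : finType := ((bool + 'I_r.+1) + 'I_d)%type.
Definition kcontrol : key := inl (inl true).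
Definition kstore : key := inl (inl false).
Definition kreg (i : 'I_r.+1) : key := inl (inr i).
Definition kclock (j : 'I_d) : key := inr j.

(** Each query has a single state, so the return address cannot be kept in the state and stands on
    the control tape instead. A query state continues exactly like [mrun]. *)
Definition mstate : finType := (bool * bool + bool * bool)%type.
Definition qcode (q : query) : bool * bool :=
  match q with
  | QValid => (true, true)
  | QInv => (true, false)
  | QProd => (false, true)
  | QId => (false, false)
  end.
Definition mquery (q : query) : mstate := inl (qcode q).
Definition minit : mstate := inr (true, true).
Definition mcopy : mstate := inr (true, false).
Definition mrun : mstate := inr (false, true).
Definition mdone : mstate := inr (false, false).

Lemma mquery_inj : injective mquery.
Proof. by move=> [] []. Qed.

Definition by_key (f : key -> option sym * move) : {ffun 'I_#|key| -> option sym * move} :=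
  [ffun i => f (enum_val i)].

Section Delta.
Variable scan : key -> option sym.

Definition blocked (ds : {ffun 'I_d -> bool}) (j : 'I_d) : bool :=
  if ds j then scan (kclock j) == None else scan (kclock j) == Some (mark true).
(** A head moves or turns only when all lower heads stand at the ends of their tracks. A turn
    exchanges [pos] and [top - pos], so a digit passes from 0 to [top] in one step, without a
    journey back. *)
Definition turn_reached ds (j : 'I_d) : bool :=
  [forall i : 'I_d, (i < j) ==> blocked ds i].
Definition tick_directions ds : {ffun 'I_d -> bool} :=
  [ffun j => if turn_reached ds j && blocked ds j then ~~ ds j else ds j].
Definition tick_move ds (j : 'I_d) : move :=
  if turn_reached ds j && ~~ blocked ds j then (if ds j then MoveRight else MoveLeft)
  else Stay.

Definition run_action ds (p : prim r) (t : option V)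
    (a : (option bool * move) * (option letter * move) * (option letter * move)) :
    action mstate sym #|key| :=
  Action (if p_query p is Some q then mquery q else mrun) Stay a.1.1.1 a.1.1.2
    (by_key (fun k => match k with
      | inl (inl true) => (Some (control (omap Some t) (tick_directions ds)), Stay)
      | inl (inl false) => (omap inl a.1.2.1, a.1.2.2)
      | inl (inr i) => if i == p_reg p then (omap inl a.2.1, a.2.2) else (scan k, Stay)
      | inr j => (scan k, tick_move ds j)
      end)).

(** When all clock heads are blocked no instruction can be taken, so an overlong computation halts
    without accepting. The exit is tested first and leads to the only accepting state. *)
Definition run_actions (orc : option bool) : seq (action mstate sym #|key|) :=
  match scan kcontrol with
  | Some (inr (inr (None, _))) =>
      [:: Action mdone Stay orc Stay (by_key (fun k => (scan k, Stay)))]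
  | Some (inr (inr (Some o, ds))) =>
      if [forall j, blocked ds j] then [::]
      else pmap (fun e : prim r * option V =>
        omap (run_action ds e.1 e.2)
          (p_fun e.1 orc (letter_of (scan kstore)) (letter_of (scan (kreg (p_reg e.1))))))
        (E o)
  | _ => [::]
  end.

Definition init_action (orc : option bool) : action mstate sym #|key| :=
  Action mcopy Stay orc Stay (by_key (fun k => match k with
    | inl (inl false) => (scan k, MoveRight)
    | inl _ => (scan k, Stay)
    | inr _ => (Some (mark true), MoveRight)
    end)).

(** Each copied letter also puts a mark on every clock tape, so the tracks get the length of the
    input without any arithmetic. *)
Definition copy_action (orc : option bool) (inp : option letter) :
    action mstate sym #|key| :=
  if inp is Some a then
    Action mcopy MoveRight orc Stay (by_key (fun k => match k with
      | inl (inl false) => (Some (inl a), MoveRight)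
      | inl _ => (scan k, Stay)
      | inr _ => (Some (mark false), MoveRight)
      end))
  else
    Action mrun Stay orc Stay (by_key (fun k =>
      if k == kcontrol then (Some (control (Some None) [ffun => false]), Stay)
      else (scan k, Stay))).

End Delta.

Definition mdelta (st : mstate) (inp : option letter) (orc : option bool)
    (sc : {ffun 'I_#|key| -> option sym}) : seq (action mstate sym #|key|) :=
  let scan k := sc (enum_rank k) in
  match st with
  | inr (true, true) => [:: init_action scan orc]
  | inr (true, false) => [:: copy_action scan orc inp]
  | inr (false, false) => [::]
  | _ => run_actions scan orc
  end.

Definition machine : bbTM :=
  @BBTM mstate sym #|key| minit (pred1 mdone) mquery mquery_inj mdelta.

Variable B : blackBox.

Definition tapes_of (c : config machine) (o : ftape bool) (tp : key -> ftape sym) : Prop :=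
  represents o (c_oracle c) /\ forall k, represents (tp k) (c_work c (enum_rank k)).

Lemma scan_tapes c o tp : tapes_of c o tp ->
  (fun k => [ffun i => read (c_work c i)] (enum_rank k)) = (fun k => fread (tp k)).
Proof.
by case=> _ h; apply: functional_extensionality => k; rewrite ffunE (represents_read (h k)).
Qed.

Lemma apply_action_tapes c o tp st im ow om f : tapes_of c o tp ->
  tapes_of (apply_action (T := machine) B c (Action st im ow om (by_key f)))
    (match st with
     | inl _ => (nth None (cells (oracle_update B (T := machine) st
          (shift om (write ow (c_oracle c))))), 0)
     | inr _ => fwrite (ow, om) o
     end) (fun k => fwrite (f k) (tp k)).
Proof.
case=> ho hw; split; last first.
  move=> k; rewrite /= !ffunE enum_rankK; case: (f k) => w m /=.
  by apply: represents_act (hw k).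
case: st => [[[] []]|st] //=.
have -> : oracle_update B (T := machine) (inr st) (shift om (write ow (c_oracle c))) =
  shift om (write ow (c_oracle c)) by [].
exact: represents_act ho.
Qed.

Lemma tapes_of_ext c o tp o' tp' : tapes_of c o tp -> o = o' ->
  (forall k, tp k = tp' k) -> tapes_of c o' tp'.
Proof. by move=> [ho hw] <- e; split=> // k; rewrite -e. Qed.

Lemma ask_oracle c o q ow om : represents o (c_oracle (T := machine) c) ->
  cells (oracle_update B (T := machine) (mquery q) (shift om (write ow (c_oracle c)))) =
  map Some (fanswer B q (fwrite (ow, om) o).1).
Proof.
move=> h; rewrite -(represents_answer B q (represents_act ow om h)).
by case: q.
Qed.

Section Run.

Variable top : nat.
Hypothesis top0 : 0 < top.

Definition clock_cells (x : nat) : option sym :=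
  if x == 0 then Some (mark true) else if x < top then Some (mark false) else None.

Definition run_tapes (o : option (option V)) (ds : {ffun 'I_d -> bool})
    (pos : 'I_d -> nat) (s : lstate r) (k : key) : ftape sym :=
  match k with
  | inl (inl true) => (fun j => if j == 0 then Some (control o ds) else None, 0)
  | inl (inl false) => femb inl (l_store s)
  | inl (inr i) => femb inl (l_reg s i)
  | inr j => (clock_cells, pos j)
  end.

Definition remaining (ds : {ffun 'I_d -> bool}) (pos : 'I_d -> nat) (j : 'I_d) : nat :=
  if ds j then top - pos j else pos j.

Definition running (st : mstate) : bool := if st is inr x then x == (false, true) else true.

Definition run_config (c : config machine) o ds pos s : Prop :=
  [/\ running (c_state c), tapes_of c (l_oracle s) (run_tapes o ds pos s)
    & forall j, pos j <= top].

Lemma blocked_remaining o ds pos s j : (forall j, pos j <= top) ->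
  blocked (fun k => fread (run_tapes o ds pos s k)) ds j = (remaining ds pos j == 0).
Proof.
move=> le; rewrite /blocked /remaining /fread /= /clock_cells.
case: (ds j); case: (pos j) => [|x] //=.
- by case: (top) top0.
- by rewrite subn_eq0; case: leqP.
- by case: leqP.
Qed.

Definition tick_pos scan ds (pos : 'I_d -> nat) (j : 'I_d) : nat :=
  fmove (tick_move scan ds j) (pos j).

Section Tick.
Variables (o : option (option V)) (ds : {ffun 'I_d -> bool}) (pos : 'I_d -> nat) (s : lstate r).
Hypothesis le_pos : forall j, pos j <= top.
Local Notation scan := (fun k => fread (run_tapes o ds pos s k)).

Lemma turn_settled j : turn_reached scan ds j = settled (remaining ds pos) j.
Proof. by apply: eq_forallb => i; rewrite blocked_remaining. Qed.

Lemma tick_pos_le j : tick_pos scan ds pos j <= top.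
Proof.
rewrite /tick_pos /tick_move; case: ifP => [/andP[_]|_]; last exact: le_pos.
rewrite blocked_remaining // /remaining; case: (ds j) => /=.
  by rewrite subn_eq0 -ltnNge.
by move=> _; apply: leq_trans (leq_pred _) (le_pos j).
Qed.

Lemma tick_remaining j : remaining (tick_directions scan ds) (tick_pos scan ds pos) j =
  odo_next top (remaining ds pos) j.
Proof.
rewrite /odo_next -turn_settled /tick_pos /tick_move.
rewrite {1}/remaining ffunE blocked_remaining //.
case: (turn_reached scan ds j) => //=.
move: (le_pos j); rewrite /remaining; case: (ds j) => /=; case: eqP => //= e le; lia.
Qed.

Lemma tick_odo : ~~ [forall j, blocked scan ds j] -> odo top (remaining ds pos) =
  (odo top (remaining (tick_directions scan ds) (tick_pos scan ds pos))).+1.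
Proof.
rewrite negb_forall => /existsP [j]; rewrite blocked_remaining // => /odo_nextE -> .
by congr S; apply: eq_bigr => i _; rewrite tick_remaining.
Qed.

End Tick.

Lemma run_action_config c o ds pos s p t s' a : run_config c (Some o) ds pos s ->
  let scan k := fread (run_tapes (Some o) ds pos s k) in
  p_fun p (fread (l_oracle s)) (fread (l_store s)) (fread (l_reg s (p_reg p))) = Some a ->
  lstep B p s = Some s' ->
  run_config (apply_action (T := machine) B c (run_action scan ds p t a))
    (omap Some t) (tick_directions scan ds) (tick_pos scan ds pos) s'.
Proof.
move=> [_ tc le] scan ea; rewrite /lstep ea; case: a ea => [[[ow om] [sw sm]] [rw rm]] ea [<-].
split; [by rewrite /=; case: (p_query p)| |by move=> j; apply: tick_pos_le].
apply: tapes_of_ext; first exact: (apply_action_tapes _ _ _ _ _ tc).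
  case: (p_query p) => [q|] //=; by rewrite (ask_oracle q ow om tc.1).
case=> [[[]|i]|j] /=.
- congr pair; apply: functional_extensionality => -[|j] //=.
- exact: femb_write.
- rewrite /upd; case: eqP => [->|_]; first exact: femb_write.
  by rewrite fwrite_stay.
- by rewrite fwrite_keep.
Qed.

Lemma letter_of_emb x : letter_of (omap inl x) = x.
Proof. by case: x. Qed.

Lemma run_actionsE c o ds pos s : run_config c o ds pos s ->
  tm_delta (c_state c) (read (c_input c)) (read (c_oracle c))
    [ffun i => read (c_work c i)] =
  run_actions (fun k => fread (run_tapes o ds pos s k)) (fread (l_oracle s)).
Proof.
case=> run tc _; rewrite -(represents_read tc.1) -(scan_tapes tc) /=.
by case: (c_state c) run => [[]|[[] []]].
Qed.

Lemma In_pmap A A' (f : A -> option A') x l :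
  List.In x (pmap f l) <-> exists2 y, f y = Some x & List.In y l.
Proof.
elim: l => [|z l IH] /=; first by split=> // [[]].
case e: (f z) => [u|] /=; split.
- by case=> [<-|/IH [y ey ly]]; [exists z => //; left|exists y => //; right].
- case=> y ey [zy|ly]; last by right; apply/IH; exists y.
  by left; move: ey; rewrite -zy e => -[].
- by case/IH => y ey ly; exists y => //; right.
- case=> y ey [zy|ly]; last by apply/IH; exists y.
  by move: ey; rewrite -zy e.
Qed.

Definition ticked c' o' ds pos s' : Prop := exists ds' pos',
  run_config c' o' ds' pos' s' /\
  odo top (remaining ds pos) = (odo top (remaining ds' pos')).+1.

Lemma machine_step c o ds pos s p t s' : run_config c (Some o) ds pos s ->
  odo top (remaining ds pos) != 0 -> List.In (p, t) (E o) -> lstep B p s = Some s' ->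
  exists2 c', step (T := machine) B c c' & ticked c' (omap Some t) ds pos s'.
Proof.
move=> rc nz i st; have [_ _ le] := rc.
have [a ea] : exists a, p_fun p (fread (l_oracle s)) (fread (l_store s))
    (fread (l_reg s (p_reg p))) = Some a.
  by move: st; rewrite /lstep; case: (p_fun _ _ _ _) => // a _; exists a.
set scan := fun k => fread (run_tapes (Some o) ds pos s k).
have nb : ~~ [forall j, blocked scan ds j].
  apply: contra nz => /forallP b; rewrite /odo big1 // => j _.
  by have := b j; rewrite /scan blocked_remaining // => /eqP ->.
exists (apply_action (T := machine) B c (run_action scan ds p t a)).
  exists (run_action scan ds p t a); split=> //.
  rewrite (run_actionsE rc) /run_actions /= (negPf nb); apply/In_pmap.
  by exists (p, t) => //=; rewrite /fread /= !letter_of_emb ea.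
exists (tick_directions scan ds), (tick_pos scan ds pos); split.
  exact: run_action_config ea st.
exact: tick_odo.
Qed.

Lemma machine_step_inv c o ds pos s c' : run_config c (Some o) ds pos s ->
  step (T := machine) B c c' -> exists p t s',
  [/\ List.In (p, t) (E o), lstep B p s = Some s' & ticked c' (omap Some t) ds pos s'].
Proof.
move=> rc [a []]; rewrite (run_actionsE rc) /run_actions /=.
set scan := fun k => fread (run_tapes (Some o) ds pos s k).
case: ifP => // /negbT nb /In_pmap [[p t] /= + i ->].
rewrite /fread /= !letter_of_emb; case ea: (p_fun _ _ _ _) => [x|//] [<-].
have [s' st] : exists s', lstep B p s = Some s'.
  by rewrite /lstep ea; case: (x) => [[? ?] ?]; eexists.
exists p, t, s'; split=> //.
exists (tick_directions scan ds), (tick_pos scan ds pos); split.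
  exact: run_action_config ea st.
by apply: tick_odo nb; have [] := rc.
Qed.

Lemma exit_step c ds pos s c' : run_config c None ds pos s ->
  step (T := machine) B c c' <-> c' = apply_action (T := machine) B c
   (Action mdone Stay (fread (l_oracle s)) Stay
     (by_key (fun k => (fread (run_tapes None ds pos s k), Stay)))).
Proof.
move=> rc; split.
  by case=> a []; rewrite (run_actionsE rc) /run_actions /= => -[<-|[]].
move=> ->; eexists; split; last by reflexivity.
by rewrite (run_actionsE rc) /run_actions /=; left.
Qed.

(** The clock goes down by one per instruction, so a walk not longer than its initial value reaches
    the exit before a further instruction is refused. *)
Lemma walk_run o s s' n : walk B E o s s' n -> forall c ds pos,
  run_config c (Some o) ds pos s -> n <= odo top (remaining ds pos) ->
  exists m c', run (T := machine) B m c c' /\ c_state c' = mdone.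
Proof.
elim=> {o s s' n} [o p s s' i st|o p v s s1 s' n i st _ IH] c ds pos rc le.
  have nz : odo top (remaining ds pos) != 0 by rewrite -lt0n.
  have [c1 st1 [ds' [pos' [rc' _]]]] := machine_step rc nz i st.
  have [c2 [st2 e2]] : exists c2, step (T := machine) B c1 c2 /\ c_state c2 = mdone.
    by eexists; split; first exact/(proj2 (exit_step _ rc')).
  by exists 2, c2; split=> //; exists c1; split=> //; exists c2.
have nz : odo top (remaining ds pos) != 0 by rewrite -lt0n (leq_trans _ le).
have [c1 st1 [ds' [pos' [rc' e]]]] := machine_step rc nz i st.
have [|m [c' [rm fm]]] := IH c1 ds' pos' rc'; first by rewrite e in le.
by exists m.+1, c'; split=> //; exists c1.
Qed.

Lemma done_no_step (c c' : config machine) : c_state c = mdone -> ~ step (T := machine) B c c'.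
Proof. by move=> e [a []]; rewrite e. Qed.

Lemma run_walk m c c' o ds pos s : run_config c (Some o) ds pos s ->
  run (T := machine) B m c c' -> c_state c' = mdone -> exists s' n, walk B E o s s' n.
Proof.
elim: m c o ds pos s => [|m IH] c o ds pos s rc /=.
  by move=> <- e; case: rc; rewrite e.
case=> c1 [st1 rm] e.
have [p [[v|] [s1 [i st [ds' [pos' [rc' _]]]]]]] := machine_step_inv rc st1.
  by have [s' [n w]] := IH _ _ _ _ _ rc' rm e; exists s', n.+1; exact: (WalkStep i st w).
by exists s1, 1; exact: (WalkExit i st).
Qed.

Lemma run_bound m c c' o ds pos s : run_config c o ds pos s ->
  run (T := machine) B m c c' -> m <= (odo top (remaining ds pos)).+2.
Proof.
elim: m c o ds pos s => [//|m IH] c [o|] ds pos s rc /= [c1 [st1 rm]].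
  have [p [t [s1 [i st [ds' [pos' [rc' ->]]]]]]] := machine_step_inv rc st1.
  exact: IH rc' rm.
move/(exit_step _ rc): st1 rm => ->; case: m {IH} => // m [c2 [st2 _]].
by exfalso; apply: (done_no_step _ st2).
Qed.

End Run.

Lemma delta_step c a :
  List.In a (tm_delta (c_state c) (read (c_input c)) (read (c_oracle c))
    [ffun i => read (c_work c i)]) -> exists c', step (T := machine) B c c'.
Proof. by move=> i; exists (apply_action (T := machine) B c a), a. Qed.

(** * The copying phase and the correctness of the whole machine *)

Section Copy.

Variable X : seq letter.
Local Notation W := (input_word (bb_b B) (bb_c B) X).
Local Notation n := (size W).

Definition start_state : lstate r :=
  LState (fblank bool) (word_tape W n.+1) (fun=> fblank letter).

Definition copy_tapes (i : nat) (k : key) : ftape sym :=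
  match k with
  | inl (inl false) => femb inl (word_tape (take i W) i.+1)
  | inl _ => fblank sym
  | inr j => (fun x => if x == 0 then Some (mark true)
                       else if x <= i then Some (mark false) else None, i.+1)
  end.

Definition copy_config (c : config machine) (i : nat) : Prop :=
  [/\ c_state c = mcopy, c_input c = Tape (map Some W) i, i <= n
    & tapes_of c (fblank bool) (copy_tapes i)].

Lemma init_step c : step (T := machine) B (init machine (bb_b B) (bb_c B) X) c ->
  copy_config c 0.
Proof.
case=> a [] /= [<-|//] ->; split=> //.
have t0 : tapes_of (init machine (bb_b B) (bb_c B) X) (fblank bool) (fun=> fblank sym).
  split; first by split=> // j; rewrite /= nth_nil.
  by move=> k; rewrite /= ffunE; split=> // j; rewrite /= nth_nil.
apply: tapes_of_ext; first exact: (apply_action_tapes _ _ _ _ _ t0).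
  exact: fwrite_stay.
have sc k : [ffun i => read ([ffun=> blank_tape sym] i)] (enum_rank k : 'I_#|key|) = None.
  by rewrite !ffunE.
case=> [[[]|i]|j] /=; rewrite ?sc.
- exact: fwrite_stay.
- congr pair; apply: functional_extensionality => j /=.
  by rewrite take0; case: j => [|[]].
- exact: fwrite_stay.
- congr pair; apply: functional_extensionality => x /=.
  by case: x.
Qed.

Lemma init_step_exists :
  exists c, step (T := machine) B (init machine (bb_b B) (bb_c B) X) c.
Proof. by apply: delta_step => /=; left. Qed.

Lemma copy_deltaE c i : copy_config c i ->
  tm_delta (c_state c) (read (c_input c)) (read (c_oracle c))
    [ffun i => read (c_work c i)] =
  [:: copy_action (fun k => fread (copy_tapes i k)) None (nth None (map Some W) i)].
Proof.
case=> -> -> _ tc; rewrite -(scan_tapes tc).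
by rewrite (represents_read tc.1).
Qed.

Lemma copy_step_exists c i : copy_config c i -> exists c', step (T := machine) B c c'.
Proof.
by move=> cc; apply: delta_step; rewrite (copy_deltaE cc); left.
Qed.

Lemma copy_step c c' i : i < n -> copy_config c i -> step (T := machine) B c c' ->
  copy_config c' i.+1.
Proof.
move=> lt cc [a []]; rewrite (copy_deltaE cc) => -[<-|//] ->.
have [_ ic _ tc] := cc.
have e : nth None (map Some W) i = Some (nth None W i) by rewrite (nth_map None).
rewrite e; split=> //; first by rewrite /= ic.
apply: tapes_of_ext; first exact: (apply_action_tapes _ _ _ _ _ tc).
  exact: fwrite_stay.
case=> [[[]|l]|j] /=.
- exact: fwrite_stay.
- rewrite -[Some (inl _)]/(omap inl (Some (nth None W i))) femb_write; congr femb.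
  congr pair; apply: functional_extensionality => x /=.
  rewrite (take_nth None lt) map_rcons -rcons_cons nth_rcons /= size_map size_takel ?(ltnW lt) //.
  by case: ltngtP => // lx; rewrite nth_default // /= size_map size_takel ?(ltnW lt) // ltnW.
- exact: fwrite_stay.
- congr pair; apply: functional_extensionality => x /=.
  by case: x => // x; rewrite eqSS ltnS [x <= i]leq_eqVlt; case: eqP.
Qed.

Lemma copy_stop c c' : copy_config c n -> step (T := machine) B c c' ->
  run_config n.+1 c' (Some None) [ffun=> false] (fun=> n.+1) start_state.
Proof.
move=> cc [a []]; rewrite (copy_deltaE cc) => -[<-|//] ->.
have [_ ic _ tc] := cc.
rewrite nth_default ?size_map //; split=> //.
apply: tapes_of_ext; first exact: (apply_action_tapes _ _ _ _ _ tc).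
  exact: fwrite_stay.
case=> [[[]|l]|j].
- rewrite eqxx; congr pair; apply: functional_extensionality => x /=.
- by rewrite fwrite_stay /= take_size.
- exact: fwrite_stay.
- rewrite fwrite_stay; congr pair; apply: functional_extensionality => x /=.
Qed.

(** All clock heads start at the far end and face left, so every digit has its largest value. *)
Lemma start_remaining :
  (odo n.+1 (remaining n.+1 [ffun=> false] (fun=> n.+1))).+1 = n.+2 ^ d.
Proof.
rewrite -geometric_top; congr S; apply: eq_bigr => j _.
by rewrite /remaining ffunE.
Qed.

Lemma machine_halts : halts_within B machine X (n + n.+2 ^ d + 3).
Proof.
have copying i c c' m : copy_config c i -> run (T := machine) B m c c' ->
    m <= n - i + n.+2 ^ d + 2.
  have [j le] := ubnP (n - i); elim: j i c m le => // j IH i c [//|m] le cc [c1 [st rm]].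
  have [_ _ lei _] := cc; case: (ltngtP i n) lei => // [lt|e] _.
    have lt' : n - i.+1 < j by lia.
    by have := IH _ _ _ lt' (copy_step lt cc st) rm; lia.
  have := copy_stop (eq_ind i _ cc n e) st; move/run_bound/(_ rm).
  by have := start_remaining; lia.
by move=> [//|m] c [c1 [/init_step cc rm]]; have := copying _ _ _ _ cc rm; lia.
Qed.

Lemma machine_sound : accepts B machine X -> exists s' m, walk B E None start_state s' m.
Proof.
have copying i c c' m : copy_config c i -> run (T := machine) B m c c' ->
    c_state c' = mdone -> exists s' m, walk B E None start_state s' m.
  have [j le] := ubnP (n - i); elim: j i c m le => // j IH i c [|m] le cc.
    by move=> <- e; case: cc; rewrite e.
  case=> c1 [st rm] e.
  have [_ _ lei _] := cc; case: (ltngtP i n) lei => // [lt|ei] _.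
    by apply: IH (copy_step lt cc st) rm e; lia.
  exact: run_walk (copy_stop (eq_ind i _ cc n ei) st) rm e.
case=> -[|m] [c [rm _ /eqP e]]; first by move: e; rewrite -rm.
by case: rm => c1 [/init_step cc rm]; apply: copying cc rm e.
Qed.

Lemma machine_complete s' m : walk B E None start_state s' m -> m < n.+2 ^ d ->
  accepts B machine X.
Proof.
move=> w lt.
have copying i c : copy_config c i ->
    exists m' c', run (T := machine) B m' c c' /\ c_state c' = mdone.
  have [j le] := ubnP (n - i); elim: j i c le => // j IH i c le cc.
  have [c1 st] := copy_step_exists cc.
  have [_ _ lei _] := cc; case: (ltngtP i n) lei => // [lti|ei] _.
    have lt' : n - i.+1 < j by lia.
    have [m' [c' [rm e]]] := IH _ _ lt' (copy_step lti cc st).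
    by exists m'.+1, c'; split=> //; exists c1.
  have rc := copy_stop (eq_ind i _ cc n ei) st.
  have [||m' [c' [rm e]]] := walk_run _ w rc; rewrite //.
    by have := start_remaining; lia.
  by exists m'.+1, c'; split=> //; exists c1.
have [c st] := init_step_exists.
have [m' [c' [rm e]]] := copying _ _ (init_step st).
exists m'.+1, c'; split; [by exists c| |by rewrite /= e].
by case=> c'' /(done_no_step e).
Qed.

End Copy.
End Machine.

(** * Executions of programs *)

Arguments fread : simpl never.
Arguments fwrite : simpl never.
Arguments word_tape : simpl never.

Lemma fread_word_tape S (u v : seq S) : fread (word_tape (u ++ v) (size u).+1) = ohead v.
Proof. by rewrite /fread /= map_cat nth_cat size_map ltnn subnn; case: v. Qed.

Lemma fread_word_tape_end S (u : seq S) : fread (word_tape u (size u).+1) = None.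
Proof. by have := fread_word_tape u [::]; rewrite cats0. Qed.

Lemma word_tape_append S (u : seq S) a m :
  fwrite (Some a, m) (word_tape u (size u).+1) = word_tape (rcons u a) (fmove m (size u).+1).
Proof.
congr pair; apply: functional_extensionality => j /=.
case: j => // j; rewrite eqSS /= map_rcons nth_rcons size_map.
by case: ltngtP => // lt; rewrite nth_default // size_map ltnW.
Qed.

Lemma word_tape_erase S (u : seq S) a m :
  fwrite (None, m) (word_tape (rcons u a) (size u).+1) = word_tape u (fmove m (size u).+1).
Proof.
congr pair; apply: functional_extensionality => j /=.
case: j => // j; rewrite eqSS /= map_rcons nth_rcons size_map.
case: ltngtP => // h; first by rewrite nth_default // size_map ltnW.
by rewrite nth_default // size_map h.
Qed.

Definition bit_tape (u : seq bool) (p : nat) : ftape bool := (nth None (map Some u), p).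

Lemma bit_tape_append u a m :
  fwrite (Some a, m) (bit_tape u (size u)) = bit_tape (rcons u a) (fmove m (size u)).
Proof.
congr pair; apply: functional_extensionality => j /=.
rewrite map_rcons nth_rcons size_map; case: ltngtP => // lt.
by rewrite nth_default // size_map ltnW.
Qed.

Lemma fread_bit_tape u v : fread (bit_tape (u ++ v) (size u)) = ohead v.
Proof. by rewrite /fread /= map_cat nth_cat size_map ltnn subnn; case: v. Qed.

Section Programs.

Variables (B : blackBox) (r : nat).
Implicit Type s : lstate r.
Local Notation cmd := (cmd r).

(** The first half serves completeness and the running time, the second soundness: the outcome is
    unique. Genuine guesses are confined to commands that have no [spec]. *)
Definition spec (c : cmd) s s' n : Prop :=
  (exists m, m <= n /\ exec B c s s' m) /\ (forall s'' m, exec B c s s'' m -> s'' = s').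

Definition fails (c : cmd) s : Prop := forall s' m, ~ exec B c s s' m.

Lemma spec_leq c s s' n n' : n <= n' -> spec c s s' n -> spec c s s' n'.
Proof. by move=> le [[m [l e]] u]; split=> //; exists m; split=> //; apply: leq_trans le. Qed.

Lemma exec_Do p s s' n : exec B (Do p) s s' n -> lstep B p s = Some s'.
Proof.
move: {-2}(Do p) (erefl (Do p)) => c e ex; case: ex e => // {c n}.
by move=> q t t' st [<-].
Qed.

Lemma exec_Seq c1 c2 s s' n : exec B (Seq c1 c2) s s' n ->
  exists s1 n1 n2, [/\ exec B c1 s s1 n1, exec B c2 s1 s' n2 & n = n1 + n2].
Proof.
move: {-2}(Seq c1 c2) (erefl (Seq c1 c2)) => c e ex; case: ex e => // {c n}.
by move=> d1 d2 t t1 t' n1 n2 e1 e2 [<- <-]; exists t1, n1, n2.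
Qed.

Lemma exec_Alt c1 c2 s s' n : exec B (Alt c1 c2) s s' n ->
  exec B c1 s s' n \/ exec B c2 s s' n.
Proof.
move: {-2}(Alt c1 c2) (erefl (Alt c1 c2)) => c e ex; case: ex e => // {c n}.
  by move=> d1 d2 t t' n ? [<- _]; left.
by move=> d1 d2 t t' n ? [_ <-]; right.
Qed.

Lemma exec_Star c s s' n : exec B (Star c) s s' n -> s' = s \/
  exists s1 n1 n2, [/\ exec B c s s1 n1, exec B (Star c) s1 s' n2, n2 < n & n = n1 + n2].
Proof.
move: {-2}(Star c) (erefl (Star c)) => d e ex; case: ex e => // {d n}; first by left.
move=> d t t1 t' n1 n2 e1 e2 [<-]; right; exists t1, n1, n2; split=> //.
by rewrite -[X in X < _]add0n ltn_add2r; exact: walk_gt0 (exec_walk e1).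
Qed.

Lemma exec_Star_inv (P : lstate r -> Prop) c s s' n :
  (forall s s' n, P s -> exec B c s s' n -> P s') -> P s -> exec B (Star c) s s' n -> P s'.
Proof.
move=> inv; have [k le] := ubnP n; elim: k n s le => // k IH n s le Ps.
case/exec_Star => [-> //|[s1 [n1 [n2 [e1 e2 lt _]]]]].
apply: IH (inv _ _ _ Ps e1) e2; exact: leq_trans lt le.
Qed.

Lemma spec_Do p s s' : lstep B p s = Some s' -> spec (Do p) s s' 1.
Proof.
move=> st; split; first by exists 1; split=> //; apply: ExecDo.
by move=> s'' m /exec_Do; rewrite st => -[].
Qed.

Lemma fails_Do p s : lstep B p s = None -> fails (Do p) s.
Proof. by move=> st s' m /exec_Do; rewrite st. Qed.

Lemma spec_Seq c1 c2 s s1 s' n1 n2 : spec c1 s s1 n1 -> spec c2 s1 s' n2 ->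
  spec (Seq c1 c2) s s' (n1 + n2).
Proof.
move=> [[m1 [l1 e1]] u1] [[m2 [l2 e2]] u2]; split.
  by exists (m1 + m2); split; [apply: leq_add|apply: ExecSeq e1 e2].
by move=> s'' m /exec_Seq [t [k1 [k2 [/u1 -> /u2]]]].
Qed.

Lemma fails_Seq1 c1 c2 s : fails c1 s -> fails (Seq c1 c2) s.
Proof. by move=> f s' m /exec_Seq [t [k1 [k2 [/f]]]]. Qed.

Lemma fails_Seq2 c1 c2 s s1 n : spec c1 s s1 n -> fails c2 s1 -> fails (Seq c1 c2) s.
Proof. by move=> [_ u] f s' m /exec_Seq [t [k1 [k2 [/u -> /f]]]]. Qed.

Lemma spec_AltL c1 c2 s s' n : spec c1 s s' n -> fails c2 s -> spec (Alt c1 c2) s s' n.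
Proof.
move=> [[m [l e]] u] f; split; first by exists m; split=> //; apply: ExecAltL.
by move=> s'' k /exec_Alt [/u|/f].
Qed.

Lemma spec_AltR c1 c2 s s' n : fails c1 s -> spec c2 s s' n -> spec (Alt c1 c2) s s' n.
Proof.
move=> f [[m [l e]] u]; split; first by exists m; split=> //; apply: ExecAltR.
by move=> s'' k /exec_Alt [/f|/u].
Qed.

(** [Star] may stop at any moment; this becomes a deterministic while loop because in each use the
    guards of [p] and [e] exclude each other. *)
Definition loop (p e : prim r) : cmd := Seq (Star (Do p)) (Do e).

Lemma exec_loop p e s s' n : exec B (loop p e) s s' n -> lstep B e s = Some s' \/
  exists s1 m, lstep B p s = Some s1 /\ exec B (loop p e) s1 s' m.
Proof.
case/exec_Seq => t [n1 [n2 [/exec_Star [-> /exec_Do|] ]]]; first by left.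
move=> [s1 [k1 [k2 [/exec_Do st e1 _ _]]]] e2 _; right; exists s1, (k2 + n2); split=> //.
exact: ExecSeq e1 e2.
Qed.

Lemma loop_stop p e s s' : lstep B p s = None -> lstep B e s = Some s' ->
  spec (loop p e) s s' 3.
Proof.
move=> sp se; split.
  by exists 3; split=> //; apply: (ExecSeq (n1 := 2) (n2 := 1) (s1 := s));
    [apply: ExecStar0|apply: ExecDo].
by move=> s'' m /exec_loop [|[s1 [k []]]]; rewrite ?se ?sp // => -[].
Qed.

Lemma loop_step p e s s1 s' n : lstep B p s = Some s1 -> lstep B e s = None ->
  spec (loop p e) s1 s' n -> spec (loop p e) s s' n.+1.
Proof.
move=> sp se [[m [l ex]] u]; split.
  exists m.+1; split=> //; have [t [n1 [n2 [e1 e2 ->]]]] := exec_Seq ex.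
  by rewrite -addSn -add1n; apply: (ExecSeq _ e2); apply: (ExecStarS _ e1); apply: ExecDo.
by move=> s'' k /exec_loop [|[t [j []]]]; rewrite ?se ?sp // => -[<-] /u.
Qed.

Lemma loop_fails p e s : lstep B p s = None -> lstep B e s = None -> fails (loop p e) s.
Proof. by move=> sp se s' m /exec_loop []; rewrite ?se // => -[t [j []]]; rewrite sp. Qed.

Lemma loop_fails_step p e s s1 : lstep B p s = Some s1 -> lstep B e s = None ->
  fails (loop p e) s1 -> fails (loop p e) s.
Proof.
move=> sp se f s' m /exec_loop []; rewrite ?se // => -[t [j []]].
by rewrite sp => -[<-] /f.
Qed.

(** * Instructions on a single tape *)

(* [None] is the store. *)
Definition get_tape s (k : option 'I_r.+1) : ftape letter :=
  if k is Some i then l_reg s i else l_store s.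

Definition set_tape s (k : option 'I_r.+1) t : lstate r :=
  if k is Some i then LState (l_oracle s) (l_store s) (upd (l_reg s) i t)
  else LState (l_oracle s) t (l_reg s).

Lemma get_set_tape s k t : get_tape (set_tape s k t) k = t.
Proof. by case: k => //= i; rewrite upd_same. Qed.

Lemma set_set_tape s k t t' : set_tape (set_tape s k t) k t' = set_tape s k t'.
Proof. by case: k => //= i; rewrite upd_upd. Qed.

Lemma set_get_tape s k : set_tape s k (get_tape s k) = s.
Proof. by case: s => o w x; case: k => //= i; rewrite upd_id. Qed.

Definition on_tape (k : option 'I_r.+1) (f : option letter -> option (option letter * move)) :
    prim r :=
  if k is Some i then
    Prim i (fun o y x => omap (fun a => ((o, Stay), (y, Stay), a)) (f x)) None
  else Prim ord0 (fun o y x => omap (fun a => ((o, Stay), a, (x, Stay))) (f y)) None.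

Lemma lstep_on_tape k f s : lstep B (on_tape k f) s =
  omap (fun a => set_tape s k (fwrite a (get_tape s k))) (f (fread (get_tape s k))).
Proof.
case: k => [i|] /=; rewrite /lstep /=; case: (f _) => //= a.
  by rewrite !fwrite_stay.
by rewrite !fwrite_stay upd_id.
Qed.

Definition step_nonblank m (x : option letter) : option (option letter * move) :=
  if x is Some _ then Some (x, m) else None.
Definition erase_nonblank (x : option letter) : option (option letter * move) :=
  if x is Some _ then Some (None, MoveLeft) else None.
Definition at_blank (x : option letter) : option (option letter * move) :=
  if x is Some _ then None else Some (x, Stay).
Definition step_any m (x : option letter) : option (option letter * move) := Some (x, m).

(** The first move is unconditional because the head may stand on the blank behind the word; after
    it the head is inside the word or on cell 0, whose blank ends the loop. *)
Definition rewind k : cmd :=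
  Seq (Do (on_tape k (step_any MoveLeft)))
    (loop (on_tape k (step_nonblank MoveLeft)) (on_tape k at_blank)).
Definition goto_end k : cmd :=
  Seq (Do (on_tape k (step_any MoveRight)))
    (loop (on_tape k (step_nonblank MoveRight)) (on_tape k at_blank)).
Definition clear i : cmd :=
  Seq (goto_end (Some i)) (Seq (Do (on_tape (Some i) (step_any MoveLeft)))
    (loop (on_tape (Some i) erase_nonblank) (on_tape (Some i) at_blank))).

Lemma lstep_any k m s w p : get_tape s k = word_tape w p ->
  lstep B (on_tape k (step_any m)) s = Some (set_tape s k (word_tape w (fmove m p))).
Proof. by move=> e; rewrite lstep_on_tape e /= fwrite_keep. Qed.

Lemma lstep_nonblank k m s (u v : seq letter) a :
  get_tape s k = word_tape (u ++ a :: v) (size u).+1 ->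
  lstep B (on_tape k (step_nonblank m)) s =
    Some (set_tape s k (word_tape (u ++ a :: v) (fmove m (size u).+1))) /\
  lstep B (on_tape k at_blank) s = None.
Proof.
move=> e; rewrite !lstep_on_tape e fread_word_tape /=; split=> //.
by rewrite -[Some a]/(ohead (a :: v)) -(fread_word_tape u) fwrite_keep.
Qed.

Lemma lstep_at_blank k s f t : get_tape s k = t -> fread t = None -> f None = None ->
  lstep B (on_tape k f) s = None /\ lstep B (on_tape k at_blank) s = Some s.
Proof.
move=> e ft f0; rewrite !lstep_on_tape e ft f0 /=; split=> //.
by rewrite -[None]ft fwrite_stay -e set_get_tape.
Qed.

Lemma spec_rewind k s w p : get_tape s k = word_tape w p -> p <= (size w).+1 ->
  spec (rewind k) s (set_tape s k (word_tape w 0)) (p + 5).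
Proof.
move=> e le; apply: (spec_leq (n := 1 + (p.-1 + 3))); first by lia.
apply: spec_Seq; first exact: spec_Do (lstep_any MoveLeft e).
have {e le} : p.-1 <= size w by lia.
rewrite /=; move: p.-1 => {}p.
rewrite -(set_set_tape s k (word_tape w p) (word_tape w 0)).
move: (get_set_tape s k (word_tape w p)).
move: (set_tape s k (word_tape w p)) => {}s; elim: p s => [|p IH] s e le.
  have [h1 h2] := lstep_at_blank (f := step_nonblank MoveLeft) e (erefl _) (erefl _).
  by rewrite -[X in set_tape _ _ X]e set_get_tape; apply: loop_stop.
have ew : w = take p w ++ nth None w p :: drop p.+1 w.
  by rewrite -drop_nth // cat_take_drop.
have sp : size (take p w) = p by rewrite size_takel // ltnW.
rewrite ew -[in p.+1]sp in e; have [h1 h2] := lstep_nonblank MoveLeft e.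
rewrite sp -ew /= in h1; apply: (loop_step h1 h2).
rewrite -(set_set_tape s k (word_tape w p) (word_tape w 0)); apply: IH; last exact: ltnW.
exact: get_set_tape.
Qed.

Lemma spec_goto_end k s w : get_tape s k = word_tape w 0 ->
  spec (goto_end k) s (set_tape s k (word_tape w (size w).+1)) (size w + 4).
Proof.
move=> e; apply: (spec_leq (n := 1 + (size w + 3))); first by lia.
apply: spec_Seq; first exact: spec_Do (lstep_any MoveRight e).
rewrite -(set_set_tape s k (word_tape w 1) (word_tape w (size w).+1)).
move: (get_set_tape s k (word_tape w 1)).
rewrite /=; move: (set_tape s k (word_tape w 1)) => {e}s.
suff H (u v : seq letter) t : get_tape t k = word_tape (u ++ v) (size u).+1 ->
    spec (loop (on_tape k (step_nonblank MoveRight)) (on_tape k at_blank)) t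
     (set_tape t k (word_tape (u ++ v) (size (u ++ v)).+1)) (size v + 3).
  by move=> e; apply: (H [::]).
elim: v u t => [|a v IH] u t e.
  rewrite cats0 in e *.
  have [h1 h2] := lstep_at_blank (f := step_nonblank MoveRight) e (fread_word_tape_end u) (erefl _).
  by rewrite -[X in set_tape _ _ X]e set_get_tape; apply: loop_stop.
have [h1 h2] := lstep_nonblank MoveRight e; apply: (loop_step h1 h2).
rewrite -(set_set_tape t k (word_tape (u ++ a :: v) (size u).+2)
  (word_tape _ (size (u ++ a :: v)).+1)) /=.
have := IH (rcons u a); rewrite cat_rcons size_rcons; apply.
by rewrite get_set_tape.
Qed.

Lemma spec_clear i s w : l_reg s i = word_tape w 0 ->
  spec (clear i) s (set_tape s (Some i) (word_tape [::] 0)) (2 * size w + 8).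
Proof.
move=> e; apply: (spec_leq (n := (size w + 4) + (1 + (size w + 3)))); first by lia.
apply: spec_Seq; first exact: (spec_goto_end (k := Some i) e).
apply: spec_Seq.
  by apply: spec_Do; apply: lstep_any; rewrite get_set_tape.
rewrite set_set_tape -[fmove _ _]/(size w).
rewrite -(set_set_tape s (Some i) (word_tape w (size w)) (word_tape [::] 0)).
move: (get_set_tape s (Some i) (word_tape w (size w))).
move: (set_tape s (Some i) (word_tape w (size w))) => {e}s.
elim/last_ind: w s => [|w a IH] s e.
  have [h1 h2] := lstep_at_blank (f := erase_nonblank) e (erefl _) (erefl _).
  by rewrite -[X in set_tape _ _ X]e set_get_tape; apply: loop_stop.
have e' : get_tape s (Some i) = word_tape (w ++ [:: a]) (size w).+1.
  by rewrite e cats1 size_rcons.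
have h1 : lstep B (on_tape (Some i) erase_nonblank) s =
    Some (set_tape s (Some i) (word_tape w (size w))).
  by rewrite lstep_on_tape e' fread_word_tape /= cats1 word_tape_erase.
rewrite size_rcons addSn; apply: (loop_step h1).
  by case: (lstep_nonblank MoveLeft e').
rewrite -(set_set_tape s (Some i) (word_tape w (size w)) (word_tape [::] 0)); apply: IH.
exact: get_set_tape.
Qed.

End Programs.

(** * Transfers between the store, the registers and the oracle tape *)

Section Registers.

Variables (B : blackBox) (r : nat).
Local Notation spec := (@spec B r).
Local Notation fails := (@fails B r).
Implicit Types (o : ftape bool) (W : seq letter) (p : nat) (rg : 'I_r.+1 -> seq bool)
  (i : 'I_r.+1)
  (w : seq bool) (u v : seq letter).

Definition reg_tapes rg i : ftape letter := word_tape (map Some (rg i)) 0.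

(** Between commands every register head is back on cell 0; a command displaces one register at a
    time, a phase described by [reg_active]. *)
Definition at_rest o W p rg : lstate r := LState o (word_tape W p) (reg_tapes rg).

Definition reg_active o W p rg i w q : lstate r :=
  LState o (word_tape W p) (upd (reg_tapes rg) i (word_tape (map Some w) q)).

Lemma at_restE o W p rg i : at_rest o W p rg = reg_active o W p rg i (rg i) 0.
Proof. by rewrite /reg_active -[word_tape _ 0]/(reg_tapes rg i) upd_id. Qed.

Lemma reg_active0 o W p rg i w : reg_active o W p rg i w 0 = at_rest o W p (upd rg i w).
Proof.
congr LState; apply: functional_extensionality => j.
by rewrite /upd /reg_tapes; case: eqP.
Qed.

Lemma set_reg_active o W p rg i w q w' q' :
  set_tape (reg_active o W p rg i w q) (Some i) (word_tape (map Some w') q') =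
  reg_active o W p rg i w' q'.
Proof. by rewrite /reg_active /= upd_upd. Qed.

Lemma get_reg_active o W p rg i w q :
  get_tape (reg_active o W p rg i w q) (Some i) = word_tape (map Some w) q.
Proof. by rewrite /= upd_same. Qed.

Lemma spec_reg_start o W p rg i :
  spec (Do (on_tape (Some i) (step_any MoveRight))) (at_rest o W p rg)
    (reg_active o W p rg i (rg i) 1) 1.
Proof.
apply: spec_Do; rewrite (at_restE _ _ _ _ i).
by rewrite (lstep_any B MoveRight (get_reg_active o W p rg i (rg i) 0)) set_reg_active.
Qed.

Lemma spec_reg_rewind o W p rg i w q : q <= (size w).+1 ->
  spec (rewind (Some i)) (reg_active o W p rg i w q) (at_rest o W p (upd rg i w)) (q + 5).
Proof.
move=> le; rewrite -reg_active0 -(set_reg_active o W p rg i w q w 0).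
by apply: spec_rewind; rewrite ?get_reg_active ?size_map.
Qed.

Lemma spec_reg_clear o W p rg i :
  spec (clear i) (at_rest o W p rg) (at_rest o W p (upd rg i [::])) (2 * size (rg i) + 8).
Proof.
rewrite -reg_active0 [X in spec _ X](at_restE _ _ _ _ i).
rewrite -(set_reg_active o W p rg i (rg i) 0 [::] 0) -(size_map Some).
by apply: spec_clear; rewrite /= upd_same.
Qed.

Lemma spec_store_rewind o W p rg : p <= (size W).+1 ->
  spec (rewind None) (at_rest o W p rg) (at_rest o W 0 rg) (p + 5).
Proof. by move=> le; apply: (spec_rewind B (k := None)). Qed.

Lemma spec_store_end o W rg :
  spec (goto_end None) (at_rest o W 0 rg) (at_rest o W (size W).+1 rg) (size W + 4).
Proof. exact: (spec_goto_end B (k := None)). Qed.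

Definition on_both i (f : option letter -> option letter ->
    option ((option letter * move) * (option letter * move))) : prim r :=
  Prim i (fun z y x => omap (fun a => ((z, Stay), a.1, a.2)) (f y x)) None.

Definition on_oracle i (f : option bool -> option letter ->
    option ((option bool * move) * (option letter * move))) : prim r :=
  Prim i (fun z y x => omap (fun a => (a.1, (y, Stay), a.2)) (f z x)) None.

Lemma lstep_on_both i f o W p rg w q : lstep B (on_both i f) (reg_active o W p rg i w q) =
  omap (fun a => LState o (fwrite a.1 (word_tape W p))
      (upd (reg_tapes rg) i (fwrite a.2 (word_tape (map Some w) q))))
    (f (fread (word_tape W p)) (fread (word_tape (map Some w) q))).
Proof.
rewrite /lstep /= upd_same; case: (f _ _) => //= a.
by rewrite fwrite_stay upd_upd.
Qed.

Lemma lstep_on_oracle i f o W p rg w q : lstep B (on_oracle i f) (reg_active o W p rg i w q) =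
  omap (fun a => LState (fwrite a.1 o) (word_tape W p)
      (upd (reg_tapes rg) i (fwrite a.2 (word_tape (map Some w) q))))
    (f (fread o) (fread (word_tape (map Some w) q))).
Proof.
rewrite /lstep /= upd_same; case: (f _ _) => //= a.
by rewrite fwrite_stay upd_upd.
Qed.

Definition field (f : seq bool) : seq letter := rcons (map Some f) None.

Lemma fread_bits_end w : fread (word_tape (map Some w : seq letter) (size w).+1) = None.
Proof. by rewrite -(size_map Some w) fread_word_tape_end. Qed.

Lemma fread_bits (w1 w2 : seq bool) :
  fread (word_tape (map Some (w1 ++ w2) : seq letter) (size w1).+1) =
  omap Some (ohead w2).
Proof. by rewrite map_cat -(size_map Some w1) fread_word_tape; case: w2. Qed.

Lemma bits_append w b m : fwrite (Some (Some b), m) (word_tape (map Some w) (size w).+1) =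
  word_tape (map Some (rcons w b)) (fmove m (size w).+1).
Proof. by rewrite -(size_map Some w) word_tape_append map_rcons. Qed.

Definition copy_bit (y x : option letter) :=
  if y is Some (Some b) then Some ((y, MoveRight), (Some (Some b), MoveRight)) else None.
Definition pass_mark (y x : option letter) :=
  if y is Some None then Some ((y, MoveRight), (x, Stay)) else None.

Definition load i : cmd r :=
  Seq (clear i) (Seq (Do (on_tape (Some i) (step_any MoveRight)))
    (Seq (loop (on_both i copy_bit) (on_both i pass_mark)) (rewind (Some i)))).

Lemma spec_load_loop i o u (f : seq bool) v rg w :
  spec (loop (on_both i copy_bit) (on_both i pass_mark))
    (reg_active o (u ++ field f ++ v) (size u).+1 rg i w (size w).+1)
    (reg_active o (u ++ field f ++ v) (size u + size f).+2 rg i (w ++ f) (size (w ++ f)).+1)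
    (size f + 3).
Proof.
elim: f u w => [|b f IH] u w.
  rewrite cats0 addn0; apply: loop_stop; rewrite lstep_on_both fread_word_tape //=.
  rewrite !fwrite_stay -{1}[Some None]/(ohead ([:: None] ++ v)) -(fread_word_tape u).
  by rewrite fwrite_keep.
apply: (loop_step (s1 := reg_active o (u ++ field (b :: f) ++ v) (size u).+2 rg i
   (rcons w b) (size w).+2)).
- rewrite lstep_on_both fread_word_tape /= bits_append.
  by rewrite -{1}[Some (Some b)]/(ohead (field (b :: f) ++ v)) -(fread_word_tape u) fwrite_keep.
- by rewrite lstep_on_both fread_word_tape.
have := IH (rcons u (Some b)) (rcons w b).
by rewrite !size_rcons !cat_rcons [(size u).+1 + _]addSnnS.
Qed.

Lemma spec_load i o u (f : seq bool) v rg :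
  spec (load i) (at_rest o (u ++ field f ++ v) (size u).+1 rg)
    (at_rest o (u ++ field f ++ v) (size u + size f).+2 (upd rg i f))
    (2 * size (rg i) + 2 * size f + 20).
Proof.
apply: (spec_leq (n := (2 * size (rg i) + 8) + (1 + ((size f + 3) + ((size f).+1 + 5))))).
  by lia.
apply: spec_Seq; first exact: spec_reg_clear.
apply: spec_Seq; first exact: spec_reg_start.
rewrite upd_same; apply: spec_Seq; first exact: spec_load_loop.
by rewrite cat0s -[X in at_rest _ _ _ X](upd_upd rg i [::]); apply: spec_reg_rewind.
Qed.

Definition same_bit (y x : option letter) :=
  if (y, x) is (Some (Some b), Some (Some b')) then
    if b == b' then Some ((y, MoveRight), (x, MoveRight)) else None
  else None.
Definition both_end (y x : option letter) :=
  if (y, x) is (Some None, None) then Some ((y, MoveRight), (x, Stay)) else None.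

(** A mismatch blocks, so a wrongly guessed entry kills the computation; on success the store head
    ends behind the field, as after [load]. *)
Definition cmp i : cmd r :=
  Seq (Do (on_tape (Some i) (step_any MoveRight)))
    (Seq (loop (on_both i same_bit) (on_both i both_end)) (rewind (Some i))).

Lemma spec_cmp_loop i o u (f : seq bool) v rg (w1 w2 : seq bool) :
  if w2 == f then
    spec (loop (on_both i same_bit) (on_both i both_end))
      (reg_active o (u ++ field f ++ v) (size u).+1 rg i (w1 ++ w2) (size w1).+1)
      (reg_active o (u ++ field f ++ v) (size u + size f).+2 rg i (w1 ++ w2)
         (size (w1 ++ w2)).+1)
      (size f + 3)
  else fails (loop (on_both i same_bit) (on_both i both_end))
      (reg_active o (u ++ field f ++ v) (size u).+1 rg i (w1 ++ w2) (size w1).+1).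
Proof.
elim: f u w1 w2 => [|b f IH] u w1 [|b' w2] /=.
- rewrite cats0 addn0; apply: loop_stop; rewrite lstep_on_both fread_word_tape fread_bits_end //=.
  rewrite -{1}[Some None]/(ohead ([:: None] ++ v)) -(fread_word_tape u) fwrite_keep.
  by rewrite -{1}(fread_bits_end w1) fwrite_stay.
- by apply: loop_fails; rewrite lstep_on_both fread_word_tape fread_bits.
- by apply: loop_fails; rewrite lstep_on_both fread_word_tape cats0 fread_bits_end.
rewrite eqseq_cons eq_sym; case: eqP => [<-|ne] /=; last first.
  apply: loop_fails; rewrite lstep_on_both fread_word_tape fread_bits //= /same_bit.
  by case: eqP.
have st : lstep B (on_both i same_bit)
  (reg_active o (u ++ field (b :: f) ++ v) (size u).+1 rg i (w1 ++ b :: w2) (size w1).+1) =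
  Some (reg_active o (u ++ field (b :: f) ++ v) (size u).+2 rg i (w1 ++ b :: w2) (size w1).+2).
  rewrite lstep_on_both fread_word_tape fread_bits.
  rewrite -[same_bit _ _]/(same_bit (Some (Some b)) (Some (Some b))) /same_bit eqxx /=.
  rewrite -{1}[Some (Some b)]/(ohead (field (b :: f) ++ v)) -(fread_word_tape u) fwrite_keep.
  rewrite -[Some (Some b)]/(omap Some (ohead (b :: w2))) -(fread_bits w1) fwrite_keep.
  by [].
have se : lstep B (on_both i both_end)
  (reg_active o (u ++ field (b :: f) ++ v) (size u).+1 rg i (w1 ++ b :: w2) (size w1).+1) = None.
  by rewrite lstep_on_both fread_word_tape fread_bits.
have := IH (rcons u (Some b)) (rcons w1 b) w2.
rewrite !size_rcons !(cat_rcons b) (cat_rcons (Some b)).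
case: eqP => _ h; last exact: loop_fails_step st se h.
by apply: (loop_step st se); rewrite -addSnnS.
Qed.

Lemma spec_cmp i o u (f : seq bool) v rg :
  if rg i == f then
    spec (cmp i) (at_rest o (u ++ field f ++ v) (size u).+1 rg)
      (at_rest o (u ++ field f ++ v) (size u + size f).+2 rg) (2 * size f + 20)
  else fails (cmp i) (at_rest o (u ++ field f ++ v) (size u).+1 rg).
Proof.
have := spec_cmp_loop i o u f v rg [::] (rg i); case: eqP => [e|_] /= h.
  apply: (spec_leq (n := 1 + ((size f + 3) + ((size f).+1 + 5)))); first by lia.
  apply: spec_Seq; first exact: spec_reg_start.
  apply: (spec_Seq h).
  rewrite -[X in at_rest _ _ _ X](upd_id rg i) -[in (size f).+1]e.
  exact: spec_reg_rewind.
apply: (fails_Seq2 (spec_reg_start o _ _ rg i)).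
exact: fails_Seq1 h.
Qed.

Definition skip_bit (y : option letter) :=
  if y is Some (Some b) then Some (y, MoveRight) else None.
Definition skip_mark (y : option letter) :=
  if y is Some None then Some (y, MoveRight) else None.
Definition skip : cmd r := loop (on_tape None skip_bit) (on_tape None skip_mark).

Lemma spec_skip o u (f : seq bool) v rg :
  spec skip (at_rest o (u ++ field f ++ v) (size u).+1 rg)
    (at_rest o (u ++ field f ++ v) (size u + size f).+2 rg) (size f + 3).
Proof.
elim: f u => [|b f IH] u.
  rewrite addn0; apply: loop_stop; rewrite lstep_on_tape /= fread_word_tape //=.
  by rewrite -[Some None]/(ohead ([:: None] ++ v)) -(fread_word_tape u) fwrite_keep.
apply: (loop_step (s1 := at_rest o (u ++ field (b :: f) ++ v) (size u).+2 rg)).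
- rewrite lstep_on_tape /= fread_word_tape /=.
  by rewrite -[Some (Some b)]/(ohead (field (b :: f) ++ v)) -(fread_word_tape u) fwrite_keep.
- by rewrite lstep_on_tape /= fread_word_tape.
have := IH (rcons u (Some b)); by rewrite !size_rcons !cat_rcons [(size u).+1 + _]addSnnS.
Qed.

Definition expect (a : letter) : cmd r :=
  Do (on_tape None (fun y => if y == Some a then Some (y, MoveRight) else None)).

Lemma spec_expect a o u a' v rg :
  if a' == a then
    spec (expect a) (at_rest o (u ++ a' :: v) (size u).+1 rg)
      (at_rest o (u ++ a' :: v) (size u).+2 rg) 1
  else fails (expect a) (at_rest o (u ++ a' :: v) (size u).+1 rg).
Proof.
case: eqP => [<-|ne]; [apply: spec_Do|apply: fails_Do];
  rewrite lstep_on_tape /= fread_word_tape /= -[Some _ == _]/(a' == _).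
  by rewrite eqxx -[Some a']/(ohead (a' :: v)) -(fread_word_tape u) /= fwrite_keep.
by case: eqP.
Qed.

Lemma fails_expect a o W rg : fails (expect a) (at_rest o W (size W).+1 rg).
Proof. by apply: fails_Do; rewrite lstep_on_tape /= fread_word_tape_end. Qed.

Definition put_letter (a : letter) : cmd r :=
  Do (on_tape None (fun=> Some (Some a, MoveRight))).

Lemma spec_put_letter a o W rg : spec (put_letter a) (at_rest o W (size W).+1 rg)
  (at_rest o (rcons W a) (size (rcons W a)).+1 rg) 1.
Proof. by apply: spec_Do; rewrite lstep_on_tape /= word_tape_append size_rcons. Qed.

Definition put_bit (y x : option letter) :=
  if x is Some _ then Some ((x, MoveRight), (x, MoveRight)) else None.
Definition put_mark (y x : option letter) :=
  if x is Some _ then None else Some ((Some (None : letter), MoveRight), (x, Stay)).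

Definition put i : cmd r :=
  Seq (Do (on_tape (Some i) (step_any MoveRight)))
    (Seq (loop (on_both i put_bit) (on_both i put_mark)) (rewind (Some i))).

Lemma spec_put_loop i o W rg w1 w2 :
  spec (loop (on_both i put_bit) (on_both i put_mark))
    (reg_active o W (size W).+1 rg i (w1 ++ w2) (size w1).+1)
    (reg_active o (W ++ field w2) (size (W ++ field w2)).+1 rg i (w1 ++ w2)
       (size (w1 ++ w2)).+1)
    (size w2 + 3).
Proof.
elim: w2 W w1 => [|b w2 IH] W w1.
  rewrite cats0; apply: loop_stop; rewrite lstep_on_both fread_bits_end //=.
  rewrite word_tape_append cats1 size_rcons -{1}(fread_bits_end w1) fwrite_stay.
  by [].
apply: (loop_step (s1 := reg_active o (rcons W (Some b)) (size W).+2 rg i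
   (w1 ++ b :: w2) (size w1).+2)).
- rewrite lstep_on_both fread_bits /= word_tape_append.
  by rewrite -[Some (Some b)]/(omap Some (ohead (b :: w2))) -(fread_bits w1) fwrite_keep.
- by rewrite lstep_on_both fread_bits.
have := IH (rcons W (Some b)) (rcons w1 b); rewrite !size_rcons !cat_rcons.
by [].
Qed.

Lemma spec_put i o W rg :
  spec (put i) (at_rest o W (size W).+1 rg)
    (at_rest o (W ++ field (rg i)) (size (W ++ field (rg i))).+1 rg) (2 * size (rg i) + 20).
Proof.
apply: (spec_leq (n := 1 + ((size (rg i) + 3) + ((size (rg i)).+1 + 5)))); first by lia.
apply: spec_Seq; first exact: spec_reg_start.
apply: spec_Seq; first exact: (spec_put_loop i o W rg [::]).
rewrite -[X in at_rest _ _ _ X](upd_id rg i); exact: spec_reg_rewind.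
Qed.

Definition emit_bit (y : option bool) (x : option letter) :=
  if x is Some (Some b) then Some ((Some b, MoveRight), (x, MoveRight)) else None.
Definition emit_end (y : option bool) (x : option letter) :=
  if x is Some _ then None else Some ((y, Stay), (x, Stay)).

Definition emit i : cmd r :=
  Seq (Do (on_tape (Some i) (step_any MoveRight)))
    (Seq (loop (on_oracle i emit_bit) (on_oracle i emit_end)) (rewind (Some i))).

Lemma spec_emit_loop i a W p rg w1 w2 :
  spec (loop (on_oracle i emit_bit) (on_oracle i emit_end))
    (reg_active (bit_tape a (size a)) W p rg i (w1 ++ w2) (size w1).+1)
    (reg_active (bit_tape (a ++ w2) (size (a ++ w2))) W p rg i (w1 ++ w2)
       (size (w1 ++ w2)).+1)
    (size w2 + 3).
Proof.
elim: w2 a w1 => [|b w2 IH] a w1.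
  rewrite !cats0; apply: loop_stop; rewrite lstep_on_oracle fread_bits_end //=.
  by rewrite fwrite_stay -{1}(fread_bits_end w1) fwrite_stay.
apply: (loop_step (s1 := reg_active (bit_tape (rcons a b) (size a).+1) W p rg i
   (w1 ++ b :: w2) (size w1).+2)).
- rewrite lstep_on_oracle fread_bits /= bit_tape_append.
  by rewrite -[Some (Some b)]/(omap Some (ohead (b :: w2))) -(fread_bits w1) fwrite_keep.
- by rewrite lstep_on_oracle fread_bits.
have := IH (rcons a b) (rcons w1 b); rewrite !size_rcons !cat_rcons.
by [].
Qed.

Lemma spec_emit i a W p rg :
  spec (emit i) (at_rest (bit_tape a (size a)) W p rg)
    (at_rest (bit_tape (a ++ rg i) (size (a ++ rg i))) W p rg) (2 * size (rg i) + 20).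
Proof.
apply: (spec_leq (n := 1 + ((size (rg i) + 3) + ((size (rg i)).+1 + 5)))); first by lia.
apply: spec_Seq; first exact: spec_reg_start.
apply: spec_Seq; first exact: (spec_emit_loop i a W p rg [::]).
rewrite -[X in at_rest _ _ _ X](upd_id rg i); exact: spec_reg_rewind.
Qed.

Definition recv_bit (y : option bool) (x : option letter) :=
  if y is Some b then Some ((y, MoveRight), (Some (Some b), MoveRight)) else None.
Definition recv_end (y : option bool) (x : option letter) :=
  if y is Some _ then None else Some ((y, Stay), (x, Stay)).

(** A query replaces the whole oracle tape by the answer, so the first blank marks the end of the
    answer. *)
Definition recv i : cmd r :=
  Seq (clear i) (Seq (Do (on_tape (Some i) (step_any MoveRight)))
    (Seq (loop (on_oracle i recv_bit) (on_oracle i recv_end)) (rewind (Some i)))).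

Lemma spec_recv_loop i a1 a2 W p rg w :
  spec (loop (on_oracle i recv_bit) (on_oracle i recv_end))
    (reg_active (bit_tape (a1 ++ a2) (size a1)) W p rg i w (size w).+1)
    (reg_active (bit_tape (a1 ++ a2) (size (a1 ++ a2))) W p rg i (w ++ a2)
       (size (w ++ a2)).+1)
    (size a2 + 3).
Proof.
elim: a2 a1 w => [|b a2 IH] a1 w.
  have e : fread (bit_tape a1 (size a1)) = None.
    by have := fread_bit_tape a1 [::]; rewrite cats0.
  rewrite !cats0; apply: loop_stop; rewrite lstep_on_oracle e //=.
  by rewrite fwrite_stay -e fwrite_stay.
apply: (loop_step (s1 := reg_active (bit_tape (a1 ++ b :: a2) (size a1).+1) W p rg i
   (rcons w b) (size w).+2)).
- rewrite lstep_on_oracle fread_bit_tape /= bits_append.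
  by rewrite -[Some b]/(ohead (b :: a2)) -(fread_bit_tape a1) fwrite_keep.
- by rewrite lstep_on_oracle fread_bit_tape.
have := IH (rcons a1 b) (rcons w b); rewrite !size_rcons !cat_rcons.
by [].
Qed.

Lemma spec_recv i a W p rg :
  spec (recv i) (at_rest (bit_tape a 0) W p rg)
    (at_rest (bit_tape a (size a)) W p (upd rg i a)) (2 * size (rg i) + 2 * size a + 20).
Proof.
apply: (spec_leq (n := (2 * size (rg i) + 8) + (1 + ((size a + 3) + ((size a).+1 + 5))))).
  by lia.
apply: spec_Seq; first exact: spec_reg_clear.
apply: spec_Seq; first exact: spec_reg_start.
rewrite upd_same; apply: spec_Seq; first exact: (spec_recv_loop i [::]).
by rewrite /= -[X in at_rest _ _ _ X](upd_upd rg i [::]); apply: spec_reg_rewind.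
Qed.

Definition query_prim (q : query) : prim r :=
  Prim ord0 (fun z y x => Some ((z, Stay), (y, Stay), (x, Stay))) (Some q).

Definition answer_to (q : query) (a : seq bool) : seq bool := fanswer B q (nth None (map Some a)).

Lemma lstep_query q o y (x : 'I_r.+1 -> ftape letter) :
  lstep B (query_prim q) (LState o y x) =
  Some (LState (bit_tape (fanswer B q o.1) 0) y x).
Proof.
rewrite -[lstep _ _ _]/(Some (LState
  (nth None (map Some (fanswer B q (fwrite (fread o, Stay) o).1)), 0)
  (fwrite (fread y, Stay) y) (upd x ord0 (fwrite (fread (x ord0), Stay) (x ord0))))).
by rewrite !fwrite_stay upd_id.
Qed.

Lemma spec_query q a p' W p rg : spec (Do (query_prim q)) (at_rest (bit_tape a p') W p rg)
  (at_rest (bit_tape (answer_to q a) 0) W p rg) 1.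
Proof. exact/spec_Do/lstep_query. Qed.

Definition erase_prim : prim r :=
  Prim ord0 (fun _ y x => Some ((None, Stay), (y, Stay), (x, Stay))) None.

(* A query is the only way to bring the oracle head back to cell 0. *)
Definition reset : cmd r := Seq (Do (query_prim QValid)) (Do erase_prim).

Lemma spec_reset o W p rg : spec reset (at_rest o W p rg) (at_rest (bit_tape [::] 0) W p rg) 2.
Proof.
rewrite -[2]/(1 + 1); apply: spec_Seq; first exact/spec_Do/lstep_query.
apply: spec_Do; rewrite /lstep /= fwrite_stay fwrite_stay upd_id; congr (Some (LState _ _ _)).
(* [QValid] answers with a single bit, so erasing cell 0 leaves a blank tape. *)
by congr pair; apply: functional_extensionality => -[|[|j]].
Qed.

Fixpoint seqs (cs : seq (cmd r)) : cmd r :=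
  if cs is c :: cs' then Seq c (seqs cs') else Do (nop r).

Lemma spec_nop s : spec (Do (nop r)) s s 1.
Proof. exact/spec_Do/lstep_nop. Qed.

Definition call q js k : cmd r :=
  Seq reset (Seq (seqs (map emit js)) (Seq (Do (query_prim q)) (recv k))).

Definition contents rg js : seq bool := flatten (map rg js).

Lemma spec_emits a W p rg js :
  spec (seqs (map emit js)) (at_rest (bit_tape a (size a)) W p rg)
    (at_rest (bit_tape (a ++ contents rg js) (size (a ++ contents rg js))) W p rg)
    (2 * size (contents rg js) + 20 * size js + 1).
Proof.
elim: js a => [|j js IH] a /=; first by rewrite cats0; exact: spec_nop.
rewrite /contents /= -/(contents rg js) catA.
apply: spec_leq (spec_Seq (spec_emit j a W p rg) (IH _)).
by rewrite size_cat; lia.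
Qed.

Lemma spec_call q js k o W p rg : exists o',
  spec (call q js k) (at_rest o W p rg)
    (at_rest o' W p (upd rg k (answer_to q (contents rg js))))
    (2 * size (contents rg js) + 20 * size js + 2 * size (rg k) +
     2 * size (answer_to q (contents rg js)) + 30).
Proof.
eexists; apply: spec_leq; last first.
  apply: spec_Seq; first exact: spec_reset.
  apply: spec_Seq; first exact: (spec_emits [::]).
  apply: spec_Seq; first exact: spec_query.
  exact: spec_recv.
by rewrite cat0s; lia.
Qed.

End Registers.

(** * The store *)

(* [(Some true, [:: A; B; C])] is the production A -> BC, [(Some false, [:: A; x])]
   says that A generates the element named x, and [(None, [:: A; B; x; y])] that A
   generates g h k^-1, where x and y name g and k, whenever B generates h. *)
Definition entry : Type := (letter * seq (seq bool))%type.

Definition entry_word (e : entry) : seq letter := e.1 :: flatten (map field e.2).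

Arguments entry_word : simpl never.

Definition arity (a : letter) : nat :=
  match a with Some true => 3 | Some false => 2 | None => 4 end.

Definition wf_entry (e : entry) : bool := size e.2 == arity e.1.

Section Records.

Variables (B : blackBox) (r : nat).
Variable header : seq (seq bool).
Hypothesis header3 : size header = 3.
Local Notation spec := (@spec B r).
Local Notation fails := (@fails B r).
Implicit Types (o : ftape bool) (p : nat) (rg : 'I_r.+1 -> seq bool) (i : 'I_r.+1)
  (u v : seq letter) (ws : seq (seq bool)) (es : seq entry).

(** The copied input already has this shape, with 1^b, 1^c and the code of the start symbol as
    header; derived facts are appended behind it in the same format. *)
Definition store_word es : seq letter :=
  flatten (map field header) ++ flatten (map entry_word es).

Lemma size_field w : size (field w) = (size w).+1.
Proof. by rewrite size_rcons size_map. Qed.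

Lemma spec_skips o u v rg ws :
  spec (seqs (nseq (size ws) (skip r)))
    (at_rest o (u ++ flatten (map field ws) ++ v) (size u).+1 rg)
    (at_rest o (u ++ flatten (map field ws) ++ v) (size (u ++ flatten (map field ws))).+1 rg)
    (3 * size (flatten (map field ws)) + 1).
Proof.
elim: ws u => [|w ws IH] u /=; first by rewrite cats0; exact: spec_nop.
have h1 := spec_skip B o u w (flatten (map field ws) ++ v) rg.
have := IH (u ++ field w); rewrite -!catA size_cat size_field addnS => h2.
by apply: spec_leq (spec_Seq h1 h2); rewrite size_cat size_field; lia.
Qed.

Definition skip_tagged (a : letter) : cmd r :=
  Seq (expect r a) (seqs (nseq (arity a) (skip r))).

Definition skip_entry : cmd r :=
  Alt (skip_tagged (Some true)) (Alt (skip_tagged (Some false)) (skip_tagged None)).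

Lemma spec_skip_tagged a o u v rg e : wf_entry e ->
  if e.1 == a then
    spec (skip_tagged a) (at_rest o (u ++ entry_word e ++ v) (size u).+1 rg)
      (at_rest o (u ++ entry_word e ++ v) (size (u ++ entry_word e)).+1 rg)
      (3 * size (entry_word e))
  else fails (skip_tagged a) (at_rest o (u ++ entry_word e ++ v) (size u).+1 rg).
Proof.
case: e => b ws /= /eqP wf.
have := spec_expect B a o u b (flatten (map field ws) ++ v) rg.
case: eqP => [<-|_] h; last exact: fails_Seq1 h.
have := spec_skips o (rcons u b) v rg ws; rewrite wf !cat_rcons size_rcons => h2.
by apply: spec_leq (spec_Seq h h2); rewrite /entry_word /=; lia.
Qed.

Lemma spec_skip_entry o u v rg e : wf_entry e ->
  spec skip_entry (at_rest o (u ++ entry_word e ++ v) (size u).+1 rg)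
    (at_rest o (u ++ entry_word e ++ v) (size (u ++ entry_word e)).+1 rg)
    (3 * size (entry_word e)).
Proof.
move=> wf; have h a := spec_skip_tagged a o u v rg wf.
move: (h (Some true)) (h (Some false)) (h None); rewrite -!/(is_true _) => {h}.
case: (e.1) => [[]|] /= h1 h2 h3.
- by apply: spec_AltL h1 _ => s' m /exec_Alt [/h2|/h3].
- by apply: spec_AltR h1 _; apply: spec_AltL.
- by apply: spec_AltR h1 _; apply: spec_AltR.
Qed.

Lemma fails_skip_entry o W rg : fails skip_entry (at_rest o W (size W).+1 rg).
Proof.
move=> s' m /exec_Alt [|/exec_Alt []]; apply: fails_Seq1; exact: fails_expect.
Qed.

(** The guess of an entry: behind the header the head passes any number of complete entries. *)
Definition seek : cmd r :=
  Seq (rewind None) (Seq (Do (on_tape None (step_any MoveRight)))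
    (Seq (seqs (nseq 3 (skip r))) (Star skip_entry))).

Definition boundary o es es1 rg : lstate r :=
  at_rest o (store_word es) (size (store_word es1)).+1 rg.

Lemma spec_seek_start o es p rg : p <= (size (store_word es)).+1 ->
  spec (Seq (rewind None) (Seq (Do (on_tape None (step_any MoveRight)))
    (seqs (nseq 3 (skip r))))) (at_rest o (store_word es) p rg)
    (boundary o es [::] rg) (4 * size (store_word es) + 20).
Proof.
move=> le; have h1 := spec_store_rewind B o rg le.
have h2 : spec (Do (on_tape None (step_any MoveRight))) (at_rest o (store_word es) 0 rg)
    (at_rest o (store_word es) 1 rg) 1.
  exact: spec_Do (lstep_any B (k := None) MoveRight _).
have := spec_skips o [::] (flatten (map entry_word es)) rg header; rewrite header3 => h3.
apply: (spec_leq (n := (p + 5) + (1 + (3 * size (flatten (map field header)) + 1)))).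
  by rewrite /store_word size_cat in le *; lia.
apply: (spec_Seq h1); apply: (spec_Seq h2).
have -> : boundary o es [::] rg =
  at_rest o (store_word es) (size (flatten (map field header))).+1 rg.
  by rewrite /boundary {2}/store_word /= cats0.
exact: h3.
Qed.

Lemma exec_seek_start s s' m : exec B seek s s' m -> exists s1 n1 n2,
  exec B (Seq (rewind None) (Seq (Do (on_tape None (step_any MoveRight)))
    (seqs (nseq 3 (skip r))))) s s1 n1 /\ exec B (Star skip_entry) s1 s' n2.
Proof.
case/exec_Seq => t1 [m1 [? [e1
  /exec_Seq [t2 [m2 [? [e2 /exec_Seq [t3 [m3 [m4 [e3 e4 _]]]] _]]]] _]]].
exists t3; exists (m1 + (m2 + m3)), m4; split=> //.
by apply: (ExecSeq e1); apply: (ExecSeq e2).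
Qed.

Lemma spec_step_entry o es1 e es2 rg : wf_entry e ->
  spec skip_entry (boundary o (es1 ++ e :: es2) es1 rg)
    (boundary o (es1 ++ e :: es2) (rcons es1 e) rg) (3 * size (entry_word e)).
Proof.
move=> we; have := spec_skip_entry o (store_word es1) (flatten (map entry_word es2)) rg we.
have e1 : store_word (es1 ++ e :: es2) =
    store_word es1 ++ entry_word e ++ flatten (map entry_word es2).
  by rewrite /store_word map_cat flatten_cat /= -!catA.
have e2 : store_word (rcons es1 e) = store_word es1 ++ entry_word e.
  by rewrite /store_word map_rcons flatten_rcons catA.
by rewrite /boundary e1 e2.
Qed.

(** The outcome is guessed, so two statements take the place of a [spec]: here the outcomes are
    confined to boundaries of entries, and [seek_reach] attains each boundary. *)
Lemma seek_sound o es p rg s' m : all wf_entry es -> p <= (size (store_word es)).+1 ->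
  exec B seek (at_rest o (store_word es) p rg) s' m ->
  exists es1 es2, es = es1 ++ es2 /\ s' = boundary o es es1 rg.
Proof.
move=> wf le /exec_seek_start [s1 [n1 [n2 [e1 e2]]]].
move: e2; rewrite ((spec_seek_start o rg le).2 _ _ e1).
apply: (exec_Star_inv (P := fun s => exists es1 es2, es = es1 ++ es2 /\ s = boundary o es es1 rg)).
  move=> t t' k [es1 [[|e es2] [ee ->]]] ex.
    by rewrite cats0 in ee; rewrite ee /boundary in ex; case: (fails_skip_entry ex).
  have we : wf_entry e by move/allP: wf; apply; rewrite ee mem_cat mem_head orbT.
  exists (rcons es1 e), es2; rewrite cat_rcons; split=> //.
  by move: ex; rewrite ee => /(spec_step_entry o es1 es2 rg we).2.
by exists [::], es.
Qed.

Lemma seek_reach o es1 es2 p rg : all wf_entry (es1 ++ es2) ->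
  p <= (size (store_word (es1 ++ es2))).+1 ->
  exists m, m <= 8 * size (store_word (es1 ++ es2)) + 25 /\
    exec B seek (at_rest o (store_word (es1 ++ es2)) p rg) (boundary o (es1 ++ es2) es1 rg) m.
Proof.
move=> wf le; have [[k [lk ek]] _] := spec_seek_start o rg le.
have iter es0 es : all wf_entry es -> exists j,
    j <= 3 * size (flatten (map entry_word es)) + 2 /\
    exec B (Star skip_entry) (boundary o (es0 ++ es ++ es2) es0 rg)
      (boundary o (es0 ++ es ++ es2) (es0 ++ es) rg) j.
  elim: es es0 => [|e es IH] es0.
    by move=> _; exists 2; split=> //; rewrite cats0; apply: ExecStar0.
  have sz : size (flatten (map entry_word (e :: es))) =
      size (entry_word e) + size (flatten (map entry_word es)) by rewrite -size_cat.
  move=> /andP[we wes]; have [[i [li ei]] _] := spec_step_entry o es0 (es ++ es2) rg we.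
  have [j [lj ej]] := IH (rcons es0 e) wes; rewrite !cat_rcons in ej.
  by exists (i + j); split; [rewrite sz; lia|exact: ExecStarS ei ej].
have [|j [lj ej]] := iter [::] es1; first by move: wf; rewrite all_cat => /andP[].
have [t1 [k1 [k2 [e1 /exec_Seq [t2 [k3 [k4 [e2 e3 ->]]]] ek']]]] := exec_Seq ek.
exists (k1 + (k3 + (k4 + j))); split.
  by move: lj lk; rewrite /store_word map_cat flatten_cat !size_cat; lia.
by apply: (ExecSeq e1); apply: (ExecSeq e2); apply: (ExecSeq e3).
Qed.

(** * Register programs *)

Inductive fieldop := Fetch of 'I_r.+1 | Compare of 'I_r.+1.

Definition fieldop_cmd (f : fieldop) : cmd r :=
  match f with Fetch i => load i | Compare i => cmp i end.

Fixpoint match_fields (fs : seq fieldop) ws rg : option ('I_r.+1 -> seq bool) :=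
  match fs, ws with
  | Fetch i :: fs', w :: ws' => match_fields fs' ws' (upd rg i w)
  | Compare i :: fs', w :: ws' => if rg i == w then match_fields fs' ws' rg else None
  | [::], [::] => Some rg
  | _, _ => None
  end.

Definition small F rg : Prop := forall i, size (rg i) <= F.

Lemma small_upd F rg i w : small F rg -> size w <= F -> small F (upd rg i w).
Proof. by move=> s l j; rewrite /upd; case: eqP. Qed.

Lemma spec_match_fields F o u v ws fs rg : size fs = size ws -> small F rg ->
  all (fun w => size w <= F) ws ->
  if match_fields fs ws rg is Some rg' then
    spec (seqs (map fieldop_cmd fs)) (at_rest o (u ++ flatten (map field ws) ++ v) (size u).+1 rg)
      (at_rest o (u ++ flatten (map field ws) ++ v) (size (u ++ flatten (map field ws))).+1 rg')
      (size fs * (4 * F + 20) + 1) /\ small F rg'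
  else fails (seqs (map fieldop_cmd fs))
      (at_rest o (u ++ flatten (map field ws) ++ v) (size u).+1 rg).
Proof.
elim: ws u fs rg => [|w ws IH] u [|[i|i] fs] rg //=.
- by move=> _ s _; rewrite cats0; split=> //; apply: spec_nop.
- move=> [es] s /andP[lw lws].
  have h := spec_load B i o u w (flatten (map field ws) ++ v) rg.
  have := IH (u ++ field w) fs (upd rg i w) es (small_upd i s lw) lws.
  rewrite -!catA size_cat size_field addnS.
  case: match_fields => [rg' [h' s']|h']; last exact: fails_Seq2 h h'.
  by split=> //; apply: spec_leq (spec_Seq h h'); have := s i; lia.
- move=> [es] s /andP[lw lws].
  have := spec_cmp B i o u w (flatten (map field ws) ++ v) rg; rewrite -!catA.
  case: eqP => [_|_] h; last exact: fails_Seq1 h.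
  have := IH (u ++ field w) fs rg es s lws.
  rewrite -!catA size_cat size_field addnS.
  case: match_fields => [rg' [h' s']|h']; last exact: fails_Seq2 h h'.
  by split=> //; apply: spec_leq (spec_Seq h h'); lia.
Qed.

Lemma spec_puts F o W rg js : small F rg ->
  spec (seqs (map (@put r) js)) (at_rest o W (size W).+1 rg)
    (at_rest o (W ++ flatten (map field (map rg js)))
       (size (W ++ flatten (map field (map rg js)))).+1 rg)
    (size js * (2 * F + 20) + 1).
Proof.
move=> s; elim: js W => [|j js IH] W /=; first by rewrite cats0; apply: spec_nop.
rewrite catA; apply: spec_leq (spec_Seq (spec_put B j o W rg) (IH _)).
by have := s j; lia.
Qed.

Inductive instr :=
| Find of letter & seq fieldop
| Call of query & seq 'I_r.+1 & 'I_r.+1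
| Append of letter & seq 'I_r.+1.

Definition instr_cmd (c : instr) : cmd r :=
  match c with
  | Find a fs => Seq seek (Seq (expect r a) (seqs (map fieldop_cmd fs)))
  | Call q js k => call q js k
  | Append a js => Seq (rewind None) (Seq (goto_end None)
      (Seq (put_letter r a) (seqs (map (@put r) js))))
  end.

Definition wf_instr (c : instr) : bool :=
  match c with
  | Find a fs => size fs == arity a
  | Call _ js _ => size js <= 4
  | Append a js => size js == arity a
  end.

Definition rstate : Type := (seq entry * ('I_r.+1 -> seq bool))%type.

Definition istep (c : instr) (x y : rstate) : Prop :=
  match c with
  | Find a fs => exists2 ws, (a, ws) \in x.1 &
      exists2 rg, match_fields fs ws x.2 = Some rg & y = (x.1, rg)
  | Call q js k => y = (x.1, upd x.2 k (answer_to B q (contents x.2 js)))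
  | Append a js => y = (rcons x.1 (a, map x.2 js), x.2)
  end.

(** The oracle tape and the position in the store are left open, because every instruction begins
    with a [rewind] of the store or a [reset] of the oracle tape. *)
Definition state_of (x : rstate) (s : lstate r) : Prop := exists o p,
  p <= (size (store_word x.1)).+1 /\ s = at_rest o (store_word x.1) p x.2.

Definition bounded F (x : rstate) : Prop :=
  [/\ all wf_entry x.1, all (fun e : entry => all (fun w => size w <= F) e.2) x.1
    & small F x.2].

(** A rounded common bound: [M] pays for the passes over the store, [F] for the at most four fields
    or registers handled. *)
Definition instr_cost F M := 9 * M + 40 * F + 300.

Section Cost.
Variable F : nat.
Hypothesis bF : bb_b B + 1 <= F.

(** [QInv] and [QProd] answer with b bits, the other queries with one; hence the bound b + 1 on
    [F]. *)
Lemma size_answer q a : size (answer_to B q a) <= F.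
Proof.
rewrite /answer_to; case: q => /=; rewrite ?size_tuple; lia.
Qed.

Lemma match_fields_small fs ws rg rg' : small F rg -> all (fun w => size w <= F) ws ->
  match_fields fs ws rg = Some rg' -> small F rg'.
Proof.
elim: ws fs rg => [|w ws IH] [|[i|i] fs] rg s //=; first by move=> _ [<-].
  by case/andP=> lw lws; apply: IH => //; apply: small_upd.
by case/andP=> lw lws; case: eqP => // _; apply: IH.
Qed.

Lemma match_fields_size fs ws rg rg' : match_fields fs ws rg = Some rg' -> size fs = size ws.
Proof.
elim: ws fs rg => [|w ws IH] [|[i|i] fs] rg //=; first by move/IH->.
by case: eqP => // _ /IH ->.
Qed.

Lemma size_contents rg js : small F rg -> size (contents rg js) <= size js * F.
Proof.
move=> s; elim: js => [|j js IH] //=; rewrite /contents /= size_cat mulSn.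
exact: leq_add.
Qed.

Lemma size_fields rg js : small F rg ->
  size (flatten (map field (map rg js))) <= size js * F.+1.
Proof.
move=> s; elim: js => [|j js IH] //=; rewrite size_cat size_field mulSn.
by apply: leq_add => //; rewrite ltnS.
Qed.

Lemma store_word_rcons es e : store_word (rcons es e) = store_word es ++ entry_word e.
Proof. by rewrite /store_word map_rcons flatten_rcons catA. Qed.

Lemma istep_bounded c x y : wf_instr c -> bounded F x -> istep c x y -> bounded F y /\
  size (store_word y.1) <= size (store_word x.1) + (4 * F + 5).
Proof.
case: x => es rg wc [/= wf lf sm]; case: c wc => [a fs|q js k|a js] /= wc.
- case=> ws wse [rg' em ->]; split; last exact: leq_addr.
  split=> //; apply: match_fields_small em => //.
  by move/allP: lf => /(_ _ wse).
- move=> ->; split; last exact: leq_addr.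
  by split=> //; apply: small_upd (size_answer _ _).
move=> ->; split.
  split=> //=; rewrite all_rcons.
    by rewrite wf andbT /wf_entry size_map.
  by rewrite lf andbT; apply/allP => _ /mapP [j _ ->].
rewrite store_word_rcons size_cat leq_add2l /entry_word /=.
have := size_fields js sm; have : size js <= 4 by rewrite (eqP wc); case: (a) => [[]|].
nia.
Qed.

Lemma instr_sound c x s s' m : wf_instr c -> bounded F x -> state_of x s ->
  exec B (instr_cmd c) s s' m -> exists2 y, istep c x y & state_of y s'.
Proof.
case: x => es rg wc [/= wf lf sm] [o [p [/= lp ->]]]; case: c wc => [a fs|q js k|a js] /= wc.
- case/exec_Seq => t [k1 [k2 [/(seek_sound wf lp) [es1 [es2 [ee ->]]] e2 _]]].
  case: es2 => [|[a' ws] es2] in ee *.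
    rewrite cats0 in ee; case/exec_Seq: e2 => t2 [k3 [k4 [ex _ _]]].
    by rewrite ee /boundary in ex; case: (fails_expect ex).
  have i : (a', ws) \in es by rewrite ee mem_cat mem_head orbT.
  have we : size ws = arity a' by apply/eqP; move/allP: wf => /(_ _ i).
  have lws : all (fun w => size w <= F) ws by move/allP: lf => /(_ _ i).
  have esw : store_word es = store_word es1 ++ a' :: flatten (map field ws) ++
      flatten (map entry_word es2).
    by rewrite ee /store_word map_cat flatten_cat /= -!catA.
  move: e2; rewrite /boundary esw => e2.
  have := spec_expect B a o (store_word es1) a' (flatten (map field ws) ++
      flatten (map entry_word es2)) rg.
  case: eqP => [ea|_] h; last by case: (fails_Seq1 h e2).
  case/exec_Seq: e2 => t2 [k3 [k4 [/h.2 -> ex _]]].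
  have := spec_match_fields o (rcons (store_word es1) a') (flatten (map entry_word es2))
    (etrans (eqP wc) (esym (etrans we (congr1 arity ea)))) sm lws.
  rewrite size_rcons cat_rcons; case em: match_fields => [rg'|] h2; last by case: (h2 _ _ ex).
  have [[_ u] _] := h2; rewrite (u _ _ ex); exists (es, rg').
    by exists ws; [rewrite -ea|exists rg'].
  exists o, (size (rcons (store_word es1) a' ++ flatten (map field ws))).+1; split.
    by rewrite /= esw -cat_rcons catA ltnS [X in _ <= X]size_cat leq_addr.
  by rewrite /= esw.
- have [o' h] := spec_call B q js k o (store_word es) p rg.
  by move/h.2 ->; eexists; [reflexivity|exists o', p].
have h : spec (instr_cmd (Append a js)) (at_rest o (store_word es) p rg)
    (at_rest o (store_word (rcons es (a, map rg js)))
       (size (store_word (rcons es (a, map rg js)))).+1 rg)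
    (p + 5 + (size (store_word es) + 4 + (1 + (size js * (2 * F + 20) + 1)))).
  apply: spec_Seq; first exact: spec_store_rewind.
  apply: spec_Seq; first exact: spec_store_end.
  apply: spec_Seq; first exact: spec_put_letter.
  by rewrite store_word_rcons -[entry_word _]/(a :: _) -cat_rcons; apply: spec_puts.
move/h.2 ->; eexists; [reflexivity|].
by exists o; eexists; split; [|reflexivity].
Qed.

Lemma instr_reach c x y s : wf_instr c -> bounded F x -> state_of x s -> istep c x y ->
  exists s' m, [/\ m <= instr_cost F (size (store_word x.1)), exec B (instr_cmd c) s s' m
    & state_of y s'].
Proof.
case: x => es rg wc [/= wf lf sm] [o [p [/= lp ->]]]; case: c wc => [a fs|q js k|a js] /= wc.
- case=> ws i [rg' em ->].
  have [es1 [es2 ee]] : exists es1 es2, es = es1 ++ (a, ws) :: es2.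
    by case/splitPr: i => es1 es2; exists es1, es2.
  rewrite ee in wf lp; have [k [lk ek]] := seek_reach o rg wf lp.
  rewrite -ee in wf lp lk ek.
  have lws : all (fun w => size w <= F) ws by move/allP: lf => /(_ _ i).
  have esw : store_word es = store_word es1 ++ a :: flatten (map field ws) ++
      flatten (map entry_word es2).
    by rewrite ee /store_word map_cat flatten_cat /= -!catA.
  have := spec_expect B a o (store_word es1) a (flatten (map field ws) ++
      flatten (map entry_word es2)) rg.
  rewrite eqxx => -[[k1 [l1 e1]] _].
  have := spec_match_fields o (rcons (store_word es1) a) (flatten (map entry_word es2))
    (match_fields_size em) sm lws.
  rewrite size_rcons cat_rcons em => -[[[k2 [l2 e2]] _] _].
  eexists; exists (k + (k1 + k2)); split.
  + have : size fs <= 4 by rewrite (eqP wc); case: (a) => [[]|].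
    by rewrite /instr_cost; nia.
  + by apply: (ExecSeq ek); rewrite /boundary esw; apply: (ExecSeq e1 e2).
  exists o, (size (rcons (store_word es1) a ++ flatten (map field ws))).+1; split.
    by rewrite /= esw -cat_rcons catA ltnS [X in _ <= X]size_cat leq_addr.
  by rewrite /= esw.
- move=> ->; have [o' [[m [lm em]] _]] := spec_call B q js k o (store_word es) p rg.
  eexists; exists m; split; [|exact: em|by exists o', p].
  have := size_contents js sm; have := sm k; have := size_answer q (contents rg js).
  by rewrite /instr_cost; nia.
move=> ->.
have [[m [lm em]] _] : spec (instr_cmd (Append a js)) (at_rest o (store_word es) p rg)
    (at_rest o (store_word (rcons es (a, map rg js)))
       (size (store_word (rcons es (a, map rg js)))).+1 rg)
    (p + 5 + (size (store_word es) + 4 + (1 + (size js * (2 * F + 20) + 1)))).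
  apply: spec_Seq; first exact: spec_store_rewind.
  apply: spec_Seq; first exact: spec_store_end.
  apply: spec_Seq; first exact: spec_put_letter.
  by rewrite store_word_rcons -[entry_word _]/(a :: _) -cat_rcons; apply: spec_puts.
eexists; exists m; split; [|exact: em|].
  have : size js <= 4 by rewrite (eqP wc); case: (a) => [[]|].
  by rewrite /instr_cost; nia.
by exists o; eexists; split; [|reflexivity].
Qed.

End Cost.

Fixpoint isem (l : seq instr) (x y : rstate) : Prop :=
  if l is c :: l' then exists2 z, istep c x z & isem l' z y else y = x.

Definition prog_cmd (l : seq instr) : cmd r := seqs (map instr_cmd l).

Section ProgCost.
Variable F : nat.
Hypothesis bF : bb_b B + 1 <= F.

Lemma isem_bounded l x y : all wf_instr l -> bounded F x -> isem l x y -> bounded F y /\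
  size (store_word y.1) <= size (store_word x.1) + size l * (4 * F + 5).
Proof.
elim: l x => [|c l IH] x /=; first by move=> _ bx ->; rewrite mul0n addn0.
case/andP => wc wl bx [z st /(IH _ wl)].
have [bz lz] := istep_bounded bF wc bx st.
by case/(_ bz) => bw lw; split=> //; lia.
Qed.

Lemma prog_sound l x s s' m : all wf_instr l -> bounded F x -> state_of x s ->
  exec B (prog_cmd l) s s' m -> exists2 y, isem l x y & state_of y s'.
Proof.
elim: l x s m => [|c l IH] x s m.
  by move=> _ _ xs /exec_Do; rewrite lstep_nop => -[<-]; exists x.
move=> /andP[wc wl] bx xs /exec_Seq [s1 [k1 [k2 [e1 e2 _]]]].
have [z st zs] := instr_sound wc bx xs e1.
have [y sy ys] := IH _ _ _ wl (istep_bounded bF wc bx st).1 zs e2.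
by exists y => //; exists z.
Qed.

Lemma prog_reach l x y s M : all wf_instr l -> bounded F x -> state_of x s -> isem l x y ->
  size (store_word x.1) + size l * (4 * F + 5) <= M ->
  exists s' m, [/\ m <= size l * instr_cost F M + 1, exec B (prog_cmd l) s s' m
    & state_of y s'].
Proof.
elim: l x s => [|c l IH] x s /=.
  by move=> _ _ xs -> _; exists s, 1; split=> //; apply: ExecDo; apply: lstep_nop.
move=> /andP[wc wl] bx xs [z st sem] le.
have [s1 [k1 [l1 e1 zs]]] := instr_reach bF wc bx xs st.
have [bz lz] := istep_bounded bF wc bx st.
have [|s' [k2 [l2 e2 ys]]] := IH z s1 wl bz zs sem; first by lia.
exists s', (k1 + k2); split=> //; last exact: ExecSeq e1 e2.
have : instr_cost F (size (store_word x.1)) <= instr_cost F M by rewrite /instr_cost; lia.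
by lia.
Qed.

End ProgCost.
End Records.

(** * The six rules *)

Arguments answer_to : simpl never.

Lemma fbits_tuple m n (x : n.-tuple bool) u v : size u = m ->
  fbits (nth None (map Some (u ++ x ++ v))) m n = x.
Proof.
move=> <-; apply: eq_from_tnth => j; rewrite tnth_mktuple (tnth_nth false).
rewrite (nth_map false); last by rewrite !size_cat size_tuple ltn_add2l ltn_addr.
by rewrite nth_cat ltnNge leq_addr /= addKn nth_cat size_tuple ltn_ord.
Qed.

Section Answers.
Variable B : blackBox.
Local Notation b := (bb_b B).
Implicit Types x y : b.-tuple bool.

Lemma answer_inv x : answer_to B QInv (x ++ [::]) = bb_inv x.
Proof. by rewrite /answer_to /= (@fbits_tuple 0 b x [::]). Qed.

Lemma answer_prod x y : answer_to B QProd (x ++ y ++ [::]) = bb_prod x y.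
Proof.
rewrite /answer_to /= (@fbits_tuple 0 b x [::]) //.
by rewrite (@fbits_tuple b b y x) ?size_tuple.
Qed.

(** The oracle reads exactly c bits behind the name and takes blanks as 0, so a guess [a] of any
    length amounts to some certificate. *)
Lemma answer_id x a : exists z, answer_to B QId (x ++ a) = [:: bb_id x z].
Proof. by rewrite /answer_to /= (@fbits_tuple 0 b x [::]) //; eexists. Qed.

Lemma answer_id_tuple x (y : (bb_c B).-tuple bool) :
  answer_to B QId (x ++ y) = [:: bb_id x y].
Proof.
rewrite /answer_to /= (@fbits_tuple 0 b x [::]) //.
by rewrite -[in map _ _](cats0 y) (@fbits_tuple b _ y x) ?size_tuple.
Qed.
End Answers.

Definition R0 : 'I_8 := @Ordinal 8 0 isT.
Definition R1 : 'I_8 := @Ordinal 8 1 isT.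
Definition R2 : 'I_8 := @Ordinal 8 2 isT.
Definition R3 : 'I_8 := @Ordinal 8 3 isT.
Definition R4 : 'I_8 := @Ordinal 8 4 isT.
Definition R5 : 'I_8 := @Ordinal 8 5 isT.
Definition R6 : 'I_8 := @Ordinal 8 6 isT.
Definition R7 : 'I_8 := @Ordinal 8 7 isT.

(** [Compare] joins two entries at a common nonterminal, and [R4] times its inverse gives in [R6] a
    name of 1. None of the six rules writes to [R0], which keeps the code of the start symbol. *)
Definition rule_left : seq (instr 7) :=
  [:: Find (Some true) [:: Fetch R1; Fetch R2; Fetch R3];
      Find (Some false) [:: Compare R3; Fetch R4];
      Call QInv [:: R4] R5; Call QProd [:: R4; R5] R6; Append None [:: R1; R2; R6; R5]].
Definition rule_right : seq (instr 7) :=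
  [:: Find (Some true) [:: Fetch R1; Fetch R2; Fetch R3];
      Find (Some false) [:: Compare R2; Fetch R4];
      Call QInv [:: R4] R5; Call QProd [:: R4; R5] R6; Append None [:: R1; R3; R4; R6]].
Definition rule_comp : seq (instr 7) :=
  [:: Find None [:: Fetch R1; Fetch R2; Fetch R3; Fetch R4];
      Find None [:: Compare R2; Fetch R5; Fetch R6; Fetch R7];
      Call QProd [:: R3; R6] R3; Call QProd [:: R4; R7] R4; Append None [:: R1; R5; R3; R4]].
Definition rule_inv : seq (instr 7) :=
  [:: Find None [:: Fetch R1; Compare R1; Fetch R3; Fetch R4];
      Call QInv [:: R3] R3; Call QInv [:: R4] R4; Append None [:: R1; R1; R3; R4]].
Definition rule_id : seq (instr 7) :=
  [:: Find (Some false) [:: Fetch R1; Fetch R4];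
      Call QInv [:: R4] R5; Call QProd [:: R4; R5] R6; Append None [:: R1; R1; R6; R6]].
(** [R4] is inverted first, since [act] multiplies on the right by the inverse of the second
    component. *)
Definition rule_act : seq (instr 7) :=
  [:: Find None [:: Fetch R1; Fetch R2; Fetch R3; Fetch R4];
      Find (Some false) [:: Compare R2; Fetch R5];
      Call QInv [:: R4] R4; Call QProd [:: R3; R5] R3; Call QProd [:: R3; R4] R3;
      Append (Some false) [:: R1; R3]].

Definition rules : seq (seq (instr 7)) :=
  [:: rule_left; rule_right; rule_comp; rule_inv; rule_id; rule_act].

Section Rules.

Variables (B : blackBox) (Gr : cfg (bb_group B)) (code : nonterm Gr -> seq bool).
Hypothesis codeI : injective code.
Local Notation name := ((bb_b B).-tuple bool).
Implicit Types (es : seq entry) (x y : name) (g h : bb_group B).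

Inductive entry_fact : entry -> fact Gr -> Prop :=
| EntryVal A x g : bb_f x = Some g ->
    entry_fact (Some false, [:: code A; tval x]) (valf A g)
| EntryCtx A A' x y g h : bb_f x = Some g -> bb_f y = Some h ->
    entry_fact (None, [:: code A; code A'; tval x; tval y]) (ctxf A A' (g, h)).

Definition sound_entry (e : entry) : Prop :=
  (exists A A1 A2, (A, inl (A1, A2)) \in prods Gr /\
     e = (Some true, [:: code A; code A1; code A2])) \/
  (exists2 f, entry_fact e f & fact_true f).

Definition sound_store es : Prop := forall e, e \in es -> sound_entry e.

Lemma sound_prodE ws : sound_entry (Some true, ws) -> exists A A1 A2,
  (A, inl (A1, A2)) \in prods Gr /\ ws = [:: code A; code A1; code A2].
Proof.
case=> [[A [A1 [A2 [pA [->]]]]]|[f e]]; first by exists A, A1, A2.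
by inversion e.
Qed.

Lemma sound_valE ws : sound_entry (Some false, ws) -> exists A x g,
  [/\ bb_f x = Some g, fact_true (valf A g) & ws = [:: code A; tval x]].
Proof.
case=> [[A [A1 [A2 [pA []]]]]|[f e tf]] //.
inversion e as [A x g fx e1 e2|]; subst f; by exists A, x, g.
Qed.

Lemma sound_ctxE ws : sound_entry (None, ws) -> exists A A' x y g h,
  [/\ bb_f x = Some g, bb_f y = Some h, fact_true (ctxf A A' (g, h))
    & ws = [:: code A; code A'; tval x; tval y]].
Proof.
case=> [[A [A1 [A2 [pA []]]]]|[f e tf]] //.
inversion e as [|A A' x y g h fx fy e1 e2]; subst f; by exists A, A', x, y, g, h.
Qed.

Lemma sound_rcons es e f : sound_store es -> entry_fact e f -> fact_true f ->
  sound_store (rcons es e).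
Proof.
move=> s ef tf e'; rewrite mem_rcons inE => /predU1P [->|/s //].
by right; exists f.
Qed.

Lemma infer_true_in (F : seq (fact Gr)) f : (forall f, f \in F -> fact_true f) ->
  infer F f -> fact_true f.
Proof. exact: infer_true. Qed.

(** As [code] is injective, equal codes mean equal nonterminals; the appended entry then names a
    fact inferred from true ones. *)
Lemma rule_left_sound (u v : rstate 7) : sound_store u.1 -> isem B rule_left u v ->
  sound_store v.1 /\ v.2 R0 = u.2 R0.
Proof.
case: u => es rg so /= [_ [ws i1 [rg1 m1 ->]]]
  [_ [ws2 i2 [rg2 m2 ->]]] [_ ->] [_ ->] [_ -> ->] /=.
have [A [A1 [A2 [pA e1]]]] := sound_prodE (so _ i1).
have [A3 [x [g [fx tx e2]]]] := sound_valE (so _ i2).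
subst ws ws2; case: m1 => e; subst rg1; move: m2; rewrite /= {1}/upd /=.
case: eqP => // /codeI e [e']; subst A3 rg2.
split; last by [].
rewrite /contents /upd /= answer_inv answer_prod.
apply: (sound_rcons so).
  by apply: EntryCtx; [apply: bb_prodP fx (bb_invP fx)|apply: bb_invP fx].
rewrite mulgV; apply: (infer_true_in (F := [:: valf A2 g])).
  by move=> f; rewrite inE => /eqP ->.
by apply: InferLeft pA _; rewrite mem_head.
Qed.

Lemma rule_right_sound (u v : rstate 7) : sound_store u.1 -> isem B rule_right u v ->
  sound_store v.1 /\ v.2 R0 = u.2 R0.
Proof.
case: u => es rg so /= [_ [ws i1 [rg1 m1 ->]]]
  [_ [ws2 i2 [rg2 m2 ->]]] [_ ->] [_ ->] [_ -> ->] /=.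
have [A [A1 [A2 [pA e1]]]] := sound_prodE (so _ i1).
have [A3 [x [g [fx tx e2]]]] := sound_valE (so _ i2).
subst ws ws2; case: m1 => e; subst rg1; move: m2; rewrite /= {1}/upd /=.
case: eqP => // /codeI e [e']; subst A3 rg2.
split; last by [].
rewrite /contents /upd /= answer_inv answer_prod.
apply: (sound_rcons so).
  by apply: EntryCtx; [exact: fx|apply: bb_prodP fx (bb_invP fx)].
rewrite mulgV; apply: (infer_true_in (F := [:: valf A1 g])).
  by move=> f; rewrite inE => /eqP ->.
by apply: InferRight pA _; rewrite mem_head.
Qed.

Lemma rule_comp_sound (u v : rstate 7) : sound_store u.1 -> isem B rule_comp u v ->
  sound_store v.1 /\ v.2 R0 = u.2 R0.
Proof.
case: u => es rg so /= [_ [ws i1 [rg1 m1 ->]]]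
  [_ [ws2 i2 [rg2 m2 ->]]] [_ ->] [_ ->] [_ -> ->] /=.
have [A1 [A2 [x [y [g [h [fx fy t1 e1]]]]]]] := sound_ctxE (so _ i1).
have [A3 [A4 [x' [y' [g' [h' [fx' fy' t2 e2]]]]]]] := sound_ctxE (so _ i2).
subst ws ws2; case: m1 => e; subst rg1; move: m2; rewrite /= {1}/upd /=.
case: eqP => // /codeI e [e']; subst A3 rg2.
split; last by [].
rewrite /contents /upd /= !answer_prod.
apply: (sound_rcons so).
  by apply: EntryCtx; [apply: bb_prodP fx fx'|apply: bb_prodP fy fy'].
apply: (infer_true_in (F := [:: ctxf A1 A2 (g, h); ctxf A2 A4 (g', h')])).
  by move=> f; rewrite !inE => /orP[]/eqP ->.
apply: (InferComp (A := A1) (B := A2) (C := A4) (p := (g, h)) (q := (g', h'))).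
  exact: mem_head.
by rewrite inE mem_head orbT.
Qed.

Lemma rule_inv_sound (u v : rstate 7) : sound_store u.1 -> isem B rule_inv u v ->
  sound_store v.1 /\ v.2 R0 = u.2 R0.
Proof.
case: u => es rg so /= [_ [ws i1 [rg1 m1 ->]]] [_ ->] [_ ->] [_ -> ->] /=.
have [A1 [A2 [x [y [g [h [fx fy t1 e1]]]]]]] := sound_ctxE (so _ i1).
subst ws; move: m1; rewrite /= {1}/upd /=.
case: eqP => // /codeI e [e']; subst A2 rg1.
split; last by [].
rewrite /contents /upd /= !answer_inv.
apply: (sound_rcons so).
  by apply: EntryCtx; [apply: bb_invP fx|apply: bb_invP fy].
apply: (infer_true_in (F := [:: ctxf A1 A1 (g, h)])).
  by move=> f; rewrite !inE => /eqP ->.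
by apply: (InferInv (A := A1) (p := (g, h))); apply: mem_head.
Qed.

Lemma rule_id_sound (u v : rstate 7) : sound_store u.1 -> isem B rule_id u v ->
  sound_store v.1 /\ v.2 R0 = u.2 R0.
Proof.
case: u => es rg so /= [_ [ws i1 [rg1 m1 ->]]] [_ ->] [_ ->] [_ -> ->] /=.
have [A [x [g [fx tx e1]]]] := sound_valE (so _ i1).
subst ws; case: m1 => e; subst rg1.
split; last by [].
rewrite /contents /upd /= !answer_inv answer_prod.
apply: (sound_rcons so).
  by apply: EntryCtx; apply: bb_prodP fx (bb_invP fx).
rewrite mulgV; apply: (infer_true_in (F := [:: valf A g])).
  by move=> f; rewrite !inE => /eqP ->.
by apply: InferId (mem_head _ _).
Qed.

Lemma rule_act_sound (u v : rstate 7) : sound_store u.1 -> isem B rule_act u v ->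
  sound_store v.1 /\ v.2 R0 = u.2 R0.
Proof.
case: u => es rg so /= [_ [ws i1 [rg1 m1 ->]]]
  [_ [ws2 i2 [rg2 m2 ->]]] [_ ->] [_ ->] [_ ->] [_ -> ->] /=.
have [A1 [A2 [x [y [g [h [fx fy t1 e1]]]]]]] := sound_ctxE (so _ i1).
have [A3 [z [k [fz tz e2]]]] := sound_valE (so _ i2).
subst ws ws2; case: m1 => e; subst rg1; move: m2; rewrite /= {1}/upd /=.
case: eqP => // /codeI e [e']; subst A3 rg2.
split; last by [].
rewrite /contents /upd /= answer_inv !answer_prod.
apply: (sound_rcons so).
  by apply: EntryVal; apply: bb_prodP (bb_invP fy); apply: bb_prodP fx fz.
apply: (infer_true_in (F := [:: ctxf A1 A2 (g, h); valf A2 k])).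
  by move=> f; rewrite !inE => /orP[]/eqP ->.
apply: (InferAct (A := A1) (B := A2) (p := (g, h)) (x := k)); first exact: mem_head.
by rewrite inE mem_head orbT.
Qed.

Lemma rules_sound l (u v : rstate 7) : List.In l rules -> sound_store u.1 -> isem B l u v ->
  sound_store v.1 /\ v.2 R0 = u.2 R0.
Proof.
move=> + so; case=> [<-|[<-|[<-|[<-|[<-|[<-|[]]]]]]].
- exact: rule_left_sound.
- exact: rule_right_sound.
- exact: rule_comp_sound.
- exact: rule_inv_sound.
- exact: rule_id_sound.
- exact: rule_act_sound.
Qed.

Definition stores es (F : seq (fact Gr)) : Prop :=
  (forall A A1 A2, (A, inl (A1, A2)) \in prods Gr ->
     (Some true, [:: code A; code A1; code A2]) \in es) /\
  (forall f, f \in F -> exists2 e, e \in es & entry_fact e f).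

Lemma stores_val es F A g : stores es F -> valf A g \in F ->
  exists2 x : name, bb_f x = Some g & (Some false, [:: code A; tval x]) \in es.
Proof.
case=> _ h /h [e i ef]; inversion ef as [A' x g' fx e1 e2|].
by subst; exists x.
Qed.

Lemma stores_ctx es F A A' g h : stores es F -> ctxf A A' (g, h) \in F ->
  exists x y : name, [/\ bb_f x = Some g, bb_f y = Some h
    & (None, [:: code A; code A'; tval x; tval y]) \in es].
Proof.
case=> _ H /H [e i ef]; inversion ef as [|A1 A2 x y g' h' fx fy e1 e2].
by subst; exists x, y.
Qed.

Lemma stores_rcons es F e f : stores es F -> entry_fact e f -> stores (rcons es e) (f :: F).
Proof.
case=> h1 h2 ef; split=> [A A1 A2 /h1 i|f']; first by rewrite mem_rcons inE i orbT.
rewrite inE => /predU1P [->|/h2 [e' i ef']]; [exists e|exists e'] => //.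
  by rewrite mem_rcons mem_head.
by rewrite mem_rcons inE i orbT.
Qed.

Lemma isem_find a fs l es rg ws rg' (u : rstate 7) :
  (a, ws) \in es -> match_fields fs ws rg = Some rg' ->
  isem (r := 7) B l (es, rg') u -> isem B (Find a fs :: l) (es, rg) u.
Proof. by move=> i m s; exists (es, rg') => //; exists ws => //; exists rg'. Qed.

Lemma isem_call q js j l es rg (u : rstate 7) :
  isem (r := 7) B l (es, upd rg j (answer_to B q (contents rg js))) u ->
  isem B (Call q js j :: l) (es, rg) u.
Proof. by move=> s; eexists; first reflexivity. Qed.

Lemma isem_append a js es rg : isem (r := 7) B [:: Append a js] (es, rg)
  (rcons es (a, map rg js), rg).
Proof. by eexists; first reflexivity. Qed.

Lemma rules_complete es F f rg : stores es F -> infer F f -> exists l e rg',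
  [/\ List.In l rules, isem B l (es, rg) (rcons es e, rg'), entry_fact e f & rg' R0 = rg R0].
Proof.
move=> st; have [stp _] := st; case=> {f}.
- move=> A A1 A2 g pA /(stores_val st) [x fx i2].
  exists rule_left; eexists; eexists; split; first by left.
  + apply: (isem_find (stp _ _ _ pA)); first reflexivity.
    apply: (isem_find i2); first by rewrite /= {1}/upd /= eqxx.
    by do 2!apply: isem_call; apply: isem_append.
  (* The string in [R6] is known as a name of g g^-1, so the 1 of the fact is put in that form. *)
  + rewrite /contents /upd /= answer_inv answer_prod -(mulgV g).
    by apply: EntryCtx; [apply: bb_prodP fx (bb_invP fx)|apply: bb_invP fx].
  + by [].
- move=> A A1 A2 g pA /(stores_val st) [x fx i2].
  exists rule_right; eexists; eexists; split; first by right; left.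
  + apply: (isem_find (stp _ _ _ pA)); first reflexivity.
    apply: (isem_find i2); first by rewrite /= {1}/upd /= eqxx.
    by do 2!apply: isem_call; apply: isem_append.
  + rewrite /contents /upd /= answer_inv answer_prod -(mulgV g).
    by apply: EntryCtx; [exact: fx|apply: bb_prodP fx (bb_invP fx)].
  + by [].
- move=> A1 A2 A3 [g h] [g' h'] /(stores_ctx st) [x [y [fx fy i1]]].
  move=> /(stores_ctx st) [x' [y' [fx' fy' i2]]].
  exists rule_comp; eexists; eexists; split; first by do 2!right; left.
  + apply: (isem_find i1); first reflexivity.
    apply: (isem_find i2); first by rewrite /= {1}/upd /= eqxx.
    by do 2!apply: isem_call; apply: isem_append.
  + rewrite /contents /upd /= !answer_prod.
    by apply: EntryCtx; [apply: bb_prodP fx fx'|apply: bb_prodP fy fy'].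
  + by [].
- move=> A [g h] /(stores_ctx st) [x [y [fx fy i1]]].
  exists rule_inv; eexists; eexists; split; first by do 3!right; left.
  + apply: (isem_find i1); first by rewrite /= {1}/upd /= eqxx.
    by do 2!apply: isem_call; apply: isem_append.
  + rewrite /contents /upd /= !answer_inv.
    by apply: EntryCtx; apply: bb_invP.
  + by [].
- move=> A g /(stores_val st) [x fx i1].
  exists rule_id; eexists; eexists; split; first by do 4!right; left.
  + apply: (isem_find i1); first reflexivity.
    by do 2!apply: isem_call; apply: isem_append.
  + rewrite /contents /upd /= !answer_inv answer_prod.
    have -> : (1 = (g * g^-1, g * g^-1) :> bb_group B * bb_group B)%g by rewrite mulgV.
    by apply: EntryCtx; apply: bb_prodP fx (bb_invP fx).
  + by [].
- move=> A1 A2 [g h] k /(stores_ctx st) [x [y [fx fy i1]]] /(stores_val st) [z fz i2].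
  exists rule_act; eexists; eexists; split; first by do 5!right; left.
  + apply: (isem_find i1); first reflexivity.
    apply: (isem_find i2); first by rewrite /= {1}/upd /= eqxx.
    by do 3!apply: isem_call; apply: isem_append.
  + rewrite /contents /upd /= answer_inv !answer_prod.
    by apply: EntryVal; apply: bb_prodP (bb_invP fy); apply: bb_prodP fx fz.
  + by [].
Qed.

End Rules.

(** * The main program *)

(** The two [skip] pass over the unary numbers b and c. *)
Definition start_cmd : cmd 7 :=
  Seq (rewind None) (Seq (Do (on_tape None (step_any MoveRight)))
    (Seq (skip 7) (Seq (skip 7) (load R0)))).

Fixpoint alts (cs : seq (cmd 7)) : cmd 7 :=
  if cs is c :: cs' then Alt c (alts cs') else Do (nop 7).

Definition find_final : seq (instr 7) := [:: Find (Some false) [:: Compare R0; Fetch R1]].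

Definition guess_prim (a : bool) : prim 7 :=
  Prim ord0 (fun _ y x => Some ((Some a, MoveRight), (y, Stay), (x, Stay))) None.

Definition check_prim : prim 7 :=
  Prim ord0 (fun z y x => if z == Some true then Some ((z, Stay), (y, Stay), (x, Stay))
                          else None) None.

(** The guessed certificate may have any length: [id] looks at its first c bits only, and the clock
    cuts off a guess that never ends. *)
Definition final_cmd : cmd 7 :=
  Seq (prog_cmd find_final) (Seq (reset 7) (Seq (emit R1)
    (Seq (Star (Alt (Do (guess_prim true)) (Do (guess_prim false))))
      (Seq (Do (query_prim 7 QId)) (Do check_prim))))).

Definition main_cmd : cmd 7 :=
  Seq start_cmd (Seq (Star (alts (map (@prog_cmd 7) rules))) final_cmd).

Definition empty_regs : 'I_8 -> seq bool := fun=> [::].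
Definition start_regs (header : seq (seq bool)) : 'I_8 -> seq bool :=
  upd empty_regs R0 (nth [::] header 2).

Section Main.

Variable B : blackBox.

Lemma exec_alts cs s s' n : exec B (alts cs) s s' n ->
  s' = s \/ exists c m, List.In c cs /\ exec B c s s' m.
Proof.
elim: cs => [|c cs IH]; first by move/exec_Do; rewrite lstep_nop => -[->]; left.
case/exec_Alt => [e|/IH [->|[d [m [i e]]]]]; [right|by left|right].
  by exists c, n; split=> //; left.
by exists d, m; split=> //; right.
Qed.

Lemma alts_exec cs c s s' n : List.In c cs -> exec B c s s' n -> exec B (alts cs) s s' n.
Proof.
elim: cs => //= d cs IH [<-|i] e; first exact: ExecAltL.
by apply: ExecAltR; apply: IH.
Qed.

Lemma lstep_guess a w W p rg :
  lstep B (guess_prim a) (at_rest (bit_tape w (size w)) W p rg) =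
  Some (at_rest (bit_tape (rcons w a) (size (rcons w a))) W p rg).
Proof.
rewrite -[lstep _ _ _]/(Some (LState (fwrite (Some a, MoveRight) (bit_tape w (size w)))
  (fwrite (fread (word_tape W p), Stay) (word_tape W p))
  (upd (reg_tapes rg) ord0 (fwrite (fread (reg_tapes rg ord0), Stay) (reg_tapes rg ord0))))).
by rewrite !fwrite_stay upd_id bit_tape_append size_rcons.
Qed.

Lemma lstep_check a W p rg : lstep B check_prim (at_rest (bit_tape a 0) W p rg) =
  if ohead a == Some true then Some (at_rest (bit_tape a 0) W p rg) else None.
Proof.
have e : fread (bit_tape a 0) = ohead a by case: a.
rewrite /lstep /check_prim /p_fun /= e; case: eqP => //= ea.
by rewrite -e !fwrite_stay upd_id.
Qed.

Section Run.

Variables (header : seq (seq bool)) (F : nat).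
Hypothesis header3 : size header = 3.
Hypothesis bF : bb_b B + 1 <= F.

Local Notation state_of := (state_of header).


Lemma spec_start o es p : p <= (size (store_word header es)).+1 -> exists s',
  spec B start_cmd (at_rest o (store_word header es) p empty_regs) s'
     (5 * size (store_word header es) + 50) /\ state_of (es, start_regs header) s'.
Proof.
move=> le.
case: header header3 => [|h1 [|h2 [|h3 [|]]]] //= _ in le *.
have h0 := spec_store_rewind B o empty_regs le.
have hr : spec B (Do (on_tape None (step_any MoveRight)))
    (at_rest o (store_word [:: h1; h2; h3] es) 0 empty_regs)
    (at_rest o (store_word [:: h1; h2; h3] es) 1 empty_regs) 1.
  exact: spec_Do (lstep_any B (k := None) MoveRight _).
set v := flatten (map entry_word es).
have ew : store_word [:: h1; h2; h3] es = field h1 ++ field h2 ++ field h3 ++ v.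
  by rewrite /store_word /= cats0 -!catA.
have sk1 := spec_skip B o [::] h1 (field h2 ++ field h3 ++ v) empty_regs.
have sk2 := spec_skip B o (field h1) h2 (field h3 ++ v) empty_regs.
have ld := spec_load B R0 o (field h1 ++ field h2) h3 v empty_regs.
rewrite -!catA !size_cat !size_field in sk1 sk2 ld; rewrite addnS in ld.
eexists; split.
  apply: spec_leq; last first.
    apply: (spec_Seq h0); apply: (spec_Seq hr); rewrite ew.
    apply: (spec_Seq sk1); apply: (spec_Seq sk2).
    exact: ld.
  by rewrite ew in le *; rewrite !size_cat !size_field in le *; rewrite /=; lia.
exists o; eexists; split; last by rewrite /= ew.
by rewrite /= ew !size_cat !size_field; lia.
Qed.

Lemma final_sound x s s' m : bounded F x -> state_of x s -> exec B final_cmd s s' m ->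
  exists w a, (Some false, [:: x.2 R0; w]) \in x.1 /\ answer_to B QId (w ++ a) = [:: true].
Proof.
move=> bx xs /exec_Seq [s1 [k1 [k2 [e1 e2 _]]]].
have [//|y [z [ws i [rg em ->]] ->] ys] := prog_sound header3 bF _ bx xs e1.
have [w ew] : exists w, ws = [:: x.2 R0; w] /\ rg R1 = w.
  by case: ws em {i} => [|w1 [|w2 [|]]] //=; case: eqP => // <- [<-]; exists w2.
case: ew => ew rw; exists w.
have [o [p [_ es1]]] := ys; rewrite es1 /= in e2.
case/exec_Seq: e2 => s2 [k3 [k4 [/(spec_reset B o _ p rg).2 -> + _]]].
case/exec_Seq => s3 [k5 [k6 [/(spec_emit B R1 [::] _ p rg).2 -> + _]]].
rewrite cat0s rw; case/exec_Seq => s4 [k7 [k8 [eg + _]]].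
have [a ea] : exists a,
    s4 = at_rest (bit_tape (w ++ a) (size (w ++ a))) (store_word header x.1) p rg.
  apply: (exec_Star_inv (P := fun s => exists a,
    s = at_rest (bit_tape (w ++ a) (size (w ++ a))) (store_word header x.1) p rg)) eg.
    move=> t t' n [a ->] /exec_Alt [] /exec_Do; rewrite lstep_guess => -[<-];
      by rewrite rcons_cat; eexists; reflexivity.
  by exists [::]; rewrite cats0.
rewrite ea => /exec_Seq [s5 [k9 [k10 [/(spec_query B QId _ _ _ p rg).2 -> /exec_Do + _]]]].
rewrite lstep_check; have [z0 ez] : exists c, answer_to B QId (w ++ a) = [:: c] by eexists.
by rewrite ez; case: z0 ez => //= ez _; exists a; rewrite -ew.
Qed.

Lemma final_reach x s w a M : bounded F x -> state_of x s ->
  (Some false, [:: x.2 R0; w]) \in x.1 -> answer_to B QId (w ++ a) = [:: true] ->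
  size (store_word header x.1) + (4 * F + 5) <= M ->
  exists s' m, m <= instr_cost F M + 2 * F + size a + 30 /\ exec B final_cmd s s' m.
Proof.
move=> bx xs i ea lM.
have [||s1 [k1 [l1 e1 [o [p [_ es1]]]]]] := prog_reach header3 bF (l := find_final)
  (y := (x.1, upd x.2 R1 w)) (M := M) isT bx xs.
- exists (x.1, upd x.2 R1 w) => //; exists [:: x.2 R0; w] => //.
  by exists (upd x.2 R1 w); rewrite //= eqxx.
- by rewrite /= mul1n.
rewrite es1 /= in e1.
have sw : size w <= F.
  by case: bx => _ /allP /(_ _ i) /= /and3P[].
have [[k2 [l2 e2]] _] := spec_reset B o (store_word header x.1) p (upd x.2 R1 w).
have [[k3 [l3 e3]] _] := spec_emit B R1 [::] (store_word header x.1) p (upd x.2 R1 w).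
have [k4 [l4 e4]] : exists k, k <= size a + 2 /\
  exec B (Star (Alt (Do (guess_prim true)) (Do (guess_prim false))))
    (at_rest (bit_tape w (size w)) (store_word header x.1) p (upd x.2 R1 w))
    (at_rest (bit_tape (w ++ a) (size (w ++ a))) (store_word header x.1) p (upd x.2 R1 w)) k.
  elim: a w (upd x.2 R1 w) {ea i es1 e1 e2 e3 l3 sw} => [|c a IH] w rg.
    by exists 2; split=> //; rewrite cats0; apply: ExecStar0.
  have [k [lk ek]] := IH (rcons w c) rg.
  exists (1 + k); split; first by rewrite /=; lia.
  rewrite -cat_rcons; apply: ExecStarS ek.
  by case: c; [apply: ExecAltL|apply: ExecAltR]; apply: ExecDo; rewrite lstep_guess.
have [[k5 [l5 e5]] _] := spec_query B QId (w ++ a) (size (w ++ a))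
  (store_word header x.1) p (upd x.2 R1 w).
rewrite cat0s upd_same in e3 l3.
eexists; exists (k1 + (k2 + (k3 + (k4 + (k5 + 1))))); split; first by rewrite /= in l1; lia.
apply: (ExecSeq e1); apply: (ExecSeq e2); apply: (ExecSeq e3); apply: (ExecSeq e4).
apply: (ExecSeq e5); apply: ExecDo; rewrite lstep_check ea; reflexivity.
Qed.

Lemma rules_wf l : List.In l rules -> all (@wf_instr 7) l && (size l <= 6).
Proof. by do 6!(case=> [<- //|]). Qed.

Section Grammar.

Variables (Gr : cfg (bb_group B)) (code : nonterm Gr -> seq bool) (A0 : nonterm Gr).
Hypothesis codeI : injective code.
Hypothesis start_code : nth [::] header 2 = code A0.

Lemma main_sound o p es s' m : bounded F (es, start_regs header) ->
  p <= (size (store_word header es)).+1 -> sound_store code es ->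
  exec B main_cmd (at_rest o (store_word header es) p empty_regs) s' m -> generates A0 1%g.
Proof.
move=> bx lp so /exec_Seq [s1 [k1 [k2 [e1 + _]]]].
have [s1' [sp st]] := spec_start o lp; rewrite (sp.2 _ _ e1) {e1 s1}.
case/exec_Seq => s2 [k3 [k4 [eS eF _]]].
(* Invariant of the guessing loop: only true facts are stored, fields stay short, and [R0] still
   holds the code of the start symbol. *)
pose P s := exists x, [/\ state_of x s, bounded F x, sound_store code x.1 & x.2 R0 = code A0].
have [x [xs bx' so' x0]] : P s2.
  apply: (exec_Star_inv (P := P)) eS; last first.
    by exists (es, start_regs header); split=> //; rewrite /= /start_regs upd_same.
  move=> t t' n [x [xs bx' so' x0]] /exec_alts [->|]; first by exists x.
  case=> c [j [/In_map [l <- il] ex]].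
  have /andP[wl _] := rules_wf il.
  have [y sem ys] := prog_sound header3 bF wl bx' xs ex.
  have [so'' y0] := rules_sound codeI il so' sem.
  exists y; split=> //; last by rewrite y0.
  by have [] := isem_bounded header3 bF wl bx' sem.
have [w [a [i ea]]] := final_sound bx' xs eF.
have [A [z [g [fz tz [eA ew]]]]] := sound_valE (so' _ i).
rewrite x0 in eA; rewrite (codeI eA) ew in tz ea *.
have [y ey] := answer_id z a; rewrite ea in ey.
have -> // : 1%g = g.
by apply/esym/(bb_idP fz); exists y; case: ey => <-.
Qed.

(** A rule has at most 6 instructions, each lengthening the store by at most 4F + 5; the extra unit
    in [m.+1] leaves room for the final search. *)
Lemma rules_reach m G G' x s M : derivs m G G' -> stores code x.1 G -> bounded F x ->
  state_of x s -> size (store_word header x.1) + m.+1 * (6 * (4 * F + 5)) <= M ->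
  exists s' y n, [/\ n <= m * (6 * instr_cost F M + 1) + 2,
    exec B (Star (alts (map (@prog_cmd 7) rules))) s s' n, state_of y s' &
    [/\ stores code y.1 G', bounded F y, y.2 R0 = x.2 R0 & 
       size (store_word header y.1) + (4 * F + 5) <= M]].
Proof.
move=> d; elim: d x s => {m G G'} [G|m G G' f inf _ IH] x s st bx xs lM.
  exists s, x, 2; split=> //; first exact: ExecStar0.
  by split=> //; lia.
have [l [e [rg [il sem ef rg0]]]] := rules_complete x.2 st inf.
have /andP[wl sl] := rules_wf il.
rewrite -surjective_pairing in sem.
have [bz lz] := isem_bounded header3 bF wl bx sem.
have lz' : size l * (4 * F + 5) <= 6 * (4 * F + 5) by rewrite leq_mul2r sl orbT.
have [|s1 [k1 [l1 e1 s1z]]] := prog_reach header3 bF (M := M) wl bx xs sem; first by lia.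
have [|s' [y [k2 [l2 e2 ys [sty by_ y0 ly]]]]] :=
  IH (rcons x.1 e, rg) s1 (stores_rcons st ef) bz s1z.
  by rewrite /= in lz *; lia.
exists s', y, (k1 + k2); split=> //.
- have : size l * instr_cost F M <= 6 * instr_cost F M by rewrite leq_mul2r sl orbT.
  by lia.
- apply: ExecStarS e2; apply: (alts_exec _ e1); apply/In_map; by exists l.
- by split=> //; rewrite y0.
Qed.

Lemma main_reach o p es m G G' M : bounded F (es, start_regs header) ->
  p <= (size (store_word header es)).+1 -> stores code es G -> derivs m G G' ->
  valf A0 1%g \in G' -> bb_c B <= F ->
  size (store_word header es) + m.+1 * (6 * (4 * F + 5)) <= M ->
  exists s' n,
    n <= 5 * M + 50 + (m * (6 * instr_cost F M + 1) + 2) + (instr_cost F M + 3 * F + 30) /\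
    exec B main_cmd (at_rest o (store_word header es) p empty_regs) s' n.
Proof.
move=> bx lp st d i cF lM.
have [s1 [[[k1 [l1 e1]] _] st1]] := spec_start o lp.
have [s2 [y [k2 [l2 e2 ys [sty bdy y0 ly]]]]] :=
  rules_reach d (x := (es, start_regs header)) st bx st1 lM.
have [w fw iw] := stores_val sty i.
have [v idv] := (bb_idP fw).1 (erefl _).
have [||s3 [k3 [l3 e3]]] := final_reach (w := w) (a := v) (M := M) bdy ys _ _ ly.
- by rewrite y0 /= /start_regs upd_same start_code.
- by rewrite answer_id_tuple idv.
exists s3, (k1 + (k2 + k3)); split.
  by rewrite size_tuple in l3; lia.
by apply: (ExecSeq e1); apply: (ExecSeq e2).
Qed.

End Grammar.
End Run.
End Main.

(** * Encodings and bounds *)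

(** The two summands are at most 20 q^2 and 18 q^k q^2, and 64 q^2 <= q^5 for q >= 4. *)
Lemma derivation_bound q k l b : 4 <= q -> l < q -> b < q ->
  (5 * (l * (1 + 3 * b + l)) + (l ^ k).*2 * tree_cost b).+1 <= q ^ (k + 5).
Proof.
move=> q4 lq bq; have t1 : 0 < q ^ k by rewrite expn_gt0; lia.
have lt : l ^ k <= q ^ k by apply: leq_expn2r; apply: ltnW.
rewrite expnD; set t := q ^ k in t1 lt *; set u := l ^ k in lt *.
have h1 : l * (1 + 3 * b + l) <= 4 * (q * q).
  by rewrite mulnCA leq_mul ?(ltnW lq) //; lia.
have h2 : tree_cost b <= 9 * (q * q).
  rewrite /tree_cost; have : (2 * b + 1) * (4 * b + 3) <= (2 * q) * (4 * q) by apply: leq_mul; lia.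
  by nia.
have h3 : u.*2 * tree_cost b <= t.*2 * (9 * (q * q)).
  by apply: leq_mul => //; rewrite leq_double.
have h4 : 64 * (q * q) <= q ^ 5.
  rewrite (expnD q 3 2) -[q ^ 2]/(q * q) leq_mul2r; apply/orP; right.
  exact: (leq_expn2r 3 q4).
have h5 : t * (64 * (q * q)) <= t * q ^ 5 by rewrite leq_mul2l h4 orbT.
nia.
Qed.

(** With a = q^(k+5), each of the m rules scans a store of length O(a q), so the time is O(a^2 q). A
    spare factor q^9 absorbs the constants, and 2 (k+5) + 1 + 9 = 2k + 20. *)
Lemma running_time_bound q k m n F : 4 <= q -> m.+1 <= q ^ (k + 5) -> n < q -> F <= q ->
  let M := n + m.+1 * (6 * (4 * F + 5)) in
  5 * M + 50 + (m * (6 * instr_cost F M + 1) + 2) + (instr_cost F M + 3 * F + 30)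
    < q ^ (2 * k + 20).
Proof.
move=> q4; have a1 : 0 < q ^ (k + 5) by rewrite expn_gt0; lia.
have -> : q ^ (2 * k + 20) = q ^ (k + 5) * q ^ (k + 5) * (q * q ^ 9).
  by rewrite -expnS -!expnD; congr expn; lia.
set a := q ^ (k + 5) in a1 *; move=> ma nq Fq /=; set M := n + _.
have hM : M <= 37 * (a * q).
  have : m.+1 * (6 * (4 * F + 5)) <= a * (36 * q) by apply: leq_mul => //; lia.
  by rewrite /M; nia.
have hc : instr_cost F M <= 448 * (a * q) by rewrite /instr_cost; nia.
set c := instr_cost F M in hc *.
have hm : m * (6 * c + 1) <= a * (6 * (448 * (a * q)) + 1) by apply: leq_mul; lia.
have aq : a * q <= a * a * q by rewrite leq_mul2r leq_pmulr ?orbT.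
have a2 : a <= a * a * q by nia.
have q1 : q <= a * a * q by nia.
have q9 : 16384 <= q ^ 9 by apply: (leq_trans (n := 4 ^ 9)) => //; apply: leq_expn2r.
have h : 3500 * (a * a * q) < a * a * (q * q ^ 9).
  by rewrite [X in _ < X]mulnA [X in _ < X]mulnC ltn_mul2r; apply/andP; split; [nia|lia].
have e : a * (6 * (448 * (a * q)) + 1) = 2688 * (a * a * q) + a by nia.
lia.
Qed.

(** Choosing one name for each element embeds G into the strings of b bits. *)
Lemma card_blackbox (B : blackBox) : #|bb_group B| <= 2 ^ bb_b B.
Proof.
pose name g := odflt (nseq_tuple (bb_b B) false) [pick x | bb_f x == Some g].
have nameK g : bb_f (name g) = Some g.
  rewrite /name; case: pickP => [x /eqP //|no].
  by have [x] := bb_fP g; have := no x => /eqP.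
rewrite -card_bool -card_tuple; apply: (leq_card name) => g h e.
by apply: Some_inj; rewrite -!nameK e.
Qed.

(** * From an encoded grammar to the initial store *)

Section Encoding.

Variables (B : blackBox) (Gr : cfg (bb_group B)) (code : nonterm Gr -> seq bool).
Variable ps : seq (production (nonterm Gr) ((bb_b B).-tuple bool)).

Definition entry_of (p : production (nonterm Gr) ((bb_b B).-tuple bool)) : entry :=
  match p with
  | (A, inl (A1, A2)) => (Some true, [:: code A; code A1; code A2])
  | (A, inr x) => (Some false, [:: code A; tval x])
  end.

Lemma entry_wordE p : entry_word (entry_of p) = production_word code p.
Proof. by case: p => A [[A1 A2]|x] /=; rewrite /entry_word /= cats0. Qed.

Definition facts_of : seq (fact Gr) :=
  pmap (fun p => if p is (A, inr x) then omap (valf A) (bb_f x) else None) ps.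

Hypothesis prods_ps : forall A r, (A, r) \in prods Gr <->
  exists2 r', (A, r') \in ps & named_rhs r' = Some r.
Hypothesis ps_named : forall A r', (A, r') \in ps -> named_rhs r' <> None.

Lemma sound_entries : sound_store code (map entry_of ps).
Proof.
move=> _ /mapP [[A [[A1 A2]|x]] i ->] /=.
  by left; exists A, A1, A2; split=> //; apply/prods_ps; exists (inl (A1, A2)).
right; have := ps_named i; rewrite /=; case fx: (bb_f x) => [g|] // _.
exists (valf A g); first exact: EntryVal.
exists (DLeaf A g); split=> //=; apply/prods_ps; exists (inr x) => //.
by rewrite /= fx.
Qed.

Lemma stores_entries : stores code (map entry_of ps) facts_of.
Proof.
split=> [A A1 A2 /prods_ps [[[A3 A4]|x] i /=]|f].
- by case=> <- <-; apply/mapP; exists (A, inl (A3, A4)).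
- by case: (bb_f x).
rewrite mem_pmap => /mapP [[A [//|x]] i].
case fx: (bb_f x) => [g|] // -[->]; exists (Some false, [:: code A; tval x]).
  by apply/mapP; exists (A, inr x).
exact: EntryVal.
Qed.

Lemma terminal_facts A g : (A, inr g) \in prods Gr -> valf A g \in facts_of.
Proof.
case/prods_ps => -[[//]|x] i /=; case fx: (bb_f x) => [h|] // [<-].
by rewrite mem_pmap; apply/mapP; exists (A, inr x) => //=; rewrite fx.
Qed.

Lemma card_lhs : #|lhs Gr| <= size ps.
Proof.
have -> : size ps = size (map fst ps) by rewrite size_map.
apply: leq_trans (card_size _); apply: subset_leq_card; apply/subsetP => A.
rewrite inE => /existsP [r /prods_ps [r' i _]].
by apply/mapP; exists (A, r').
Qed.

End Encoding.

Lemma size_entries (es : seq entry) : size es <= size (flatten (map entry_word es)).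
Proof.
elim: es => [//|e es IH].
have -> : size (flatten (map entry_word (e :: es))) =
  size (entry_word e) + size (flatten (map entry_word es)) := size_cat _ _.
by rewrite -[size (e :: es)]add1n; apply: leq_add.
Qed.

Lemma size_in_flatten (T : eqType) (s : seq (seq T)) x : x \in s -> size x <= size (flatten s).
Proof.
elim: s => //= y s IH; rewrite inE size_cat => /predU1P [->|/IH le]; first exact: leq_addr.
exact: leq_trans le (leq_addl _ _).
Qed.

Lemma entry_field_size (es : seq entry) e w : e \in es -> w \in e.2 ->
  size w <= size (flatten (map entry_word es)).
Proof.
move=> /(map_f entry_word) /size_in_flatten le /(map_f field) /size_in_flatten le'.
apply: leq_trans le; rewrite /entry_word /=.
by rewrite size_field in le'; apply: ltnW; apply: leq_trans le' _.
Qed.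

Lemma input_wordE b c w (es : seq entry) :
  input_word b c (terminated w ++ flatten (map entry_word es)) =
  store_word [:: nseq b true; nseq c true; w] es.
Proof.
rewrite /input_word /store_word /field /= cats0 -!catA !map_nseq -!cats1 -!catA /=.
by rewrite /terminated -cats1 -catA.
Qed.

Lemma start_stateE B X : @start_state 7 B X =
  at_rest (fblank bool) (input_word (bb_b B) (bb_c B) X)
    (size (input_word (bb_b B) (bb_c B) X)).+1 empty_regs.
Proof.
congr LState; apply: functional_extensionality => i.
by congr pair; apply: functional_extensionality => -[|j] //=; rewrite nth_nil.
Qed.

Theorem theorem4p2 (k : nat) (hk : 1 <= k) :
  in_NP_restricted (P := cf_membership) (fun G Gr => CFG k Gr).
Proof.
(* The number of clock heads: the (n+2)^d - 1 steps of the clock have to cover the guessed run, see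
   [running_time_bound]. *)
pose d := 2 * k + 20.
exists (@machine 7 d (node main_cmd) (edges (c := main_cmd))).
(* The input word has length n = y + 2 with y = b + c + |X|, so the bound of [machine_halts] has n +
   2 = y + 4 and n + 3 = y + 5. *)
exists (('X + 4%:P) ^+ d + 'X + 5%:P)%R; split.
  move=> B X m c rm; have := machine_halts rm.
  rewrite /input_word size_cat size_nseq /= size_cat size_nseq /=.
  rewrite !(hornerD, horner_exp, hornerX, hornerC) natrXE !natrDE !natn.
  set y := bb_b B + bb_c B + size X.
  have -> : bb_b B + (bb_c B + (size X).+1).+1 = y + 2 by rewrite /y; lia.
  rewrite (_ : (y + 2).+2 = y + 4); last by lia.
  by move/leq_trans; apply; lia.
move=> B Gr X cfgk [code [ps [codeI prods_ps ps_named eX]]].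
set es := map (entry_of code) ps.
have {}eX : X = terminated (code (start Gr)) ++ flatten (map entry_word es).
  rewrite eX /es -map_comp; congr (_ ++ flatten _).
  by apply: eq_map => p; rewrite /= entry_wordE.
pose header := [:: nseq (bb_b B) true; nseq (bb_c B) true; code (start Gr)].
have eW : input_word (bb_b B) (bb_c B) X = store_word header es by rewrite eX input_wordE.
pose K := size (flatten (map entry_word es)).
have sW : size (store_word header es) = bb_b B + bb_c B + size (code (start Gr)) + K + 3.
  rewrite /store_word size_cat [flatten (map field _)]/= cats0 !size_cat !size_field !size_nseq.
  by rewrite -/K; lia.
set n := size (store_word header es) in sW.
(* One bound for all strings handled: fields of the store, certificates and answers of the
   oracle. *)
pose F := n.+1.
have bF : bb_b B + 1 <= F by rewrite /F; lia.
have bdd : bounded F (es, start_regs header).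
  split=> /=.
  - by apply/allP => _ /mapP [[A [[A1 A2]|x]] _ ->].
  - apply/allP => e ie; apply/allP => w iw.
    have le : size w <= K := entry_field_size ie iw.
    by apply: leq_trans le _; rewrite /F; lia.
  - by move=> i; rewrite /start_regs /upd; case: eqP => _ //=; rewrite /F; lia.
have so : sound_store code es := sound_entries prods_ps ps_named.
split.
  case/machine_sound => s' [m /walk_exec]; rewrite start_stateE eW => ex.
  have [t [ut rt vt]] :=
    main_sound (header := header) (erefl _) bF codeI (erefl _) bdd (leqnn _) so ex.
  by apply/languageP; exists t.
move/languageP => [t dt vt].
have [m [G [lm dG sG]]] := tree_derivs (card_blackbox B) (terminal_facts prods_ps) cfgk dt.
(* All estimates are in q = n + 2, the base of the clock; the three marks of the header make n at
   least 3. *)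
have lq : #|lhs Gr| < n.+2.
  have := card_lhs prods_ps; have := size_entries es; rewrite {1}/es size_map; lia.
have bq : bb_b B < n.+2 by lia.
have q4 : 3 < n.+2 by lia.
have mq : m.+1 <= n.+2 ^ (k + 5).
  by apply: leq_trans (derivation_bound k q4 lq bq); rewrite ltnS.
have i1 : valf (start Gr) 1%g \in G by rewrite -vt sG ?mem_head.
have cF : bb_c B <= F by rewrite /F; lia.
have [s' [j [lj ej]]] :=
  main_reach (header := header) (erefl _) bF (A0 := start Gr) (erefl _) (fblank bool)
  bdd (leqnn _) (stores_entries code prods_ps) dG i1 cF (leqnn _).
have lt := running_time_bound q4 mq (leqnSn n.+1) (leqnSn n.+1).
apply: (machine_complete (s' := s') (m := j)).
  by apply: exec_walk; rewrite start_stateE eW.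
rewrite eW -/n; exact: leq_ltn_trans lj lt.
Qed.
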